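(* Let $\Omega_0,\Omega_1$ be Polish spaces with Borel $\sigma$-algebras, let $\mathcal E\subseteq\Omega_0\times\Omega_1$ be closed with all neighborhoods $N_1(x)$ ($x\in\Omega_0$) and $N_0(y)$ ($y\in\Omega_1$) nonempty, and let $\nu_0,\nu_1$ be finite nonzero measures on $\Omega_0,\Omega_1$. Fix $\iota\in\{0,1\}$ and $\bar\iota=1-\iota$. Let $\vartheta:[0,\infty)\to\mathbb R\cup\{+\infty\}$ be proper, lower semicontinuous, and strictly convex on $\operatorname{dom}\vartheta$. Let $\pi^\star\in\Pi_\iota^{\mathcal E}$ satisfy $$\mathsf D_\vartheta\bigl(\nu_{\bar\iota}^{(\pi^\star)}\,\|\,\nu_{\bar\iota}\bigr)=\inf_{\pi\in\Pi_\iota^{\mathcal E}}\mathsf D_\vartheta\bigl(\nu_{\bar\iota}^{(\pi)}\,\|\,\nu_{\bar\iota}\bigr)<+\infty .$$ Then $\pi^\star$ is level-optimal maximin from side $\iota$ to side $\bar\iota$. In particular, level-optimal maximin refinements $\pi\in\Pi^{\mathcal E}_\iota$ exist.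
   Context: Notation. $\mathcal M_+(\Omega)$ is the set of finite nonnegative measures; $T_\#$ is pushforward; $\mathrm{pr}_\iota:\Omega_0\times\Omega_1\to\Omega_\iota$ is the projection. $N_1(x)=\{y\in\Omega_1:(x,y)\in\mathcal E\}$, $N_0(y)=\{x\in\Omega_0:(x,y)\in\mathcal E\}$. Refinements and payloads. $\Pi^{\mathcal E}_\iota=\{\pi\in\mathcal M_+(\Omega_0\times\Omega_1):\pi(\mathcal E^c)=0,\ (\mathrm{pr}_\iota)_\#\pi=\nu_\iota\}$, and $\nu_{\bar\iota}^{(\pi)}=(\mathrm{pr}_{\bar\iota})_\#\pi$. $\vartheta$-divergence. For convex proper $\vartheta:[0,\infty)\to\mathbb R\cup\{+\infty\}$, $\operatorname{dom}\vartheta=\{\vartheta<\infty\}$, $\vartheta'_\infty=\lim_{t\to\infty}\vartheta(t)/t\in\mathbb R\cup\{+\infty\}$. For finite measures $P,Q$ with Lebesgue decomposition $P=rQ+P_\perp$ ($P_\perp\perp Q$), $\mathsf D_\vartheta(P\|Q)=\int\vartheta(r)\,dQ+\vartheta'_\infty P_\perp(\Omega)$, where the last term is $0$ if $P_\perp=0$, and $\mathsf D_\vartheta(P\|Q)=+\infty$ if $\vartheta'_\infty=+\infty$ and $P_\perp\ne0$. Strict convexity on $\operatorname{dom}\vartheta$ means $\operatorname{dom}\vartheta$ is convex and the convexity inequality is strict for distinct points of $\operatorname{dom}\vartheta$ and weights in $(0,1)$. Level-optimal maximin. For $\pi\in\Pi^{\mathcal E}_\iota$ let $\nu_{\bar\iota}^{(\pi)}=r\,\nu_{\bar\iota}+P^\perp$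 be the Lebesgue decomposition with respect to $\nu_{\bar\iota}$. For $t\ge0$, $\mathsf{Feas}_{\bar\iota}(t)$ is the set of $\sigma\in\mathcal M_+(\Omega_0\times\Omega_1)$ with $\sigma(\mathcal E^c)=0$, $(\mathrm{pr}_\iota)_\#\sigma\le\nu_\iota$, $(\mathrm{pr}_{\bar\iota})_\#\sigma\le t\,\nu_{\bar\iota}$; $\mathsf{Fit}_{\bar\iota}(t)=\sup\{\sigma(\Omega_0\times\Omega_1):\sigma\in\mathsf{Feas}_{\bar\iota}(t)\}$. $\pi$ is level-optimal maximin (from side $\iota$ to side $\bar\iota$) if $\int(r\wedge t)\,d\nu_{\bar\iota}=\mathsf{Fit}_{\bar\iota}(t)$ for every $t>0$. *)

(* Defs.v *)
From HB Require Import structures.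
From mathcomp Require Import all_boot all_order all_algebra.
From mathcomp Require Import all_classical all_reals all_analysis.

Set Implicit Arguments.
Unset Strict Implicit.
Unset Printing Implicit Defensive.

Import Order.TTheory GRing.Theory Num.Theory.
Import numFieldNormedType.Exports.

Local Open Scope classical_set_scope.
Local Open Scope ring_scope.

(* The topology of [T] is induced by a complete separable metric. *)
Definition polish (R : realType) (T : topologicalType) : Prop :=
  exists d : T -> T -> R,
    [/\ [/\ forall x y, 0 <= d x y,
            forall x y, d x y = 0 <-> x = y,
            forall x y, d x y = d y x &
            forall x y z, d x z <= d x y + d y z],
        forall (x : T) (A : set T),
          nbhs x A <-> exists2 e : R, 0 < e & [set y | d x y < e] `<=` A,
        forall u : nat -> T,
          (forall e : R, 0 < e -> exists N : nat, forall m n : nat,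
             (N <= m)%N -> (N <= n)%N -> d (u m) (u n) < e) ->
          exists l : T, u @ \oo --> l &
        exists2 D : set T, countable D & dense D].

(* Carrier [T] with its Borel sigma-algebra. The type must be pointed; this
   costs nothing, as spaces carrying a nonzero measure are nonempty. *)
Notation borel T := (g_sigma_algebraType (@open T)).

Notation prodspace Omega := (borel (Omega false) * borel (Omega true))%type.

Section divergence.
Context d (T : measurableType d) (R : realType).
Local Open Scope ereal_scope.

Definition mutually_singular (mu nu : set T -> \bar R) : Prop :=
  exists N : set T, [/\ measurable N, nu N = 0 & mu (~` N) = 0].

Definition is_lebesgue_decomposition (P Q : set T -> \bar R)
    (r : T -> R) (Pperp : {finite_measure set T -> \bar R}) : Prop :=
  [/\ measurable_fun [set: T] r, forall x, (0 <= r x)%R,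
      mutually_singular Pperp Q &
      forall A, measurable A -> P A = \int[Q]_(x in A) (r x)%:E + Pperp A].

(* The decomposition exists for finite measures, with [r] unique [Q]-almost
   everywhere and [Pperp] unique; the last branch is a dummy. *)
Definition lebesgue_decomposition (P Q : set T -> \bar R) :
    (T -> R) * {finite_measure set T -> \bar R} :=
  if pselect (exists rp : (T -> R) * {finite_measure set T -> \bar R},
                is_lebesgue_decomposition P Q rp.1 rp.2) is left h
  then sval (cid h) else (fun=> 0%R, mzero : {finite_measure set T -> \bar R}).

Definition density (P Q : set T -> \bar R) : T -> R :=
  (lebesgue_decomposition P Q).1.

Definition singular_part (P Q : set T -> \bar R) :
    {finite_measure set T -> \bar R} :=
  (lebesgue_decomposition P Q).2.

(* Functions [theta] on the half-line [0, +oo[ are encoded as total functions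
   on [R] whose values at negative arguments are never used. *)
Definition recession (theta : R -> \bar R) : \bar R :=
  lim ((theta t * (t^-1)%:E) @[t --> +oo%R]).

(* In the second term, [0 * +oo = 0]. *)
Definition divergence (theta : R -> \bar R) (P Q : set T -> \bar R) : \bar R :=
  \int[Q]_x theta (density P Q x) + recession theta * singular_part P Q setT.

End divergence.

Section integrands.
Context (R : realType).
Implicit Types theta : R -> \bar R.
Local Open Scope ereal_scope.

Definition edom theta : set R := [set t | (0 <= t)%R /\ theta t < +oo].

Definition proper_nneg theta : Prop :=
  (forall t, (0 <= t)%R -> theta t != -oo) /\ edom theta !=set0.

Definition lsc_nneg theta : Prop :=
  forall t a : R, (0 <= t)%R -> a%:E < theta t ->
    \forall s \near within [set s : R | (0 <= s)%R] (nbhs t), a%:E < theta s.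

Definition strictly_convex_on_dom theta : Prop :=
  (forall a b w : R, edom theta a -> edom theta b -> (0 < w < 1)%R ->
     edom theta (w * a + (1 - w) * b)%R) /\
  (forall a b w : R, edom theta a -> edom theta b -> a <> b ->
     (0 < w < 1)%R ->
     theta (w * a + (1 - w) * b)%R < w%:E * theta a + (1 - w)%:E * theta b).

End integrands.

(* The side indices 0 and 1 are the booleans [false] and [true], and the
   opposite side of [i] is [~~ i]. *)
Section refinements.
Context (R : realType) (Omega : bool -> ptopologicalType).
Variable E : set (Omega false * Omega true)%type.
Variable nu : forall i : bool,
  {finite_measure set (borel (Omega i)) -> \bar R}.
Local Open Scope ereal_scope.
Local Notation Mplus := {finite_measure set (prodspace Omega) -> \bar R}.

Definition pr (i : bool) : prodspace Omega -> borel (Omega i) :=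
  match i with false => fst | true => snd end.

Definition refinement (i : bool) : set Mplus :=
  [set pi : Mplus | pi (~` E) = 0 /\
     forall A, measurable A -> pushforward pi (pr i) A = nu i A].

Definition payload (i : bool) (pi : Mplus) :
    set (borel (Omega (~~ i))) -> \bar R :=
  pushforward pi (pr (~~ i)).
Arguments payload : clear implicits.

Definition feas (i : bool) (t : R) : set Mplus :=
  [set sigma : Mplus | [/\ sigma (~` E) = 0,
     forall A, measurable A -> pushforward sigma (pr i) A <= nu i A &
     forall A, measurable A ->
       pushforward sigma (pr (~~ i)) A <= t%:E * nu (~~ i) A]].

Definition fit (i : bool) (t : R) : \bar R :=
  ereal_sup [set sigma setT | sigma in feas i t].

Definition level_optimal_maximin (i : bool) (pi : Mplus) : Prop :=
  forall t : R, (0 < t)%R ->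
    \int[nu (~~ i)]_y (Num.min (density (payload i pi) (nu (~~ i)) y) t)%:E
    = fit i t.

End refinements.
Arguments payload {R Omega} i pi _.

(* Main.v *)
(* Let [r] be the density of the second marginal of a minimiser [pi]. If some
   [sigma] feasible at level [t] carried more than [\int min r t], mass that [pi]
   sends to the region [r > t] could be rerouted along [sigma] to the region
   [r <= t], and by strict convexity a small such exchange would decrease the
   divergence. Conversely, truncating [pi] at level [t] gives a feasible plan.

   For existence it suffices to minimise the divergence of [1 / (1 + x)], whose
   recession constant is 0, so that only densities matter. Consider plans on [E]
   with first marginal at most [mu] and second marginal [rho nu]. By uniform
   convexity the densities along a fast minimising sequence converge almost
   everywhere; truncated at their limit, the plans have marginals dominated by
   finite measures, so an ultralimit of them is a finitely additive set function
   that tightness turns into a measure. The leftover of [mu] is then sent along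
   a measurable selection of the closed graph [E]. *)
Require Import Defs.
From HB Require Import structures.
From mathcomp Require Import all_boot all_order all_algebra.
From mathcomp Require Import all_classical all_reals all_analysis.
From mathcomp Require Import measurable_realfun.
From mathcomp Require Import ring lra.

Set Implicit Arguments.
Unset Strict Implicit.
Unset Printing Implicit Defensive.

Import Order.TTheory GRing.Theory Num.Theory.
Import numFieldNormedType.Exports.

Local Open Scope classical_set_scope.
Local Open Scope ring_scope.

(** * Metrics inducing a topology *)

(** The obstacle to existence is that only one marginal is prescribed: the second marginals of a
    minimising sequence need not be tight, and their mass may concentrate on [nu]-null sets. The
    choice of [1 / (1 + x)] makes the relaxation exact: it is bounded, so every plan has finite
    cost, and decreasing, so sending the leftover mass anywhere along [E] cannot raise the cost.

    In the exchange the first marginal must be preserved, although [pi] and [sigma] disintegrate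
    differently over it; weighting each of the two exchanged parts by the first marginal density of
    the other makes them match. The gain is measured by two chord slopes of [theta] between the two
    levels, so that [theta] may be nondifferentiable, take the value [+oo], or have a bounded
    domain. *)

Definition metrizes (R : realType) (T : topologicalType) (d : T -> T -> R) : Prop :=
  [/\ forall x y, 0 <= d x y, forall x y, d x y = 0 <-> x = y,
      forall x y, d x y = d y x & forall x y z, d x z <= d x y + d y z] /\
  forall (x : T) (A : set T),
    nbhs x A <-> exists2 e : R, 0 < e & [set y | d x y < e] `<=` A.

Section metric_topology.
Context (R : realType) (T : topologicalType) (d : T -> T -> R).
Hypothesis dm : metrizes d.

Let d0 x y : 0 <= d x y. Proof. by case: dm => -[]. Qed.
Let dE x y : d x y = 0 <-> x = y. Proof. by case: dm => -[]. Qed.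
Let dC x y : d x y = d y x. Proof. by case: dm => -[]. Qed.
Let dT x y z : d x z <= d x y + d y z. Proof. by case: dm => -[]. Qed.
Let dxx x : d x x = 0. Proof. exact/dE. Qed.
Let dN (x : T) (A : set T) :
  nbhs x A <-> exists2 e : R, 0 < e & [set y | d x y < e] `<=` A.
Proof. by case: dm. Qed.

Lemma metric_nbhs_ball x e : 0 < e -> nbhs x [set y | d x y < e].
Proof. by move=> e0; apply/dN; exists e. Qed.

Lemma metric_ball_open x e : open [set y | d x y < e].
Proof.
rewrite openE => y /= xy; apply/dN; exists (e - d x y); first by rewrite subr_gt0.
by move=> z /= yz; apply: le_lt_trans (dT x y z) _; rewrite -ltrBrDl.
Qed.

Lemma metric_cball_closed x e : closed [set y | d x y <= e].
Proof.
rewrite -openC openE => y /= /negP; rewrite -ltNge => ey; apply/dN.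
exists (d x y - e); first by rewrite subr_gt0.
move=> z /= yz; apply/negP; rewrite -ltNge -(ltrD2r (d z y)).
apply: lt_le_trans (dT x z y); rewrite (dC z y) addrC -ltrBrDr.
exact: yz.
Qed.

Lemma metric_closedP (F : set T) x : closed F ->
  (forall e, 0 < e -> exists2 y, F y & d x y < e) -> F x.
Proof.
move=> cF h; apply: cF => B /dN[e e0 eB].
by have [y Fy xy] := h e e0; exists y; split => //; exact: eB.
Qed.

Lemma metric_closureP (F : set T) x : closure F x ->
  forall e, 0 < e -> exists2 y, F y & d x y < e.
Proof.
by move=> cx e e0; have [y [Fy xy]] := cx _ (metric_nbhs_ball x e0); exists y.
Qed.

Lemma metrizes_hausdorff : hausdorff_space T.
Proof.
move=> x y h; apply/dE/eqP; rewrite eq_le d0 andbT leNgt; apply/negP => xy.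
have e0 : 0 < d x y / 2 by rewrite divr_gt0.
have [z [/= xz yz]] := h _ _ (metric_nbhs_ball x e0) (metric_nbhs_ball y e0).
by have := dT x z y; rewrite (dC z y) => /le_lt_trans - /(_ _ (ltrD xz yz)); rewrite -splitr ltxx.
Qed.

Lemma metric_open_ball (A : set T) x : open A -> A x ->
  exists2 e : R, 0 < e & [set y | d x y < e] `<=` A.
Proof. by move=> oA Ax; apply/dN; exact: open_nbhs_nbhs. Qed.

End metric_topology.

(* [F n] consists of the points at distance at least [1/(n+1)] from the
   complement of [A]. *)
Lemma metric_open_exhaustion (R : realType) (T : topologicalType)
    (d : T -> T -> R) (A : set T) : metrizes d -> open A ->
  exists F : nat -> set T, [/\ forall n, closed (F n), nondecreasing_seq F,
    forall n, F n `<=` A & forall x, A x -> exists n, nbhs x (F n)].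
Proof.
move=> dm oA; have [[d0 dE dC dT] _] := dm.
pose F n := [set x | forall y, ~ A y -> (n.+1%:R^-1 <= d x y)%R].
exists F; split.
- move=> n; rewrite /F (_ : [set _ | _] =
      \bigcap_(y in ~` A) [set x | (n.+1%:R^-1 <= d x y)%R]); last first.
    by apply/seteqP; split => x.
  apply: closed_bigI => y _; rewrite -openC.
  rewrite (_ : ~` _ = [set x | (d y x < n.+1%:R^-1)%R]); first exact: metric_ball_open.
  by apply/seteqP; split => x /=; rewrite dC ltNge => /negP.
- move=> m n mn; apply/subsetPset => x /= h y Ay; apply: le_trans (h y Ay).
  by rewrite lef_pV2 ?posrE// ler_nat ltnS.
- move=> n x h; apply: contrapT => /h.
  by rewrite (dE x x).2// leNgt => /negP; apply; rewrite invr_gt0 ltr0n.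
- move=> x Ax; have [e e0 eA] := metric_open_ball dm oA Ax.
  have [n hn] : exists n, (n.+1%:R^-1 < e / 2 :> R)%R.
    exists (Num.truncn (e / 2)^-1); rewrite -[ltRHS]invrK ltf_pV2 ?posrE ?invr_gt0 ?divr_gt0//.
    exact: truncnS_gt.
  exists n; apply/(dm.2 x _).2; exists (e / 2)%R; first by rewrite divr_gt0.
  move=> z /= xz y Ay; have : ~ (d x y < e)%R by move=> /eA.
  move=> /negP; rewrite -leNgt => exy.
  apply: (le_trans (ltW hn)); have := dT x z y.
  by move: xz exy; move: (d x z) (d x y) (d z y) => a b c; lra.
Qed.

Lemma metrizes_prod (R : realType) (X Y : topologicalType) (d : X -> X -> R)
    (d' : Y -> Y -> R) : metrizes d -> metrizes d' ->
  metrizes (fun z w : X * Y => Num.max (d z.1 w.1) (d' z.2 w.2)).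
Proof.
move=> [[d0 dE dC dT] dN] [[d0' dE' dC' dT'] dN']; split; first split.
- by move=> z w; rewrite le_max d0.
- move=> [x y] [x' y'] /=; split.
    move=> h; congr pair.
      by apply/dE/eqP; rewrite eq_le d0 andbT -h le_max lexx.
    by apply/dE'/eqP; rewrite eq_le d0' andbT -h le_max lexx orbT.
  by move=> [-> ->]; rewrite (dE _ _).2// (dE' _ _).2// maxxx.
- by move=> z w; rewrite dC dC'.
- move=> x y z; rewrite ge_max; apply/andP; split.
    by apply: le_trans (dT _ y.1 _) _; rewrite lerD// le_max lexx.
  by apply: le_trans (dT' _ y.2 _) _; rewrite lerD// le_max lexx orbT.
- move=> [x y] A; split.
    move=> [[B C] /= [/dN[e e0 eB] /dN'[e' e0' eC]] BCA].
    exists (Num.min e e'); first by rewrite lt_min e0.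
    move=> [u v] /=; rewrite gt_max !lt_min => /andP[/andP[xu _] /andP[_ yv]].
    by apply: BCA; split => /=; [exact: eB|exact: eC].
  move=> [e e0 eA].
  exists ([set u | d x u < e], [set v | d' y v < e]) => /=.
    by split; [apply/dN; exists e|apply/dN'; exists e].
  by move=> [u v] /= [xu yv]; apply: eA => /=; rewrite gt_max xu.
Qed.

(** * Complete metrics: convergence of filters and compactness *)

Section polish_spaces.
Context (R : realType) (T : ptopologicalType) (d : T -> T -> R).
Hypothesis dm : metrizes d.
Hypothesis dcomplete : forall u : nat -> T,
  (forall e : R, 0 < e -> exists N : nat, forall m n : nat,
    (N <= m)%N -> (N <= n)%N -> d (u m) (u n) < e) ->
  exists l : T, u @ \oo --> l.

Let d0 x y : 0 <= d x y. Proof. by case: dm => -[]. Qed.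
Let dC x y : d x y = d y x. Proof. by case: dm => -[]. Qed.
Let dT x y z : d x z <= d x y + d y z. Proof. by case: dm => -[]. Qed.

Lemma half_pow_lt (e : R) : 0 < e -> exists n : nat, (2^-1 : R) ^+ n < e.
Proof.
move=> e0; have : (fun n => (2^-1 : R) ^+ n) @ \oo --> 0.
  by apply: cvg_expr; rewrite ger0_norm// invf_lt1// ltr1n.
move/cvgrPdist_lt => /(_ e e0) [N _ h]; exists N.
by have := h N (leqnn _); rewrite /= sub0r normrN ger0_norm// exprn_ge0.
Qed.

Lemma geometric_cauchy_cvg (u : nat -> T) (K : R) :
  (forall m n, (n <= m)%N -> d (u n) (u m) <= K * 2^-1 ^+ n) ->
  exists l, forall n, d (u n) l <= K * 2^-1 ^+ n.
Proof.
move=> h; have K0 : 0 <= K by have := h 0 0 (leqnn _); rewrite expr0 mulr1; exact: le_trans.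
have [e e0|l ul] := dcomplete (u := u).
  have [|N hN] := @half_pow_lt (e / (K + K + 1)).
    by rewrite divr_gt0// ltr_wpDl// addr_ge0.
  exists N => m n Nm Nn; apply: le_lt_trans (dT _ (u N) _) _; rewrite dC.
  apply: le_lt_trans (lerD (h _ _ Nm) (h _ _ Nn)) _; rewrite -mulrDl.
  move: hN; rewrite ltr_pdivlMr ?ltr_wpDl ?addr_ge0// => hN.
  apply: le_lt_trans hN; rewrite mulrC ler_wpM2l// ?exprn_ge0//.
  by rewrite lerDl.
exists l => n; apply/ler_addgt0Pr => e e0.
have /= [N _ hN] := ul _ (metric_nbhs_ball dm l e0).
have Nn := leq_maxl n N; have nN := leq_maxr n N.
apply: le_trans (dT _ (u (maxn n N)) _) _; apply: lerD; first exact: h.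
by rewrite dC ltW//; exact: hN.
Qed.

(* In a complete space a filter deciding every set and containing, for every
   radius, a finite union of balls of a fixed sequence of centres converges. *)
Lemma totally_bounded_ultra_cvg (y : nat -> T) (F : set_system T) :
  ProperFilter F -> (forall A, F A \/ F (~` A)) ->
  (forall k, exists n, F (\bigcup_(i < n) [set z | d (y i) z <= 2^-1 ^+ k])) ->
  exists l : T, F --> l.
Proof.
move=> FF Fdec Ftb.
(* Since [F] decides every set, one ball of each finite union must itself belong to [F]. The chosen
   balls meet pairwise, so their centres form a Cauchy sequence. *)
have one k : exists i, F [set z | d (y i) z <= 2^-1 ^+ k].
  have [n] := Ftb k; elim: n => [|n IH].
    by rewrite bigcup_mkord big_ord0 => /filter_not_empty.
  move=> Fn; have [|Fc] := Fdec [set z | d (y n) z <= 2^-1 ^+ k]; first by exists n.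
  apply: IH; apply: filterS (filterI Fn Fc) => z [[j /= jn zj] nz].
  exists j => //=; move: jn; rewrite ltnS leq_eqVlt => /predU1P[e|//].
  by exfalso; apply: nz; rewrite -e.
have [i Fi] := choice one.
have [m n nm|l hl] := @geometric_cauchy_cvg (y \o i) 2.
  have [z [/= zm zn]] := filter_ex (filterI (Fi m) (Fi n)).
  apply: le_trans (dT _ z _) _; rewrite (dC z) mulr_natl mulr2n.
  apply: lerD => //; apply: le_trans zm _.
  by rewrite ler_wiXn2l// ?invr_ge0// invf_le1// ler1n.
exists l => A /= /(dm.2 l A).1 [e e0 eA].
have [|n hn] := @half_pow_lt (e / 3); first by rewrite divr_gt0.
apply: filterS (Fi n) => z /= zn; apply: eA => /=.
apply: le_lt_trans (dT _ (y (i n)) _) _; rewrite dC.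
apply: le_lt_trans (lerD (hl n) zn) _.
by move: hn; rewrite ltr_pdivlMr//; set a := _ ^+ n; lra.
Qed.

Lemma totally_bounded_closed_compact (y : nat -> T) (C : set T) : closed C ->
  (forall k, exists n, C `<=` \bigcup_(i < n) [set z | d (y i) z <= 2^-1 ^+ k]) ->
  compact C.
Proof.
move=> cC Ctb; rewrite compact_ultra => F FU FC.
have [|k|l Fl] := @totally_bounded_ultra_cvg y F _.
- by move=> A; exact: in_ultra_setVsetC.
- by have [n Cn] := Ctb k; exists n; exact: filterS FC.
exists l; split => //; apply: cC => B /Fl FB.
exact: filter_ex (filterI FC FB).
Qed.

End polish_spaces.

Local Open Scope ereal_scope.

(** * Finite measures and Lebesgue decompositions *)

Section finite_copy.
Context d (T : measurableType d) (R : realType) (m : {measure set T -> \bar R}).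
Hypothesis mfin : m setT < +oo.

(** An alias of [m] whose dummy argument is the proof of finiteness, so that a finite measure
    structure depending on that hypothesis can be attached to it. *)
Definition finite_copy of m setT < +oo : set T -> \bar R := m.
Local Notation fm := (finite_copy mfin).

HB.instance Definition _ := Measure.on fm.

Let fm_fin : fin_num_fun fm.
Proof.
move=> A mA; rewrite ge0_fin_numE//; apply: le_lt_trans mfin.
by apply: le_measure; rewrite ?inE.
Qed.

HB.instance Definition _ := @Measure_isFinite.Build d T R fm fm_fin.

Lemma measure_finite_of :
  exists m' : {finite_measure set T -> \bar R}, forall A, m' A = m A.
Proof. by exists fm. Qed.

End finite_copy.

Section function_measure.
Context d (T : measurableType d) (R : realType) (f : set T -> \bar R).
Hypotheses (f0 : f set0 = 0) (fge0 : forall A, 0 <= f A)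
  (fadd : semi_sigma_additive f).

Definition function_measure of f set0 = 0 & (forall A, 0 <= f A) &
  semi_sigma_additive f := f.

HB.instance Definition _ := @isMeasure.Build d T R
  (function_measure f0 fge0 fadd) f0 fge0 fadd.

Lemma ex_measure_of_function : f setT < +oo ->
  exists fm : {finite_measure set T -> \bar R}, forall A, fm A = f A.
Proof. by move=> fT; exact: (@measure_finite_of _ _ _ (function_measure f0 fge0 fadd)). Qed.

End function_measure.

Section finite_measures.
Context d (T : measurableType d) (R : realType).
Implicit Types (m P Q : {finite_measure set T -> \bar R}).

Lemma ex_density_measure (mu : {measure set T -> \bar R}) (f : T -> R) :
  measurable_fun setT f -> (forall x, (0 <= f x)%R) ->
  \int[mu]_x (f x)%:E < +oo ->
  exists fm : {finite_measure set T -> \bar R},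
    forall A, fm A = \int[mu]_(x in A) (f x)%:E.
Proof.
move=> mf f0 fT; apply: ex_measure_of_function => //.
- by rewrite integral_set0.
- by move=> A; apply: integral_ge0 => x _; rewrite lee_fin.
- apply: semi_sigma_additive_nng_induced; first exact/measurable_EFinP.
  by move=> x; rewrite lee_fin.
Qed.

(** By uniqueness of densities, the real function [f] agrees almost everywhere with the
    Radon-Nikodym derivative, for which the change of variables is known. *)
Lemma ge0_integral_density (m : {finite_measure set T -> \bar R})
    (mu : {finite_measure set T -> \bar R}) (f : T -> R) (g : T -> \bar R) D :
  measurable_fun setT f -> (forall x, (0 <= f x)%R) ->
  (forall A, measurable A -> m A = \int[mu]_(x in A) (f x)%:E) ->
  measurable D -> measurable_fun setT g -> (forall x, 0 <= g x) ->
  \int[m]_(x in D) g x = \int[mu]_(x in D) (g x * (f x)%:E).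
Proof.
move=> mf f0 mE mD mg g0.
have mmu : m `<< mu.
  apply/null_content_dominatesP => A mA A0; rewrite mE//.
  by apply: null_set_integral => //; apply: measurable_funTS; exact/measurable_EFinP.
rewrite -(Radon_Nikodym_SigmaFinite.change_of_variables mmu)//; last first.
  exact: measurable_funTS.
have iRN := Radon_Nikodym_SigmaFinite.f_integrable mmu.
have mRN := measurable_int _ iRN.
apply: ge0_ae_eq_integral => //.
- by apply: measurable_funTS; apply: emeasurable_funM.
- by apply: measurable_funTS; apply: emeasurable_funM => //; exact/measurable_EFinP.
- by move=> x _; rewrite mule_ge0// Radon_Nikodym_SigmaFinite.f_ge0.
- by move=> x _; rewrite mule_ge0// lee_fin.
have : ae_eq mu setT (Radon_Nikodym_SigmaFinite.f m mu) (EFin \o f).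
  apply: integral_ae_eq => //; first exact/measurable_EFinP.
  by move=> A _ mA; rewrite -mE// -Radon_Nikodym_SigmaFinite.f_integral.
by apply: filterS => x /= h _; rewrite h.
Qed.

(** Truncating the Radon-Nikodym derivative at [c] leaves its integrals unchanged: where it exceeds
    [c], the hypothesis already bounds [m] by [c P], which is the integral of the truncation. Having
    the bounds at every point lets the density serve as a weight. *)
Lemma ex_bounded_density m P (c : R) : (0 <= c)%R ->
  (forall A, measurable A -> m A <= c%:E * P A) ->
  exists h : T -> R, [/\ measurable_fun setT h, forall x, (0 <= h x <= c)%R &
    forall A, measurable A -> m A = \int[P]_(x in A) (h x)%:E].
Proof.
move=> c0 mP.
have mmu : m `<< P.
  apply/null_content_dominatesP => A mA A0; apply/eqP; rewrite eq_le measure_ge0 andbT.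
  by apply: le_trans (mP _ mA) _; rewrite A0 mule0.
have [f [f0 ffin fint fE]] := radon_nikodym_sigma_finite mmu.
have mf : measurable_fun setT f := measurable_int _ fint.
have mff : measurable_fun setT (fine \o f) by exact: measurableT_comp.
pose h x := Num.min (fine (f x)) c.
have mh : measurable_fun setT h by apply: measurable_minr.
have h0 x : (0 <= h x)%R by rewrite le_min c0 fine_ge0.
have fEf A : \int[P]_(x in A) f x = \int[P]_(x in A) (fine (f x))%:E.
  by apply: eq_integral => x _; rewrite fineK.
exists h; split => //; first by move=> x; rewrite h0 ge_min lexx orbT.
move=> A mA; apply/eqP; rewrite eq_le; apply/andP; split; last first.
  rewrite fE// fEf; apply: ge0_le_integral => //.
  - by move=> x _; rewrite lee_fin.
  - by apply: measurable_funTS; exact/measurable_EFinP.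
  - by apply: measurable_funTS; exact/measurable_EFinP.
  - by move=> x _; rewrite lee_fin ge_min lexx.
pose B := [set x | (c < fine (f x))%R].
have mB : measurable B.
  by rewrite -[B]setTI; apply: measurable_fun_ltr.
have mhE : measurable_fun setT (EFin \o h) by exact/measurable_EFinP.
have mAB : measurable (A `&` B) by exact: measurableI.
have mABC : measurable (A `&` ~` B) by apply: measurableI => //; exact: measurableC.
have AB0 : (A `&` B) `&` (A `&` ~` B) = set0 by rewrite setIACA setICr setI0.
have -> : m A = m (A `&` B) + m (A `&` ~` B) by rewrite -measureU// -setDE setUIDK.
have -> : \int[P]_(x in A) (h x)%:E = \int[P]_(x in A `&` B) (h x)%:E
    + \int[P]_(x in A `&` ~` B) (h x)%:E.
  rewrite -ge0_integral_setU//; first by rewrite -setDE setUIDK.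
  - exact: measurable_funTS.
  - by move=> x _; rewrite lee_fin.
  - exact/disj_set2P.
apply: leeD.
  apply: le_trans (mP _ mAB) _.
  rewrite -integral_cst//; apply: ge0_le_integral => //.
  - by apply: measurable_funTS.
  - by move=> x [_ Bx]; rewrite lee_fin /h; rewrite /B/= in Bx; rewrite le_min lexx (ltW Bx).
rewrite fE// fEf le_eqVlt; apply/orP; left; apply/eqP; apply: eq_integral => x.
by rewrite inE => -[_ /negP]; rewrite -leNgt => fc; congr EFin; rewrite /h; apply/esym/min_idPl.
Qed.

End finite_measures.

Section nonnegative_integrals.
Context d (T : measurableType d) (R : realType) (m : {measure set T -> \bar R}).

Lemma int_add (f g : T -> R) D : measurable D ->
  measurable_fun setT f -> measurable_fun setT g ->
  (forall x, (0 <= f x)%R) -> (forall x, (0 <= g x)%R) ->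
  \int[m]_(x in D) (f x + g x)%:E =
  \int[m]_(x in D) (f x)%:E + \int[m]_(x in D) (g x)%:E.
Proof.
move=> mD mf mg f0 g0; rewrite -ge0_integralD//.
- by move=> x _; rewrite lee_fin.
- exact/measurable_funTS/measurable_EFinP.
- by move=> x _; rewrite lee_fin.
- exact/measurable_funTS/measurable_EFinP.
Qed.

Lemma int_scale (k : R) (f : T -> R) D : measurable D -> (0 <= k)%R ->
  measurable_fun setT f -> (forall x, (0 <= f x)%R) ->
  \int[m]_(x in D) (k * f x)%:E = k%:E * \int[m]_(x in D) (f x)%:E.
Proof.
move=> mD k0 mf f0; rewrite -ge0_integralZl_EFin//.
- by move=> x _; rewrite lee_fin.
- exact/measurable_funTS/measurable_EFinP.
Qed.

End nonnegative_integrals.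

Section lebesgue_decomposition_theory.
Context d (T : measurableType d) (R : realType).
Implicit Types (P Q : {finite_measure set T -> \bar R}).

Lemma le_int (mu : {measure set T -> \bar R}) (D : set T) (f g : T -> R) :
  measurable D -> measurable_fun setT f -> measurable_fun setT g ->
  (forall x, (0 <= f x)%R) -> (forall x, D x -> (f x <= g x)%R) ->
  \int[mu]_(x in D) (f x)%:E <= \int[mu]_(x in D) (g x)%:E.
Proof.
move=> mD mf mg f0 fg; apply: ge0_le_integral => //.
- by move=> x _; rewrite lee_fin.
- exact/measurable_funTS/measurable_EFinP.
- exact/measurable_funTS/measurable_EFinP.
Qed.

Lemma int_setU (mu : {measure set T -> \bar R}) (A B : set T) (f : T -> R) :
  measurable A -> measurable B -> measurable_fun setT f ->
  (forall x, (0 <= f x)%R) ->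
  \int[mu]_(x in A) (f x)%:E = \int[mu]_(x in A `&` B) (f x)%:E
    + \int[mu]_(x in A `\` B) (f x)%:E.
Proof.
move=> mA mB mf f0; rewrite -ge0_integral_setU//; first by rewrite setUIDK.
- exact: measurableI.
- exact: measurableD.
- exact/measurable_funTS/measurable_EFinP.
- by move=> x _; rewrite lee_fin.
- by apply/disj_set2P; rewrite setDE setIACA setICr setI0.
Qed.

Lemma int_null (mu : {measure set T -> \bar R}) (A : set T) (f : T -> R) :
  measurable A -> measurable_fun setT f -> mu A = 0 ->
  \int[mu]_(x in A) (f x)%:E = 0.
Proof.
by move=> mA mf A0; apply: null_set_integral => //; exact/measurable_funTS/measurable_EFinP.
Qed.

Lemma int_ge0 (mu : {measure set T -> \bar R}) (A : set T) (f : T -> R) :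
  (forall x, (0 <= f x)%R) -> 0 <= \int[mu]_(x in A) (f x)%:E.
Proof. by move=> f0; apply: integral_ge0 => x _; rewrite lee_fin. Qed.

Lemma int_pos_eq0 (mu : {measure set T -> \bar R}) (A : set T) (f : T -> R) :
  measurable A -> measurable_fun setT f -> (forall x, A x -> (0 < f x)%R) ->
  \int[mu]_(x in A) (f x)%:E = 0 -> mu A = 0.
Proof.
move=> mA mf f0 If.
have /ae_eq_integral_abs : \int[mu]_(x in A) `|(f x)%:E| = 0.
  rewrite -If; apply: eq_integral => x; rewrite inE => Ax.
  by rewrite gee0_abs// lee_fin ltW// f0.
case=> //; first exact/measurable_funTS/measurable_EFinP.
move=> N [mN N0 sN]; apply: (subset_measure0 mA mN) => // x Ax; apply: sN => /= h.
by move: (h Ax) (f0 x Ax) => -[->]; rewrite ltxx.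
Qed.

(** With [g] the density of [Q] with respect to [P + Q], the set [N] where [g] vanishes is [Q]-null;
    off [N], [Q]-null sets are [P]-null because [g] is positive there. So [P] restricted to [N] is
    singular and the rest has a density. *)
Lemma ex_lebesgue_decomposition P Q :
  exists rp : (T -> R) * {finite_measure set T -> \bar R},
    is_lebesgue_decomposition P Q rp.1 rp.2.
Proof.
have Sfin : measure_add P Q setT < +oo.
  by rewrite measure_addE lte_add_pinfty// -ge0_fin_numE// fin_num_measure.
have [S SE] := measure_finite_of Sfin.
have SE' A : S A = P A + Q A by rewrite SE; exact: measure_addE.
have [|g [mg g01 gE]] := @ex_bounded_density _ _ _ Q S 1 ler01.
  by move=> A mA; rewrite mul1e SE' leeDr.
pose N := g @^-1` [set 0%R].
have mN : measurable N by rewrite -[N]setTI; exact: mg.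
have QN : Q N = 0.
  by rewrite gE// integral0_eq// => x ->.
have mNC : measurable (~` N) by exact: measurableC.
pose PN : {finite_measure set T -> \bar R} := mrestr P mNC.
have PNQ : PN `<< Q.
  apply/null_content_dominatesP => A mA A0; rewrite /PN /= /mrestr.
  have mAN : measurable (A `&` ~` N) by exact: measurableI.
  have : S (A `&` ~` N) = 0.
    apply: (int_pos_eq0 mAN mg).
      move=> x [_ /eqP Nx]; have /andP[+ _] := g01 x.
      by rewrite le_eqVlt eq_sym (negbTE Nx).
    rewrite -gE//; apply/eqP; rewrite eq_le measure_ge0 andbT -A0.
    by apply: le_measure; rewrite ?inE.
  rewrite SE' => /eqP; rewrite padde_eq0// => /andP[/eqP-> _] //.
have [f [f0 ffin fint fE]] := radon_nikodym_sigma_finite PNQ.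
exists (fine \o f, mrestr P mN : {finite_measure set T -> \bar R}); split => /=.
- by apply: measurableT_comp => //; exact: measurable_int fint.
- by move=> x; rewrite fine_ge0.
- exists N; split => //=; rewrite /mrestr setICl measure0//.
- move=> A mA; transitivity (PN A + P (A `&` N)); last first.
    congr (_ + _); rewrite fE//; apply: eq_integral => x _.
    by rewrite fineK.
  rewrite /PN/= /mrestr -measureU//; [|exact: measurableI|exact: measurableI|].
    by rewrite setUC -setDE setUIDK.
  by rewrite setIACA setICl setI0.
Qed.

(** Marginals occur as bare set functions [P']; agreement with a finite measure on measurable sets
    is enough to rule out the dummy branch of [lebesgue_decomposition]. *)
Lemma lebesgue_decompositionP P (P' : set T -> \bar R) Q :
  (forall A, measurable A -> P' A = P A) ->
  is_lebesgue_decomposition P' Q (density P' Q) (singular_part P' Q).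
Proof.
move=> PE; rewrite /density /singular_part /lebesgue_decomposition.
case: pselect => [h|]; first by case: cid.
case; have [rp [mr r0 s rpE]] := ex_lebesgue_decomposition P Q.
by exists rp; split => // A mA; rewrite PE// rpE.
Qed.

(** Off the union [M] of the two null sets both singular parts vanish, so the densities have equal
    integrals there; on [M] the densities integrate to 0, so both singular parts have total mass
    [P M]. *)
Lemma lebesgue_decomposition_unique P Q (r r' : T -> R)
    (Pp Pp' : {finite_measure set T -> \bar R}) :
  is_lebesgue_decomposition P Q r Pp ->
  is_lebesgue_decomposition P Q r' Pp' ->
  ae_eq Q setT (EFin \o r) (EFin \o r') /\ Pp setT = Pp' setT.
Proof.
move=> [mr r0 [N [mN QN PpN]] rE] [mr' r0' [N' [mN' QN' PpN']] rE'].
pose M := N `|` N'.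
have mM : measurable M by exact: measurableU.
have QM : Q M = 0 by apply: null_set_setU.
have conc (p : {finite_measure set T -> \bar R}) (n : set T) A : measurable n ->
    n `<=` M -> p (~` n) = 0 -> measurable A -> A `&` M = set0 -> p A = 0.
  move=> mn nM pn mA AM; apply: (subset_measure0 mA _ _ pn); first exact: measurableC.
  by move=> x Ax nx; have : (A `&` M) x by [split => //; exact: nM]; rewrite AM.
have tot (p : {finite_measure set T -> \bar R}) (n : set T) : measurable n ->
    n `<=` M -> p (~` n) = 0 -> p setT = p M.
  move=> mn nM pn; rewrite -(setUv M) measureU//; [|exact: measurableC|exact: setICr].
  rewrite [X in _ + X](conc _ n)// ?adde0//; first exact: measurableC.
  by rewrite setICl.
have NM : N `<=` M by move=> x; left.
have NM' : N' `<=` M by move=> x; right.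
split; last first.
  rewrite (tot _ _ mN NM PpN) (tot _ _ mN' NM' PpN').
  by have := rE' _ mM; rewrite rE// !int_null// !add0e.
have fint (f : T -> R) (p : {finite_measure set T -> \bar R}) : (forall x, (0 <= f x)%R) -> measurable_fun setT f ->
    (forall A, measurable A -> P A = \int[Q]_(x in A) (f x)%:E + p A) ->
    0 <= p setT -> Q.-integrable setT (EFin \o f).
  move=> f0 mf fE p0; apply/integrableP; split; first exact/measurable_EFinP.
  under eq_integral => x _ do rewrite gee0_abs ?lee_fin//.
  have : P setT < +oo by rewrite -ge0_fin_numE// fin_num_measure.
  by apply: le_lt_trans; rewrite fE// leeDl.
apply: integral_ae_eq => //.
- exact: (fint _ _ r0 mr rE).
- exact/measurable_EFinP.
- move=> A _ mA.
  rewrite (int_setU _ mA mM mr r0) (int_setU _ mA mM mr' r0').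
  have mAM : measurable (A `\` M) by exact: measurableD.
  have AMM : (A `\` M) `&` M = set0 by rewrite setDKI.
  have QAM : Q (A `&` M) = 0.
    by apply: (subset_measure0 _ mM) => //; exact: measurableI.
  have mAM' : measurable (A `&` M) by exact: measurableI.
  rewrite (int_null mAM' mr QAM) (int_null mAM' mr' QAM) !add0e.
  have := rE' _ mAM; rewrite rE//.
  by rewrite (conc _ _ _ mN NM PpN mAM AMM) (conc _ _ _ mN' NM' PpN' mAM AMM) !adde0.
Qed.

Lemma lebesgue_decomposition_int_le P Q (r : T -> R)
    (Pp : {finite_measure set T -> \bar R}) A :
  is_lebesgue_decomposition P Q r Pp -> measurable A ->
  \int[Q]_(x in A) (r x)%:E <= P A.
Proof. by move=> [_ _ _ PE] mA; rewrite PE// leeDl. Qed.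

Lemma finite_measure_lty P A : measurable A -> P A < +oo.
Proof. by move=> mA; rewrite -ge0_fin_numE// fin_num_measure. Qed.

End lebesgue_decomposition_theory.

(** * Convex integrands and divergences *)

Section convex_integrands.
Context (R : realType) (theta : R -> \bar R).
Hypotheses (tproper : proper_nneg theta) (tconv : strictly_convex_on_dom theta).
Implicit Types a b x y m : R.
Local Notation f := (fun x => fine (theta x)).

Lemma theta_finE x : edom theta x -> theta x = (f x)%:E.
Proof.
move=> [x0 xoo]; rewrite fineK// fin_numE (tproper.1 _ x0).
by rewrite lt_eqF.
Qed.

Lemma theta_out x : (0 <= x)%R -> ~ edom theta x -> theta x = +oo.
Proof.
move=> x0 nx; apply/eqP; rewrite -leye_eq leNgt; apply/negP => h.
by apply: nx.
Qed.

Lemma edom_between a b x : edom theta a -> edom theta b -> (a <= x <= b)%R ->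
  edom theta x.
Proof.
move=> ha hb /andP[]; rewrite le_eqVlt => /predU1P[<-//|ax].
rewrite le_eqVlt => /predU1P[->//|xb].
pose w := ((b - x) / (b - a))%R.
have ab : (0 < b - a)%R by lra.
have -> : x = (w * a + (1 - w) * b)%R by rewrite /w; field; lra.
apply: tconv.1 => //; rewrite divr_gt0//=; last lra.
by rewrite ltr_pdivrMr//; lra.
Qed.

(** Chord inequalities are kept free of denominators, which turns the slope estimates below into
    polynomial arithmetic. *)
Lemma theta_chord_lt a b x : edom theta a -> edom theta b -> (a < x < b)%R ->
  ((b - a) * f x < (b - x) * f a + (x - a) * f b)%R.
Proof.
move=> ha hb /andP[ax xb].
pose w := ((b - x) / (b - a))%R.
have ab : (0 < b - a)%R by lra.
have xE : x = (w * a + (1 - w) * b)%R by rewrite /w; field; lra.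
have w01 : (0 < w < 1)%R.
  by rewrite divr_gt0//=; [rewrite ltr_pdivrMr//; lra|lra].
have hx : edom theta x by rewrite xE; exact: tconv.1.
have nab : a <> b by move=> E; move: ab; rewrite E subrr ltxx.
have := tconv.2 a b w ha hb nab w01.
rewrite -xE theta_finE// (theta_finE ha) (theta_finE hb) -!EFinM -EFinD lte_fin /= => h.
have -> : ((b - x) * f a + (x - a) * f b = (b - a) * (w * f a + (1 - w) * f b))%R.
  by rewrite /w; field; lra.
by rewrite ltr_pM2l.
Qed.

Lemma theta_chord a b x : edom theta a -> edom theta b -> (a <= x <= b)%R ->
  ((b - a) * f x <= (b - x) * f a + (x - a) * f b)%R.
Proof.
move=> ha hb /andP[]; rewrite le_eqVlt => /predU1P[->|ax]; first by rewrite subrr mul0r addr0.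
rewrite le_eqVlt => /predU1P[->|xb]; first by rewrite subrr mul0r add0r.
by apply/ltW/theta_chord_lt => //; rewrite ax.
Qed.

Definition chord_slope a b := ((f b - f a) / (b - a))%R.

Lemma chord_slope_lt a m b : edom theta a -> edom theta b -> (a < m < b)%R ->
  (chord_slope a m < chord_slope m b)%R.
Proof.
move=> ha hb amb; have /andP[am mb] := amb.
have := theta_chord_lt ha hb amb => h.
rewrite /chord_slope ltr_pdivrMr; last lra.
rewrite mulrAC ltr_pdivlMr; last lra.
by nra.
Qed.

(** Slopes of a convex function increase, so left of [t] no chord is steeper than the one from [t]
    to [m]. This bounds the cost of adding mass at low density. *)
Lemma theta_slope_left t m x y : edom theta t -> edom theta m -> edom theta x ->
  (t < m)%R -> (x <= y <= t)%R ->
  (f y <= f x + chord_slope t m * (y - x))%R.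
Proof.
move=> ht hm hx tm /andP[xy yt].
have hy : edom theta y by apply: (edom_between hx ht); rewrite xy.
have A := @theta_chord x m y hx hm _.
have B := @theta_chord y m t hy hm _.
have {}A := A ltac:(apply/andP; split; lra).
have {}B := B ltac:(apply/andP; split; lra).
have my : (0 < m - y)%R by lra.
have mt : (0 < m - t)%R by lra.
rewrite -lerBlDl /chord_slope mulrAC ler_pdivlMr//.
rewrite -(ler_pM2l my).
set X := f x in A *; set Y := f y in A B *; set M := f m in A B *; set U := f t in B *.
have A' : ((Y - X) * (m - y) <= (M - Y) * (y - x))%R by nra.
have B' : ((m - t) * (M - Y) <= (m - y) * (M - U))%R by nra.
have C1 : ((m - t) * ((Y - X) * (m - y)) <= (m - t) * ((M - Y) * (y - x)))%R.
  by rewrite ler_pM2l.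
have C2 : ((y - x) * ((m - t) * (M - Y)) <= (y - x) * ((m - y) * (M - U)))%R.
  by apply: ler_wpM2l => //; lra.
by nra.
Qed.

(** The mirror image of [theta_slope_left]: it bounds from below what is saved by removing mass at
    high density. *)
Lemma theta_slope_right s m x y : edom theta s -> edom theta m -> edom theta x ->
  (m < s)%R -> (s <= y <= x)%R ->
  (f y <= f x - chord_slope m s * (x - y))%R.
Proof.
move=> hs hm hx ms /andP[sy yx].
have hy : edom theta y by apply: (edom_between hs hx); rewrite sy.
have A := @theta_chord m x y hm hx ltac:(apply/andP; split; lra).
have B := @theta_chord m y s hm hy ltac:(apply/andP; split; lra).
have ym : (0 < y - m)%R by lra.
have sm : (0 < s - m)%R by lra.
rewrite lerBrDr addrC -lerBrDr /chord_slope mulrAC ler_pdivrMr//.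
rewrite -(ler_pM2l ym).
set X := f x in A *; set Y := f y in A B *; set M := f m in A B *; set U := f s in B *.
have A' : ((Y - M) * (x - y) <= (X - Y) * (y - m))%R by nra.
have B' : ((y - m) * (U - M) <= (s - m) * (Y - M))%R by nra.
have C1 : ((s - m) * ((Y - M) * (x - y)) <= (s - m) * ((X - Y) * (y - m)))%R.
  by rewrite ler_pM2l.
have C2 : ((x - y) * ((y - m) * (U - M)) <= (x - y) * ((s - m) * (Y - M)))%R.
  by apply: ler_wpM2l => //; lra.
by nra.
Qed.

Lemma theta_above_left t m x : edom theta t -> edom theta m -> edom theta x ->
  (t < m)%R -> (m <= x)%R -> (f m + chord_slope t m * (x - m) <= f x)%R.
Proof.
move=> ht hm hx tm mx.
have := @theta_chord t x m ht hx ltac:(apply/andP; split; lra) => h.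
rewrite -lerBrDl /chord_slope mulrAC ler_pdivrMr; last lra.
by nra.
Qed.

Lemma theta_above_right s m x : edom theta s -> edom theta m -> edom theta x ->
  (m < s)%R -> (x <= m)%R -> (f m + chord_slope m s * (x - m) <= f x)%R.
Proof.
move=> hs hm hx ms xm.
have := @theta_chord x s m hx hs ltac:(apply/andP; split; lra) => h.
have -> : (chord_slope m s * (x - m) = - (chord_slope m s * (m - x)))%R by ring.
rewrite -lerBrDl lerNl /chord_slope mulrAC ler_pdivlMr; last lra.
by nra.
Qed.

Lemma theta_above_right' s m x : edom theta s -> edom theta m -> edom theta x ->
  (m < s)%R -> (s <= x)%R -> (f m + chord_slope m s * (x - m) <= f x)%R.
Proof.
move=> hs hm hx ms sx.
have := @theta_chord m x s hm hx ltac:(apply/andP; split; lra) => h.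
rewrite -lerBrDl /chord_slope mulrAC ler_pdivrMr; last lra.
by nra.
Qed.

(** [recession] is a [lim], so its convergence has to be established. Let [k] be the value at 0 of
    the line through the chord from [t] to [m]. Replacing [theta] by that line before [m] keeps it
    convex, so the slope [(theta x - k) / x] seen from the point [(0, k)] is nondecreasing for
    [x >= m]; the difference [k / x] tends to 0. *)
Lemma is_cvg_recession t m : edom theta t -> edom theta m -> (t < m)%R ->
  cvg (theta x * (x^-1)%:E @[x --> +oo%R]).
Proof.
move=> ht hm tm.
have t0 : (0 <= t)%R by case: ht.
pose k := (f m - chord_slope t m * m)%R.
(* The argument is clamped at [m] to make [g] monotone on the whole line. *)
pose g x := (theta (Num.max x m) - k%:E) * ((Num.max x m)^-1)%:E.
have ndg : nondecreasing_fun g.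
  move=> x y xy; rewrite /g.
  set X := Num.max x m; set Y := Num.max y m.
  have mX : (m <= X)%R by rewrite le_max lexx orbT.
  have XY : (X <= Y)%R by rewrite /X /Y ge_max !le_max xy lexx/= orbT.
  have [hY|nY] := pselect (edom theta Y); last first.
    by rewrite (theta_out _ nY); [rewrite addye//= gt0_mulye ?leey// lte_fin invr_gt0; lra|lra].
  have hX : edom theta X by apply: (edom_between hm hY); rewrite mX.
  rewrite (theta_finE hX) (theta_finE hY) -!EFinB -!EFinM lee_fin.
  have X0 : (0 < X)%R by lra.
  have Y0 : (0 < Y)%R by lra.
  rewrite ler_pdivrMr// mulrAC ler_pdivlMr//.
  have A := @theta_chord m Y X hm hY ltac:(apply/andP; split; lra).
  have B := theta_above_left ht hm hY tm (le_trans mX XY).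
  rewrite /k; move: mX; rewrite le_eqVlt => /predU1P[mX|mX].
    rewrite -mX in XY X0 *; move: B.
    by move: (chord_slope t m) (f m) (f Y) => c M FY B; nra.
  move: A B; move: (chord_slope t m) (f m) (f X) (f Y) => c M FX FY A B.
  have Ym : (0 < Y - m)%R by lra.
  rewrite -(ler_pM2l Ym).
  have C1 : (Y * ((Y - m) * FX) <= Y * ((Y - X) * M + (X - m) * FY))%R.
    by rewrite ler_pM2l.
  have C2 : ((Y - X) * m * (M + c * (Y - m)) <= (Y - X) * m * FY)%R.
    by apply: ler_wpM2l => //; apply: mulr_ge0; lra.
  by nra.
have gl := nondecreasing_cvge ndg; set l := ereal_sup _ in gl.
have kl : (k / x)%:E @[x --> +oo%R] --> (0%R : R)%:E.
  apply: cvg_EFin; first exact: nearW.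
  rewrite -[X in _ --> X](mulr0 k); apply: cvgMr.
  apply/gtr0_cvgV0; last exact: cvg_id.
  by apply: nbhs_pinfty_gt; exact: num_real.
apply/cvg_ex; exists (l + 0).
apply: cvg_trans; last first.
  apply: cvgeD gl kl; exact: fin_num_adde_defl.
apply: near_eq_cvg; near=> x.
have mx : (m <= x)%R by near: x; apply: nbhs_pinfty_ge; exact: num_real.
have x0 : (0 < x)%R by lra.
rewrite /g max_l//=; case: (theta x) => [r| |].
- by rewrite -EFinB -!EFinM -EFinD; congr EFin; rewrite mulrBl subrK.
- by rewrite addye// gt0_mulye ?lte_fin ?invr_gt0// addye.
- by rewrite addNye gt0_mulNye ?lte_fin ?invr_gt0// addNye.
Unshelve. all: by end_near. Qed.

(** Beyond [s] the function lies above the line through the chord, and the intercept of that line is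
    negligible after division by [x]. The point [t] serves for the convergence of the limit. *)
Lemma recession_ge t m s : edom theta t -> edom theta m -> edom theta s ->
  (t < m)%R -> (m < s)%R -> (chord_slope m s)%:E <= recession theta.
Proof.
move=> ht hm hs tm ms; have := is_cvg_recession ht hm tm.
have m0 : (0 <= m)%R by case: hm.
set c := chord_slope m s => cv.
suff h (e : R) : (0 < e)%R -> (c - e)%:E <= recession theta.
  by apply/lee_addgt0Pr => e /h; rewrite EFinB leeBlDr.
move=> e0; apply: lime_ge => //; near=> x.
have sx : (s <= x)%R by near: x; apply: nbhs_pinfty_ge; exact: num_real.
have x0 : (0 < x)%R by lra.
have bx : (`|f m - c * m| / e <= x)%R.
  by near: x; apply: nbhs_pinfty_ge; exact: num_real.
have [hx|nx] := pselect (edom theta x); last first.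
  by rewrite (theta_out _ nx) ?gt0_mulye ?leey// ?lte_fin ?invr_gt0// ltW.
rewrite (theta_finE hx) -EFinM lee_fin ler_pdivlMr//.
have := theta_above_right' hs hm hx ms sx; rewrite -/c.
move: bx; rewrite ler_pdivrMr// => bx.
have := ler_norm (- (f m - c * m)); rewrite normrN.
by move: bx; set N := Num.norm _; move: N (f m) (f x) => N M FX; nra.
Unshelve. all: by end_near. Qed.

Lemma recession_bounded s : (0 <= s)%R -> (forall x, edom theta x -> (x < s)%R) ->
  recession theta = +oo.
Proof.
move=> s0 h; apply: cvg_lim => //; apply: cvg_near_cst; near=> x.
have sx : (s <= x)%R by near: x; apply: nbhs_pinfty_ge; exact: num_real.
have x0 : (0 < x)%R by near: x; apply: nbhs_pinfty_gt; exact: num_real.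
have nx : ~ edom theta x by move=> /h; rewrite ltNge sx.
by rewrite (theta_out _ nx) ?gt0_mulye ?lte_fin ?invr_gt0// ltW.
Unshelve. all: by end_near. Qed.

End convex_integrands.

Section divergence_theory.
Context d (T : measurableType d) (R : realType) (theta : R -> \bar R).
Hypothesis tlsc : lsc_nneg theta.

Lemma measurable_lsc_comp (r : T -> R) : measurable_fun setT r ->
  (forall x, (0 <= r x)%R) -> measurable_fun setT (theta \o r).
Proof.
move=> mr r0.
apply: (measurability _ (ErealGenOInfty.measurableE R)) => // _ [_ [a ->] <-].
rewrite setTI.
(* The values of [theta] at negative arguments are unconstrained, so all negative numbers are added
   to the superlevel set; lower semicontinuity on the half-line puts every relevant point in the
   interior of the result. *)
pose U := ([set s | (0 <= s)%R -> a%:E < theta s]°)%classic.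
have -> : (theta \o r) @^-1` `]a%:E, +oo[%classic = r @^-1` U.
  apply/seteqP; split => x /=; rewrite in_itv/= andbT.
    by move=> h; have := tlsc (r0 x) h; rewrite /within/= /U /interior.
  by move=> /interior_subset; exact.
rewrite -[X in measurable X]setTI; apply: mr => //.
by apply: open_measurable; exact: open_interior.
Qed.

Lemma divergence_eq (P Q : {finite_measure set T -> \bar R})
    (P' : set T -> \bar R) (r : T -> R)
    (Pp : {finite_measure set T -> \bar R}) :
  (forall A, measurable A -> P' A = P A) ->
  is_lebesgue_decomposition P Q r Pp ->
  divergence theta P' Q = \int[Q]_x theta (r x) + recession theta * Pp setT.
Proof.
move=> PE rP; have h' := lebesgue_decompositionP Q PE.
have h : is_lebesgue_decomposition P Q (density P' Q) (singular_part P' Q).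
  by case: h' => ? ? ? e; split => // A mA; rewrite -PE// e.
rewrite /divergence; have [req ->] := lebesgue_decomposition_unique h rP; congr (_ + _).
case: rP => mr r0 _ _; case: h => mr' r0' _ _.
apply: ae_eq_integral => //; [exact: measurable_lsc_comp|exact: measurable_lsc_comp|].
by apply: filterS req => x /= + xT => /(_ xT)[->].
Qed.

End divergence_theory.

Lemma level_integral_eq d (T : measurableType d) (R : realType)
    (P Q : {finite_measure set T -> \bar R}) (P' : set T -> \bar R)
    (r : T -> R) (Pp : {finite_measure set T -> \bar R}) (t : R) :
  (forall A, measurable A -> P' A = P A) ->
  is_lebesgue_decomposition P Q r Pp ->
  \int[Q]_y (Num.min (density P' Q y) t)%:E = \int[Q]_y (Num.min (r y) t)%:E.
Proof.
move=> PE rP; have h' := lebesgue_decompositionP Q PE.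
have h : is_lebesgue_decomposition P Q (density P' Q) (singular_part P' Q).
  by case: h' => ? ? ? e; split => // A mA; rewrite -PE// e.
have [req _] := lebesgue_decomposition_unique h rP.
case: rP => mr r0 _ _; case: h => mr' r0' _ _.
apply: ae_eq_integral => //.
- by apply/measurable_EFinP; exact: measurable_minr.
- by apply/measurable_EFinP; exact: measurable_minr.
- by apply: filterS req => x /= + xT => /(_ xT)[->].
Qed.

Section theta_bounds.
Context (R : realType) (theta : R -> \bar R).
Hypotheses (tproper : proper_nneg theta) (tconv : strictly_convex_on_dom theta).

(** Two chords meeting at an interior point of the domain give a lower bound of linear growth, which
    makes the negative part of [theta \o r] integrable. A domain with a single point has no chord,
    but there the recession constant is [+oo] and a constant bound suffices. *)
Lemma theta_lower_bound : -oo < recession theta /\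
  exists C K : R, [/\ (0 <= C)%R, (0 <= K)%R &
    forall x, (0 <= x)%R -> (- (C + K * x))%:E <= theta x].
Proof.
have [[a [b [ha hb ab]]]|nab] :=
    pselect (exists a b, [/\ edom theta a, edom theta b & (a < b)%R]).
  pose m := ((a + b) / 2)%R.
  have am : (a < m)%R by rewrite /m; lra.
  have mb : (m < b)%R by rewrite /m; lra.
  have hm : edom theta m by apply: (edom_between tconv ha hb); rewrite !ltW.
  split.
    by apply: lt_le_trans (recession_ge tproper tconv ha hm hb am mb); exact: ltNyr.
  pose c1 := chord_slope theta a m; pose c2 := chord_slope theta m b.
  exists (`|fine (theta m)| + (`|c1| + `|c2|) * m)%R, (`|c1| + `|c2|)%R.
  have m0 : (0 <= m)%R by case: hm.
  split=> [||x x0]; [by rewrite addr_ge0// mulr_ge0// addr_ge0|by rewrite addr_ge0|].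
  have [hx|nx] := pselect (edom theta x); last by rewrite (theta_out x0 nx) leey.
  rewrite (theta_finE tproper hx) lee_fin.
  have n1 := ler_norm (- c1); have n1' := ler_norm c1.
  have n2 := ler_norm (- c2); have n2' := ler_norm c2.
  have nm := ler_norm (- fine (theta m)).
  rewrite !normrN in n1 n2 nm.
  have [mx|xm] := leP m x.
    have := theta_above_left tproper tconv ha hm hx am mx; rewrite -/c1.
    move: n1 n1' n2 n2' nm; move: c1 c2 (Num.norm (fine (theta m))) (Num.norm c1) (Num.norm c2) (fine (theta m)) (fine (theta x)).
    by move=> *; nra.
  have := theta_above_right tproper tconv hb hm hx mb (ltW xm); rewrite -/c2.
  move: n1 n1' n2 n2' nm; move: c1 c2 (Num.norm (fine (theta m))) (Num.norm c1) (Num.norm c2) (fine (theta m)) (fine (theta x)).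
  by move=> *; nra.
have [a ha] := tproper.2.
have uniq_dom x : edom theta x -> x = a.
  move=> hx; apply/eqP; rewrite eq_le; apply/andP; split; rewrite leNgt; apply/negP => h.
    by apply: nab; exists a, x.
  by apply: nab; exists x, a.
split.
  rewrite (@recession_bounded _ theta (a + 1)%R) ?ltNyy//.
    by rewrite addr_ge0//; case: ha.
  by move=> x /uniq_dom ->; rewrite ltrDl.
exists `|fine (theta a)|%R, 0%R; split => // x x0.
have [hx|nx] := pselect (edom theta x); last by rewrite (theta_out x0 nx) leey.
rewrite (uniq_dom _ hx) (theta_finE tproper ha) lee_fin mul0r addr0 lerNl.
by rewrite -normrN ler_norm.
Qed.

End theta_bounds.

Lemma int_density_add d (T : measurableType d) (R : realType)
    (P Q : {finite_measure set T -> \bar R}) (r : T -> R)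
    (Pp : {finite_measure set T -> \bar R}) (h : T -> R) (A : set T) :
  is_lebesgue_decomposition P Q r Pp ->
  measurable_fun setT h -> (forall x, (0 <= h x)%R) -> measurable A ->
  \int[P]_(x in A) (h x)%:E =
  \int[Q]_(x in A) (h x * r x)%:E + \int[Pp]_(x in A) (h x)%:E.
Proof.
move=> rP mh h0 mA; have [mr r0 _ PE] := rP.
have mh' : measurable_fun setT (EFin \o h) by exact/measurable_EFinP.
have rfin : \int[Q]_x (r x)%:E < +oo.
  apply: le_lt_trans (lebesgue_decomposition_int_le rP measurableT) _.
  exact: finite_measure_lty.
have [q qE] := ex_density_measure mr r0 rfin.
rewrite (@eq_measure_integral _ _ _ _ (measure_add q Pp)); last first.
  move=> B mB _; transitivity (q B + Pp B); first by rewrite qE; exact: PE.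
  exact/esym/measure_addE.
rewrite ge0_integral_measure_add//; last first.
- exact: measurable_funTS.
- by move=> x _; rewrite lee_fin.
congr (_ + _).
by rewrite (ge0_integral_density (mu := Q) mr r0 (fun B _ => qE B))//;
  move=> x; rewrite lee_fin.
Qed.

(** * First-order gain of an exchange of mass *)

Section divergence_decrease.
Context d (T : measurableType d) (R : realType) (theta : R -> \bar R).
Hypotheses (tproper : proper_nneg theta) (tlsc : lsc_nneg theta)
  (tconv : strictly_convex_on_dom theta).
Variables (P Q : {finite_measure set T -> \bar R}) (r : T -> R)
  (Pp : {finite_measure set T -> \bar R}) (N : set T) (t s : R) (h v : T -> R).
Hypotheses (rP : is_lebesgue_decomposition P Q r Pp)
  (rN : forall x, N x -> r x = 0%R)
  (t0 : (0 < t)%R) (ts : (t < s)%R)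
  (mh : measurable_fun setT h) (h01 : forall x, (0 <= h x <= 1)%R)
  (hG : forall x, h x != 0%R -> N x \/ (s < r x)%R)
  (mv : measurable_fun setT v) (v0t : forall x, (0 <= v x <= t)%R)
  (vL : forall x, v x != 0%R -> ~ N x /\ (r x <= t)%R)
  (hv : \int[P]_x (h x)%:E = \int[Q]_x (v x)%:E)
  (v_gt0 : 0 < \int[Q]_x (v x)%:E).
Hypothesis Dfin : \int[Q]_x theta (r x) + recession theta * Pp setT < +oo.

Let mr : measurable_fun setT r. Proof. by case: rP. Qed.
Let r0 x : (0 <= r x)%R. Proof. by case: rP. Qed.
Let h0 x : (0 <= h x)%R. Proof. by case/andP: (h01 x). Qed.
Let v0 x : (0 <= v x)%R. Proof. by case/andP: (v0t x). Qed.

Let Pfin : P setT < +oo.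
Proof. exact: finite_measure_lty. Qed.
Let Ppfin : Pp setT \is a fin_num.
Proof. exact: fin_num_measure. Qed.

Let rint : Q.-integrable setT (EFin \o r).
Proof.
apply/integrableP; split; first exact/measurable_EFinP.
under eq_integral => x _ do rewrite gee0_abs ?lee_fin//.
exact: le_lt_trans (lebesgue_decomposition_int_le rP measurableT) Pfin.
Qed.

Let vint : Q.-integrable setT (EFin \o v).
Proof.
apply: (@le_integrable _ _ _ _ _ _ _ (EFin \o cst t)) => //.
- exact/measurable_EFinP.
- by move=> x _ /=; rewrite lee_fin ger0_norm// (ger0_norm (ltW t0)); case/andP: (v0t x).
- exact: finite_measure_integrable_cst.
Qed.

Let hrint : Q.-integrable setT (fun x => (h x * r x)%:E).
Proof.
apply: (@le_integrable _ _ _ _ _ _ _ (EFin \o r)) => //.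
- by apply/measurable_EFinP; exact: measurable_funM.
- move=> x _ /=; rewrite lee_fin ger0_norm ?mulr_ge0// ger0_norm//.
  by rewrite ler_piMl//; case/andP: (h01 x).
Qed.

Let mtr : measurable_fun setT (theta \o r).
Proof. exact: measurable_lsc_comp. Qed.

Let tneg_int C K (g : T -> R) : (0 <= C)%R -> (0 <= K)%R ->
  (forall x, (0 <= x)%R -> (- (C + K * x))%:E <= theta x) ->
  (forall x, (0 <= g x)%R) -> measurable_fun setT g ->
  Q.-integrable setT (EFin \o g) ->
  \int[Q]_x (fun x => theta (g x))^\- x < +oo.
Proof.
move=> C0 K0 tl g0 mg gint.
have bint : Q.-integrable setT (EFin \o (fun x => C + K * g x)%R).
  rewrite (_ : _ \o _ = (EFin \o cst C) \+ (fun x => K%:E * (g x)%:E)).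
    by apply: integrableD => //; [exact: finite_measure_integrable_cst|exact: integrableZl].
  by apply/funext => x.
apply: le_lt_trans (integrable_lty _ bint) => //.
apply: ge0_le_integral => //.
- by apply: measurable_funeneg; exact: measurable_lsc_comp.
- exact: measurable_int bint.
- move=> x _; rewrite funenegE ge_max lee_fin addr_ge0 ?mulr_ge0// andbT.
  by rewrite leeNl -EFinN; exact: tl.
Qed.

Let trfin : \int[Q]_x theta (r x) \is a fin_num /\
  recession theta * Pp setT \is a fin_num.
Proof.
have [recN [C [K [C0 K0 tl]]]] := theta_lower_bound tproper tconv.
have recP : -oo < recession theta * Pp setT.
  case E : (recession theta) recN => [c| |] // _.
  - by rewrite -(fineK Ppfin) -EFinM ltNyr.
  - by apply: lt_le_trans (mule_ge0 _ _) => //; exact: leey.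
have tN : -oo < \int[Q]_x theta (r x).
  rewrite integralE; apply: lt_le_trans (_ : - (\int[Q]_x (fun x => theta (r x))^\- x) <= _).
    by rewrite lteNr; exact: (tneg_int C0 K0 tl r0 mr rint).
  by rewrite leeDr// integral_ge0.
move: Dfin tN recP; case: (\int[Q]_x _) => [a| |]//; case: (_ * _) => [b| |]//.
Qed.

Let trint : Q.-integrable setT (theta \o r).
Proof.
have [recN [C [K [C0 K0 tl]]]] := theta_lower_bound tproper tconv.
have nfin := tneg_int C0 K0 tl r0 mr rint.
apply/integrableP; split => //.
under eq_integral => x _ do rewrite -/((abse \o (theta \o r)) x) fune_abse.
rewrite ge0_integralD//; [|exact: measurable_funepos|exact: measurable_funeneg].
rewrite lte_add_pinfty//.
have [tfin _] := trfin; have e := integralE Q setT (theta \o r).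
have {}tfin : \int[Q]_x (theta \o r) x \is a fin_num := tfin.
move: tfin nfin; rewrite e.
have : 0 <= \int[Q]_x (theta \o r)^\- x by exact: integral_ge0.
move: (\int[Q]_x (theta \o r)^\- x) (\int[Q]_x (theta \o r)^\+ x).
by case=> [n| |] [x| |] //= _ _ _; rewrite ltry.
Qed.

(** The added mass is positive and sits where [r <= t], while [theta (r x)] is finite almost
    everywhere. *)
Let dom_low : exists2 a, edom theta a & (a <= t)%R.
Proof.
have [M [mM M0 sM]] := integrable_ae measurableT trint.
apply: contrapT => nex.
move: v_gt0; apply/negP; rewrite -leNgt.
rewrite (_ : \int[Q]_x (v x)%:E = \int[Q]_(x in M) (v x)%:E).
  by rewrite int_null.
rewrite integral_mkcond [RHS]integral_mkcond patch_setT.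
apply: eq_integral => x _; rewrite patchE; case: ifPn => // xM.
congr EFin; apply/eqP; rewrite -[_ == _]negbK; apply/negP => /vL[_ rt].
move: xM; rewrite notin_setE; apply; apply: sM => /= /(_ I).
apply/negP/negP => fin; apply: nex; exists (r x) => //; split => //.
by move: fin; rewrite fin_numElt => /andP[].
Qed.

(** Otherwise the domain would lie below [s], forcing an infinite recession constant and hence no
    singular part; all removed mass would then sit where [theta (r x) = +oo], against the finite
    divergence. *)
Let dom_high : exists2 b, edom theta b & (s <= b)%R.
Proof.
have [M [mM M0 sM]] := integrable_ae measurableT trint.
apply: contrapT => nex.
have rec : recession theta = +oo.
  apply: (@recession_bounded _ theta s); first by rewrite ltW// (lt_trans t0).
  by move=> x hx; rewrite ltNge; apply/negP => sx; apply: nex; exists x.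
have Pp0 : Pp setT = 0.
  apply/eqP/negPn/negP => n0; move: trfin => [_]; rewrite rec gt0_mulye//.
  by rewrite measure_gt0.
move: v_gt0; rewrite -hv (int_density_add rP)//; apply/negP; rewrite -leNgt.
have -> : \int[Pp]_x (h x)%:E = 0 by rewrite int_null.
rewrite adde0 (_ : \int[Q]_x (h x * r x)%:E = \int[Q]_(x in M) (h x * r x)%:E).
  by rewrite int_null//; exact: measurable_funM.
rewrite integral_mkcond [RHS]integral_mkcond patch_setT.
apply: eq_integral => x _; rewrite patchE; case: ifPn => // xM.
congr EFin; have [->|/hG] := eqVneq (h x) 0%R; first by rewrite mul0r.
case=> [/rN ->|sr]; first by rewrite mulr0.
exfalso; move: xM; rewrite notin_setE; apply; apply: sM => /= /(_ I).
apply/negP/negP => fin; apply: nex; exists (r x); last exact: ltW.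
by split => //; move: fin; rewrite fin_numElt => /andP[].
Qed.

(** The fraction [e h] of [P] is removed, where its density exceeds [s] or where it is singular, and
    the density [e v] of equal mass is added where [r <= t]. A unit added costs at most the slope
    [c1]; a unit removed saves at least [c2 > c1], on the density part by convexity and on the
    singular part because the recession constant dominates chord slopes. *)
Lemma divergence_decrease : exists2 e : R, (0 < e < 1)%R &
  \int[Q]_x theta ((1 - e * h x) * r x + e * v x)%R +
    recession theta * \int[Pp]_x (1 - e * h x)%:E <
  \int[Q]_x theta (r x) + recession theta * Pp setT.
Proof.
have t0' := t0; have ts' := ts.
have [a ha at_] := dom_low; have [b hb sb] := dom_high.
(* The gap between [t] and [s] is cut into four steps of length [dl]. Since [e * s = dl], adding at
   most [e * t] keeps a low density below [t1], and removing the fraction [e] keeps a high one above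
   [s1]; the chords from [t1] to [m] and from [m] to [s1] fit in between. *)
pose dl := ((s - t) / 4)%R; pose e := (dl / s)%R.
have s0 : (0 < s)%R := lt_trans t0 ts.
have dl0 : (0 < dl)%R by rewrite /dl; lra.
have es : (e * s = dl)%R by rewrite /e divfK// gt_eqF.
have e0 : (0 < e)%R by rewrite divr_gt0.
have e1 : (e < 1)%R by rewrite ltr_pdivrMr// /dl; lra.
have et : (e * t <= dl)%R by rewrite -es ler_wpM2l// ltW.
have sE : s = (t + 4 * dl)%R by rewrite /dl; field.
have hdom x : (t <= x <= s)%R -> edom theta x.
  move=> /andP[tx xs]; apply: (edom_between tconv ha hb).
  by rewrite (le_trans at_ tx) (le_trans xs sb).
pose t1 := (t + dl)%R; pose m := (t + 2 * dl)%R; pose s1 := (t + 3 * dl)%R.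
have ht1 : edom theta t1 by apply: hdom; rewrite /t1; apply/andP; split; lra.
have hm : edom theta m by apply: hdom; rewrite /m; apply/andP; split; lra.
have hs1 : edom theta s1 by apply: hdom; rewrite /s1; apply/andP; split; lra.
have t1m : (t1 < m)%R by rewrite /t1 /m; lra.
have ms1 : (m < s1)%R by rewrite /s1 /m; lra.
pose c1 := chord_slope theta t1 m; pose c2 := chord_slope theta m s1.
have c12 : (c1 < c2)%R by apply: chord_slope_lt => //; rewrite t1m.
exists e; first by rewrite e0.
pose r' x := ((1 - e * h x) * r x + e * v x)%R.
have eh1 x : (0 <= 1 - e * h x)%R.
  by have /andP[? ?] := h01 x; nra.
have r'0 x : (0 <= r' x)%R by rewrite /r' addr_ge0// mulr_ge0// ltW.
pose g x := (e * (c1 * v x - c2 * (h x * r x)))%R.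
have pw x : theta (r' x) <= theta (r x) + (g x)%:E.
  have [hx|nx] := pselect (edom theta (r x)); last by rewrite (theta_out (r0 x) nx) addye// leey.
  have triv : v x = 0%R -> (h x * r x = 0)%R -> theta (r' x) <= theta (r x) + (g x)%:E.
    move=> vx hrx; have -> : g x = 0%R by rewrite /g vx hrx !mulr0 subr0 mulr0.
    suff -> : r' x = r x by rewrite adde0.
    by rewrite /r' vx mulr0 addr0 mulrBl mul1r -mulrA hrx mulr0 subr0.
  have [hx0|hxN0] := eqVneq (h x) 0%R.
    have [vx0|vxN0] := eqVneq (v x) 0%R; first by apply: triv => //; rewrite hx0 mul0r.
    have [_ rxt] := vL vxN0.
    have r'E : r' x = (r x + e * v x)%R by rewrite /r' hx0 mulr0 subr0 mul1r.
    have evt : (e * v x <= dl)%R.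
      by have /andP[? ?] := v0t x; nra.
    have ev0 : (0 <= e * v x)%R by rewrite mulr_ge0// ltW.
    have rr't1 : (r x <= r' x <= t1)%R by rewrite r'E /t1; apply/andP; split; lra.
    have hr' : edom theta (r' x) by apply: (edom_between tconv hx ht1).
    rewrite (theta_finE tproper hx) (theta_finE tproper hr') -EFinD lee_fin.
    apply: le_trans (theta_slope_left tproper tconv ht1 hm hx t1m rr't1) _.
    by rewrite -/c1 r'E /g hx0; lra.
  (* On [N] the density is 0, so removal there only affects the singular part. *)
  have [/rN rx0|srx] := hG hxN0.
    have [vx0|/vL[Nx _]] := eqVneq (v x) 0%R; first by apply: triv => //; rewrite rx0 mulr0.
    by apply: triv; rewrite ?rx0 ?mulr0//; case: (hG hxN0) => [/Nx|]//; rewrite rx0 ltNge ltW.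
  have vx0 : v x = 0%R.
    by apply/eqP; rewrite -[_ == _]negbK; apply/negP => /vL[_]; rewrite leNgt (lt_trans ts).
  have r'E : r' x = ((1 - e * h x) * r x)%R by rewrite /r' vx0 mulr0 addr0.
  have eh : (e * h x <= e)%R by have /andP[? ?] := h01 x; nra.
  have eh0 : (0 <= e * h x)%R by rewrite mulr_ge0// ltW.
  have s1r' : (s1 <= r' x <= r x)%R.
    rewrite r'E; apply/andP; split; last by nra.
    apply: (@le_trans _ _ ((1 - e) * s)%R); first by rewrite mulrBl es mul1r /s1; lra.
    by apply: ler_pM; lra.
  have hr' : edom theta (r' x) by apply: (edom_between tconv hs1 hx).
  rewrite (theta_finE tproper hx) (theta_finE tproper hr') -EFinD lee_fin.
  apply: le_trans (theta_slope_right tproper tconv hs1 hm hx ms1 s1r') _.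
  by rewrite -/c2 r'E /g vx0; lra.
have mr' : measurable_fun setT r'.
  apply: measurable_funD; apply: measurable_funM => //.
  by apply: measurable_funB => //; exact: measurable_funM.
have gint : Q.-integrable setT (EFin \o g).
  rewrite (_ : _ \o _ = (fun x => (e * c1)%:E * (v x)%:E) \+
      (fun x => (- (e * c2))%:E * (h x * r x)%:E)); last first.
    by apply/funext => x /=; rewrite -!EFinM -EFinD /g; congr EFin; ring.
  by apply: integrableD => //; exact: integrableZl.
have tgint : Q.-integrable setT (fun x => theta (r x) + (g x)%:E).
  exact: integrableD.
have r'int : Q.-integrable setT (EFin \o r').
  apply: (@le_integrable _ _ _ _ _ _ _ (EFin \o (fun x => r x + v x)%R)) => //.
  - exact/measurable_EFinP.
  - move=> x _ /=; rewrite lee_fin ger0_norm// ger0_norm ?addr_ge0//.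
    have : (0 <= e * h x * r x)%R by apply: mulr_ge0 => //; apply: mulr_ge0 => //; exact: ltW.
    have : (0 <= (1 - e) * v x)%R by apply: mulr_ge0; [lra|exact: v0].
    by rewrite /r'; lra.
  - rewrite (_ : _ \o _ = (EFin \o r) \+ (EFin \o v)); last by apply/funext.
    exact: integrableD.
have mtr' : measurable_fun setT (theta \o r') by exact: measurable_lsc_comp.
have [recN [C [K [C0 K0 tl]]]] := theta_lower_bound tproper tconv.
(* Positive and negative parts are compared separately, because [theta \o r'] is not known to be
   integrable. *)
have I' : \int[Q]_x theta (r' x) <= \int[Q]_x (theta (r x) + (g x)%:E).
  rewrite integralE [leRHS]integralE leeB//.
    apply: ge0_le_integral => //; [exact: measurable_funepos|exact/measurable_funepos/measurable_int/tgint|].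
    by move=> x _; rewrite !funeposE ge_max le_max pw/= le_max lexx orbT.
  apply: ge0_le_integral => //; [exact/measurable_funeneg/measurable_int/tgint|exact: measurable_funeneg|].
  by move=> x _; rewrite !funenegE ge_max !le_max lexx orbT andbT leeN2 pw.
have Hint : Pp.-integrable setT (EFin \o h).
  apply: (@le_integrable _ _ _ _ _ _ _ (EFin \o cst 1%R)) => //.
  - exact/measurable_EFinP.
  - by move=> x _ /=; rewrite lee_fin ger0_norm// normr1; case/andP: (h01 x).
  - exact: finite_measure_integrable_cst.
have V0 := v_gt0; have hvV := hv; set V := \int[Q]_x (v x)%:E in V0 hvV.
have Vfin : V \is a fin_num by exact: integrable_fin_num.
set HQ := \int[Q]_x (h x * r x)%:E.
have HQfin : HQ \is a fin_num by exact: integrable_fin_num.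
set HP := \int[Pp]_x (h x)%:E.
have HPfin : HP \is a fin_num by exact: integrable_fin_num.
have VE : V = HQ + HP by rewrite -hvV (int_density_add rP).
have gE : \int[Q]_x (g x)%:E = (e * c1)%:E * V - (e * c2)%:E * HQ.
  rewrite -!integralZl//.
  rewrite -integralB//; [|exact: integrableZl..].
  by apply: eq_integral => x _; rewrite -!EFinM -EFinB /g; congr EFin; ring.
have PpE : \int[Pp]_x (1 - e * h x)%:E = Pp setT - e%:E * HP.
  under eq_integral do rewrite EFinB EFinM.
  rewrite integralB//.
  - by rewrite (integral_cst Pp measurableT 1) mul1e integralZl.
  - exact: finite_measure_integrable_cst.
  - exact: integrableZl.
have HP0 : 0 <= HP by exact: int_ge0.
have recP : recession theta * (Pp setT - e%:E * HP) <=
    recession theta * Pp setT - (e * c2)%:E * HP.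
  have := recession_ge tproper tconv ht1 hm hs1 t1m ms1; rewrite -/c2.
  have [Pp0|PpN0] := eqVneq (Pp setT) 0.
    have -> : HP = 0 by rewrite /HP int_null.
    by rewrite Pp0 !mule0 !sube0 mule0.
  have := trfin.2; case: (recession theta) recN => [c| |]// _.
    move=> _; rewrite -(fineK Ppfin) -(fineK HPfin) -!EFinM -!EFinB !lee_fin.
    have H0 : (0 <= fine HP)%R by exact: fine_ge0.
    move: (fine HP) H0 (fine (Pp setT)) => H H0 X cc2.
    have : (0 <= (c - c2) * (e * H))%R.
      by apply: mulr_ge0; [lra|apply: mulr_ge0 => //; exact: ltW].
    by lra.
  by rewrite gt0_mulye// measure_gt0.
rewrite PpE; apply: le_lt_trans (leeD I' recP) _.
rewrite integralD// gE.
have [Ifin Sfin] := trfin.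
rewrite VE; rewrite -(fineK Ifin) -(fineK Sfin) -(fineK HPfin) -(fineK HQfin).
rewrite -!EFinD lte_fin.
have u0 : (0 < fine HQ + fine HP)%R.
  by rewrite -lte_fin EFinD !fineK// -VE.
have : (0 < (c2 - c1) * (e * (fine HQ + fine HP)))%R.
  by apply: mulr_gt0; [lra|exact: mulr_gt0].
by lra.
Qed.

End divergence_decrease.

(** * Minimisers are level optimal *)

Lemma ex_pushforward d d' (Z : measurableType d) (Y : measurableType d')
    (R : realType) (m : {finite_measure set Z -> \bar R}) (q : Z -> Y) :
  measurable_fun setT q ->
  exists P : {finite_measure set Y -> \bar R}, forall A, P A = m (q @^-1` A).
Proof.
move=> mq; apply: ex_measure_of_function.
- by rewrite preimage_set0 measure0.
- by move=> A.
- move=> F mF tF mUF; rewrite preimage_bigcup.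
  apply: measure_semi_sigma_additive.
  + by move=> n; rewrite -[X in measurable X]setTI; exact: mq.
  + apply/trivIsetP => /= i j _ _ ij; rewrite -preimage_setI.
    by move/trivIsetP : tF => /(_ _ _ _ _ ij) ->//; rewrite preimage_set0.
  + by rewrite -preimage_bigcup -[X in measurable X]setTI; exact: mq.
- by rewrite preimage_setT; exact: finite_measure_lty.
Qed.

Lemma int_pushforward d d' (Z : measurableType d) (Y : measurableType d')
    (R : realType) (m : {finite_measure set Z -> \bar R}) (q : Z -> Y)
    (P : {finite_measure set Y -> \bar R}) (g : Y -> R) (B : set Y) :
  measurable_fun setT q ->
  (forall A, P A = m (q @^-1` A)) ->
  measurable_fun setT g -> (forall y, (0 <= g y)%R) -> measurable B ->
  \int[P]_(y in B) (g y)%:E = \int[m]_(z in q @^-1` B) (g (q z))%:E.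
Proof.
move=> mq PE mg g0 mB.
have -> : P = pushforward m q :> (set Y -> \bar R) by apply/funext => A; exact: PE.
apply: ge0_integral_pushforward => //.
- exact/measurable_funTS/measurable_EFinP.
- by move=> y _; rewrite lee_fin.
Qed.

Lemma le_measure_density d (T : measurableType d) (R : realType)
    (m : {finite_measure set T -> \bar R}) (w : T -> R) (c : R) A :
  measurable_fun setT w -> (forall x, (0 <= w x <= c)%R) -> measurable A ->
  \int[m]_(x in A) (w x)%:E <= c%:E * m A.
Proof.
move=> mw w01 mA; rewrite -integral_cst//; apply: ge0_le_integral => //.
- by move=> x _; rewrite lee_fin; case/andP: (w01 x).
- exact/measurable_funTS/measurable_EFinP.
- by move=> x _; rewrite lee_fin; case/andP: (w01 x).
Qed.

Lemma int_bounded_lty d (T : measurableType d) (R : realType)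
    (m : {finite_measure set T -> \bar R}) (w : T -> R) (c : R) :
  measurable_fun setT w -> (forall x, (0 <= w x <= c)%R) ->
  \int[m]_x (w x)%:E < +oo.
Proof.
move=> mw w01; apply: le_lt_trans (le_measure_density m mw w01 measurableT) _.
have /andP[w0 wc] := w01 point.
by apply: lte_mul_pinfty; rewrite ?finite_measure_lty// lee_fin (le_trans w0).
Qed.

(** The density [w] of [kappa] with respect to the [q]-marginal of [m] is at most 1, so reweighting
    [m] by [w \o q] stays below [m]. *)
Lemma ex_submeasure_with_marginal d d' (Z : measurableType d)
    (Y : measurableType d') (R : realType) (m : {finite_measure set Z -> \bar R})
    (q : Z -> Y) (kappa : {finite_measure set Y -> \bar R}) :
  measurable_fun setT q ->
  (forall B, measurable B -> kappa B <= m (q @^-1` B)) ->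
  exists sg : {finite_measure set Z -> \bar R},
    (forall A, measurable A -> sg A <= m A) /\
    (forall B, measurable B -> sg (q @^-1` B) = kappa B).
Proof.
move=> mq km; have [P PE] := ex_pushforward m mq.
have [|w [mw w01 wE]] := @ex_bounded_density _ _ _ kappa P 1 ler01.
  by move=> B mB; rewrite mul1e PE; exact: km.
have mwq : measurable_fun setT (fun z => w (q z)) by exact: measurableT_comp.
have w0 y : (0 <= w y)%R by case/andP: (w01 y).
have [sg sgE] := ex_density_measure mwq (fun z => w0 (q z))
  (int_bounded_lty m mwq (fun z => w01 (q z))).
exists sg; split=> [A mA|B mB].
  by rewrite sgE -[leRHS]mul1e; exact: le_measure_density.
by rewrite sgE -(int_pushforward mq PE mw w0 mB) wE.
Qed.

(** The exchange has to tell singular and absolutely continuous mass apart pointwise; [N] carries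
    all of the former and, with [r] set to 0 on it, none of the latter. *)
Lemma ex_clean_decomposition d (T : measurableType d) (R : realType)
    (P Q : {finite_measure set T -> \bar R}) :
  exists (r : T -> R) (Pp : {finite_measure set T -> \bar R}) (N : set T),
    [/\ is_lebesgue_decomposition P Q r Pp, measurable N, Q N = 0,
        Pp (~` N) = 0 & forall x, N x -> r x = 0%R].
Proof.
have [[r Pp] /= [mr r0 [N [mN QN PpN]] PE]] := ex_lebesgue_decomposition P Q.
have mNC : measurable (~` N) by exact: measurableC.
pose r1 x := (r x * \1_(~` N) x)%R.
have mr1 : measurable_fun setT r1 by apply: measurable_funM => //; exact: measurable_indic.
have r1N x : N x -> r1 x = 0%R.
  by move=> Nx; rewrite /r1 indicE memNset ?mulr0//; exact.
have r1C x : ~ N x -> r1 x = r x by move=> Nx; rewrite /r1 indicE mem_set ?mulr1.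
exists r1, Pp, N; split => //; split => //; [|by exists N|].
- by move=> x; rewrite mulr_ge0.
- move=> A mA; rewrite PE//; congr (_ + _); apply: ae_eq_integral => //.
  + exact/measurable_funTS/measurable_EFinP.
  + exact/measurable_funTS/measurable_EFinP.
  + by exists N; split => // x /= h; apply: contrapT => /r1C e; apply: h; rewrite e.
Qed.

Lemma int_one_sub d (T : measurableType d) (R : realType)
    (m : {finite_measure set T -> \bar R}) (f : T -> R) (c e : R) A :
  measurable_fun setT f -> (forall x, (0 <= f x <= c)%R) -> measurable A ->
  \int[m]_(x in A) (1 - e * f x)%:E = m A - e%:E * \int[m]_(x in A) (f x)%:E.
Proof.
move=> mf f01 mA.
have fint : m.-integrable A (EFin \o f).
  apply: (@le_integrable _ _ _ _ _ _ _ (EFin \o cst c)) => //.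
  - exact/measurable_funTS/measurable_EFinP.
  - move=> x _ /=; have /andP[f0 fc] := f01 x.
    by rewrite lee_fin ger0_norm// ger0_norm// (le_trans f0).
  - exact: finite_measure_integrable_cst.
under eq_integral do rewrite EFinB EFinM.
rewrite integralB//.
- by rewrite (integral_cst m mA 1) mul1e integralZl.
- exact: finite_measure_integrable_cst.
- exact: integrableZl.
Qed.

Lemma ex_supported_density d (T : measurableType d) (R : realType)
    (m P : {finite_measure set T -> \bar R}) (G : set T) (c : R) :
  (0 <= c)%R -> measurable G -> m (~` G) = 0 ->
  (forall A, measurable A -> m A <= c%:E * P A) ->
  exists h : T -> R, [/\ measurable_fun setT h, forall x, (0 <= h x <= c)%R,
    forall x, h x != 0%R -> G x &
    forall A, measurable A -> m A = \int[P]_(x in A) (h x)%:E].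
Proof.
move=> c0 mG mGC mP; have [h [mh h01 hE]] := ex_bounded_density c0 mP.
have hC x : ~ G x -> (h x * \1_G x = 0)%R by move=> Gx; rewrite indicE memNset ?mulr0.
have hG x : G x -> (h x * \1_G x = h x)%R by move=> Gx; rewrite indicE mem_set ?mulr1.
exists (fun x => h x * \1_G x)%R; split.
- by apply: measurable_funM => //; exact: measurable_indic.
- move=> x; have [/hG ->//|/hC ->] := pselect (G x).
  by rewrite lexx.
- by move=> x hx; apply: contrapT => /hC e; move: hx; rewrite e eqxx.
- move=> A mA.
  rewrite (@int_setU _ _ _ P A G)//; last 2 first.
  + by apply: measurable_funM => //; exact: measurable_indic.
  + by move=> x; rewrite mulr_ge0//; case/andP: (h01 x).
  rewrite [X in _ + X]integral0_eq; last by move=> x [_ /hC ->].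
  rewrite adde0 (eq_integral (fun x => (h x)%:E)); last first.
    by move=> x; rewrite inE => -[_ /hG ->].
  rewrite -hE; last exact: measurableI.
  rewrite (measureDI m mA mG) [X in X + _](_ : _ = 0) ?add0e//.
  apply: (subset_measure0 _ (measurableC mG)) => //; exact: measurableD.
Qed.

Lemma int_restr_marginal d d' (Z : measurableType d) (X : measurableType d')
    (R : realType) (m : {finite_measure set Z -> \bar R}) (p : Z -> X)
    (D : set Z) (al : {finite_measure set X -> \bar R}) (b : X -> R) (A : set X) :
  measurable_fun setT p -> measurable D ->
  (forall A, al A = m (p @^-1` A `&` D)) ->
  measurable_fun setT b -> (forall x, (0 <= b x)%R) -> measurable A ->
  \int[m]_(z in p @^-1` A) (b (p z) * \1_D z)%:E = \int[al]_(x in A) (b x)%:E.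
Proof.
move=> mp mD alE mb b0 mA.
have mpA : measurable (p @^-1` A) by rewrite -[X in measurable X]setTI; exact: mp.
pose mr : {finite_measure set Z -> \bar R} := mrestr m mD.
rewrite (int_pushforward (m := mr) mp alE mb b0 mA).
have mi : measurable_fun setT (\1_D : Z -> R) by exact: measurable_indic.
have mbp : measurable_fun setT (fun z => (b (p z))%:E).
  by apply/measurable_EFinP; exact: measurableT_comp.
rewrite (@ge0_integral_density _ _ _ mr m (\1_D : Z -> R) (fun z => (b (p z))%:E))//.
  move=> B mB; rewrite (_ : mr B = m (D `&` B)); last by rewrite setIC.
  by rewrite integral_indic.
by move=> z; rewrite lee_fin.
Qed.

Section level_optimality.
Context dz dx dy (Z : measurableType dz) (X : measurableType dx)
  (Y : measurableType dy) (R : realType).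
Variables (p : Z -> X) (q : Z -> Y) (E : set Z).
Hypotheses (mp : measurable_fun setT p) (mq : measurable_fun setT q)
  (mE : measurable E).
Variables (mu : {finite_measure set X -> \bar R})
  (nu : {finite_measure set Y -> \bar R}).
Implicit Types (pi sigma : {finite_measure set Z -> \bar R}).

Definition transports pi := pi (~` E) = 0 /\
  forall A, measurable A -> pi (p @^-1` A) = mu A.

Definition level_feasible (t : R) sigma := [/\ sigma (~` E) = 0,
  forall A, measurable A -> sigma (p @^-1` A) <= mu A &
  forall A, measurable A -> sigma (q @^-1` A) <= t%:E * nu A].

Let mqi A : measurable A -> measurable (q @^-1` A).
Proof. by move=> mA; rewrite -[X in measurable X]setTI; exact: mq. Qed.
Let mpi A : measurable A -> measurable (p @^-1` A).
Proof. by move=> mA; rewrite -[X in measurable X]setTI; exact: mp. Qed.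

Lemma level_integral_le pi t : transports pi -> (0 < t)%R ->
  \int[nu]_y (Num.min (density (pushforward pi q) nu y) t)%:E <=
  ereal_sup [set sigma setT | sigma in level_feasible t].
Proof.
move=> [piE pimu] t0.
have [P PE] := ex_pushforward pi mq.
have [[r Pp] /= rP] := ex_lebesgue_decomposition P nu.
rewrite (@level_integral_eq _ _ _ P nu _ r Pp)//.
have [mr r0 _ _] := rP.
pose k y := Num.min (r y) t.
have mk : measurable_fun setT k by exact: measurable_minr.
have k0t y : (0 <= k y <= t)%R by rewrite le_min r0 ltW//= ge_min lexx orbT.
have k0 y : (0 <= k y)%R by case/andP: (k0t y).
have [kappa kE] := ex_density_measure mk k0 (int_bounded_lty nu mk k0t).
have kP B : measurable B -> kappa B <= pi (q @^-1` B).
  move=> mB; rewrite kE -PE; apply: le_trans (lebesgue_decomposition_int_le rP mB).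
  by apply: le_int => // y _; rewrite ge_min lexx.
have [sg [sgpi sgq]] := ex_submeasure_with_marginal mq kP.
apply: ereal_sup_ubound => /=; exists sg; last first.
  by rewrite -kE -(sgq _ measurableT) preimage_setT.
split.
- apply/eqP; rewrite eq_le measure_ge0 andbT -piE; apply: sgpi.
  exact: measurableC.
- by move=> A mA; rewrite -pimu//; apply/sgpi/mpi.
- by move=> A mA; rewrite sgq// kE; exact: le_measure_density.
Qed.

End level_optimality.

Section minimizer_level_optimality.
Context dz dx dy (Z : measurableType dz) (X : measurableType dx)
  (Y : measurableType dy) (R : realType).
Variables (p : Z -> X) (q : Z -> Y) (E : set Z).
Hypotheses (mp : measurable_fun setT p) (mq : measurable_fun setT q)
  (mE : measurable E).
Variables (mu : {finite_measure set X -> \bar R})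
  (nu : {finite_measure set Y -> \bar R}).
Implicit Types (pi sigma : {finite_measure set Z -> \bar R}).

Let mqi A : measurable A -> measurable (q @^-1` A).
Proof. by move=> mA; rewrite -[X in measurable X]setTI; exact: mq. Qed.
Let mpi A : measurable A -> measurable (p @^-1` A).
Proof. by move=> mA; rewrite -[X in measurable X]setTI; exact: mp. Qed.

(* Either [pi] can be improved by an exchange along [sigma], i.e. some points
   from which [sigma] reaches the level set [r <= t] are sent by [pi] strictly
   above level [t], or [sigma] does not carry more than [\int min r t]. *)
Lemma exchange_or_bound pi sigma t r (Pp : {finite_measure set Y -> \bar R}) N
    (P : {finite_measure set Y -> \bar R})
    (be : {finite_measure set X -> \bar R}) (b : X -> R) :
  transports p E mu pi -> level_feasible p q E mu nu t sigma -> (0 < t)%R ->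
  (forall A, P A = pi (q @^-1` A)) ->
  is_lebesgue_decomposition P nu r Pp -> measurable N -> nu N = 0 ->
  Pp (~` N) = 0 ->
  let L := [set y | (r y <= t)%R] `\` N in
  (forall A, be A = sigma (p @^-1` A `&` q @^-1` L)) ->
  measurable_fun setT b -> (forall x, (0 <= b x <= 1)%R) ->
  (forall A, measurable A -> be A = \int[mu]_(x in A) (b x)%:E) ->
  (forall s, (t < s)%R ->
    \int[pi]_(z in q @^-1` (N `|` [set y | (s < r y)%R])) (b (p z))%:E = 0) ->
  sigma setT <= \int[nu]_y (Num.min (r y) t)%:E.
Proof.
move=> [piE pimu] [sgE sgp sgq] t0 PE rP mN nuN PpN L beE mb b01 bE Js.
have b0 x : (0 <= b x)%R by case/andP: (b01 x).
have [mr r0 _ PrE] := rP.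
have mbp : measurable_fun setT (fun z => b (p z)) by exact: measurableT_comp.
have mGs s : measurable (N `|` [set y | (s < r y)%R]).
  apply: measurableU => //; rewrite -[X in measurable X]setTI.
  exact: measurable_fun_ltr.
have mL : measurable L.
  apply: measurableD => //; rewrite -[X in measurable X]setTI.
  exact: measurable_fun_ler.
have LC : ~` L = N `|` [set y | (t < r y)%R].
  apply/seteqP; split => y /=.
    move=> h; have [Ny|nNy] := pselect (N y); [by left|right].
    by rewrite ltNge; apply/negP => h'; apply: h.
  by move=> [Ny [_ /(_ Ny)]//|tr [rt _]]; move: (le_lt_trans rt tr); rewrite ltxx.
have mLC : measurable (~` L) by exact: measurableC.
have mLCq := mqi mLC; have mLq := mqi mL.
have bpi_fin : \int[pi]_z (b (p z))%:E = be setT.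
  have [M ME] := ex_pushforward pi mp.
  rewrite -[[set: Z]](preimage_setT p) -(int_pushforward mp ME mb b0 measurableT).
  by rewrite bE//; apply: eq_measure_integral => A mA _; exact: etrans (ME A) (pimu A mA).
have bpi_lty : \int[pi]_z (b (p z))%:E < +oo.
  by rewrite bpi_fin; exact: finite_measure_lty.
(* By hypothesis no [b]-weighted mass of [pi] lies over [N] or above any level [s > t]; the sets
   [F n], for [s = t + 1 / (n + 1)], exhaust the preimage of the complement of [L]. *)
have J0 : \int[pi]_(z in q @^-1` (~` L)) (b (p z))%:E = 0.
  have [bpi bpiE] := ex_density_measure mbp (fun z => b0 (p z)) bpi_lty.
  pose F n := q @^-1` (N `|` [set y | (t + n.+1%:R^-1 < r y)%R]).
  have FE : q @^-1` (~` L) = \bigcup_n F n.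
    rewrite LC; apply/seteqP; split => z.
      move=> [Nz|tr]; first by exists 0%N => //; left.
      have [n hn] : exists n, (n.+1%:R^-1 < r (q z) - t)%R.
        exists (Num.truncn (r (q z) - t)^-1).
        rewrite -[ltRHS]invrK ltf_pV2 ?posrE ?invr_gt0 ?subr_gt0//.
        by have := truncnS_gt (r (q z) - t)^-1%R.
      by exists n => //; right => /=; rewrite -ltrBrDl.
    move=> [n _ [Nz|tr]]; [by left|right] => /=.
    by apply: le_lt_trans tr; rewrite lerDl.
  rewrite -bpiE FE.
  have := @nondecreasing_cvg_mu _ _ _ bpi F.
  have Fm n : measurable (F n) by exact/mqi/mGs.
  have F0 n : bpi (F n) = 0 by rewrite bpiE; apply: Js; rewrite ltrDl.
  move=> /(_ Fm) cvF.
  have {cvF} : bpi \o F @ \oo --> bpi (\bigcup_n F n).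
    apply: cvF; first exact: bigcupT_measurable.
    move=> m n mn; apply/subsetPset => z [Nz|tr]; [by left|right] => /=.
    apply: le_lt_trans tr; rewrite lerD2l lef_pV2 ?posrE//.
    by rewrite ler_nat ltnS.
  rewrite (_ : bpi \o F = cst 0); last by apply/funext => n /=.
  by move/cvg_unique => /(_ (@ereal_hausdorff R) _ (cvg_cst _)).
(* The mass that [sigma] sends into [L] equals the [b]-weighted mass of [pi], which all lies over
   [L] and is therefore at most [P L], the integral of [r]. *)
have b1 : be setT <= \int[nu]_(y in L) (r y)%:E.
  rewrite -bpi_fin (@int_setU _ _ _ pi setT _ (fun z => b (p z)) measurableT mLCq mbp)// setTI.
  rewrite J0 add0e setTD -preimage_setC setCK.
  apply: le_trans (le_measure_density pi mbp (fun z => b01 (p z)) mLq) _.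
  rewrite mul1e -PE PrE// [X in _ + X](_ : _ = 0) ?adde0//.
  by apply: (subset_measure0 mL (measurableC mN)) => // y [].
have mmin : measurable_fun setT (fun y => Num.min (r y) t) by exact: measurable_minr.
rewrite (measureDI sigma measurableT mLq).
rewrite (int_setU (B := L) _ _ _ mmin)//; last by move=> y; rewrite le_min r0 ltW.
rewrite [leRHS]addeC; apply: leeD; last first.
  apply: (@le_trans _ _ (be setT)); first by rewrite beE preimage_setT.
  apply: le_trans b1 _; rewrite setTI le_eqVlt; apply/orP; left; apply/eqP.
  by apply: eq_integral => y; rewrite inE => -[/= ry _]; rewrite min_l.
(* Off [L] the feasibility bound [t nu] is exactly what is wanted, since [min r t = t] there outside
   [N]. *)
rewrite !setTD preimage_setC; apply: le_trans (sgq _ mLC) _.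
rewrite -integral_cst// le_eqVlt; apply/orP; left; apply/eqP.
apply: ae_eq_integral => //; first exact/measurable_funTS/measurable_EFinP.
exists N; split => // y /= h; apply: contrapT => nNy; apply: h => Ly.
rewrite min_r// leNgt; apply/negP => rt.
by apply: Ly; split => //=; exact: ltW.
Qed.

Lemma ex_better_transport theta pi sigma t s r
    (Pp : {finite_measure set Y -> \bar R}) N
    (P : {finite_measure set Y -> \bar R})
    (be : {finite_measure set X -> \bar R}) (b : X -> R) :
  proper_nneg theta -> lsc_nneg theta -> strictly_convex_on_dom theta ->
  transports p E mu pi -> level_feasible p q E mu nu t sigma -> (0 < t)%R ->
  (forall A, P A = pi (q @^-1` A)) ->
  is_lebesgue_decomposition P nu r Pp -> measurable N -> nu N = 0 ->
  Pp (~` N) = 0 -> (forall y, N y -> r y = 0%R) ->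
  let L := [set y | (r y <= t)%R] `\` N in
  let G := N `|` [set y | (s < r y)%R] in
  (forall A, be A = sigma (p @^-1` A `&` q @^-1` L)) ->
  measurable_fun setT b -> (forall x, (0 <= b x <= 1)%R) ->
  (forall A, measurable A -> be A = \int[mu]_(x in A) (b x)%:E) ->
  (t < s)%R ->
  \int[pi]_(z in q @^-1` G) (b (p z))%:E != 0 ->
  \int[nu]_y theta (r y) + recession theta * Pp setT < +oo ->
  exists2 pi', transports p E mu pi' &
    divergence theta (pushforward pi' q) nu <
    \int[nu]_y theta (r y) + recession theta * Pp setT.
Proof.
move=> tprop tlsc tconv [piE pimu] [sgE sgp sgq] t0 PE rP mN nuN PpN rN L G beE
  mb b01 bE ts Jn0 Dfin.
have [mr r0 _ PrE] := rP.
have mG : measurable G.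
  apply: measurableU => //; rewrite -[X in measurable X]setTI.
  exact: measurable_fun_ltr.
have mL : measurable L.
  apply: measurableD => //; rewrite -[X in measurable X]setTI.
  exact: measurable_fun_ler.
have mGq := mqi mG; have mLq := mqi mL.
have [al alE] := ex_pushforward (mrestr pi mGq : {finite_measure set Z -> \bar R}) mp.
have {}alE A : al A = pi (p @^-1` A `&` q @^-1` G) by exact: alE.
have [|a [ma a01 aE]] := @ex_bounded_density _ _ _ al mu 1 ler01.
  move=> A mA; rewrite mul1e -pimu// alE; apply: le_measure; rewrite ?inE//.
  + by apply: measurableI => //; exact: mpi.
  + exact: mpi.
have a0 x : (0 <= a x)%R by case/andP: (a01 x).
have b0 x : (0 <= b x)%R by case/andP: (b01 x).
(* The weights are crossed: the part of [pi] over [G] is weighted by the density [b] coming from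
   [sigma], and the part of [sigma] over [L] by the density [a] coming from [pi]. Both then have
   first marginal [a b mu], which is [phipsi]. *)
pose phi z := (b (p z) * \1_(q @^-1` G) z)%R.
pose psi z := (a (p z) * \1_(q @^-1` L) z)%R.
have mphi : measurable_fun setT phi.
  by apply: measurable_funM; [exact: measurableT_comp|exact: measurable_indic].
have mpsi : measurable_fun setT psi.
  by apply: measurable_funM; [exact: measurableT_comp|exact: measurable_indic].
have ind01 (c : R) D (z : Z) : (0 <= c <= 1)%R -> (0 <= c * \1_D z <= 1)%R.
  by move=> c01; rewrite indicE; case: (_ \in _); rewrite ?mulr1 ?mulr0// lexx ler01.
have phi01 z : (0 <= phi z <= 1)%R by exact: ind01.
have psi01 z : (0 <= psi z <= 1)%R by exact: ind01.
have phi0 z : (0 <= phi z)%R by case/andP: (phi01 z).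
have psi0 z : (0 <= psi z)%R by case/andP: (psi01 z).
have phipsi A : measurable A -> \int[pi]_(z in p @^-1` A) (phi z)%:E =
    \int[sigma]_(z in p @^-1` A) (psi z)%:E.
  move=> mA; rewrite (int_restr_marginal mp mGq alE mb b0 mA).
  rewrite (int_restr_marginal mp mLq beE ma a0 mA).
  rewrite (ge0_integral_density ma a0 aE mA)//; last exact/measurable_EFinP.
  rewrite (ge0_integral_density mb b0 bE mA)//; last exact/measurable_EFinP.
  by apply: eq_integral => x _; rewrite muleC.
have [u uE] := ex_density_measure mphi phi0 (int_bounded_lty pi mphi phi01).
have [w wE] := ex_density_measure mpsi psi0 (int_bounded_lty sigma mpsi psi01).
have [U UE] := ex_pushforward u mq.
have [V VE] := ex_pushforward w mq.
have [||h [mh h01 hG hE]] := @ex_supported_density _ _ _ U P G 1 ler01 mG.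
- rewrite UE uE integral0_eq// => z Gz.
  by rewrite /phi indicE memNset ?mulr0.
- move=> A mA; rewrite UE uE PE; apply: le_measure_density => //; exact: mqi.
(* Feasibility of [sigma] at level [t] gives the bound [v <= t]. *)
have [||v [mv v0t vL vE]] := @ex_supported_density _ _ _ V nu L t (ltW t0) mL.
- rewrite VE wE integral0_eq// => z Lz.
  by rewrite /psi indicE memNset ?mulr0.
- move=> A mA; rewrite VE wE; apply: le_trans (sgq _ mA); rewrite -[leRHS]mul1e.
  by apply: le_measure_density => //; exact: mqi.
have h0 y : (0 <= h y)%R by case/andP: (h01 y).
have v0 y : (0 <= v y)%R by case/andP: (v0t y).
have hv : \int[P]_x (h x)%:E = \int[nu]_x (v x)%:E.
  rewrite -hE// -vE// UE VE uE wE !preimage_setT.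
  by have := phipsi _ measurableT; rewrite !preimage_setT.
(* The exchanged mass is the [b]-weighted mass of [pi] over [G], nonzero by hypothesis. *)
have v_gt0 : 0 < \int[nu]_x (v x)%:E.
  rewrite -hv lt0e int_ge0// andbT -hE// UE uE preimage_setT.
  apply: contra_neq Jn0 => J0; rewrite -J0.
  rewrite (@int_setU _ _ _ pi setT _ phi measurableT mGq mphi phi0) setTI.
  rewrite [X in _ = _ + X]integral0_eq ?adde0; last first.
    by move=> z [_ Gz]; rewrite /phi indicE memNset ?mulr0.
  by apply: eq_integral => z zG; rewrite /phi indicE zG mulr1.
have [||e /andP[e0 e1] De] := @divergence_decrease _ _ _ theta tprop tlsc tconv
  P nu r Pp N t s h v rP rN t0 ts mh h01 _ mv v0t _ hv v_gt0 Dfin.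
- by move=> y /hG.
- by move=> y /vL [].
have eh0 y : (0 <= 1 - e * h y <= 1)%R by have /andP[? ?] := h01 y; apply/andP; split; nra.
have ephi0 z : (0 <= 1 - e * phi z <= 1)%R by have /andP[? ?] := phi01 z; apply/andP; split; nra.
have epsi0 z : (0 <= e * psi z <= 1)%R by have /andP[? ?] := psi01 z; apply/andP; split; nra.
have meh : measurable_fun setT (fun y => 1 - e * h y)%R.
  by apply: measurable_funB => //; exact: measurable_funM.
have mephi : measurable_fun setT (fun y => 1 - e * phi y)%R.
  by apply: measurable_funB => //; exact: measurable_funM.
have mepsi : measurable_fun setT (fun y => e * psi y)%R by exact: measurable_funM.
have ge0 (T : Type) (c : R) (f : T -> R) : (forall x, (0 <= f x <= c)%R) -> forall x, (0 <= f x)%R.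
  by move=> f01 x; case/andP: (f01 x).
have [m1 m1E] := ex_density_measure mephi (ge0 _ _ _ ephi0) (int_bounded_lty pi mephi ephi0).
have [m2 m2E] := ex_density_measure mepsi (ge0 _ _ _ epsi0) (int_bounded_lty sigma mepsi epsi0).
have m12fin : measure_add m1 m2 setT < +oo.
  by rewrite measure_addE lte_add_pinfty// finite_measure_lty.
have [pi' pi'E] := measure_finite_of m12fin.
have {}pi'E A : measurable A -> pi' A = pi A - e%:E * \int[pi]_(z in A) (phi z)%:E
    + e%:E * \int[sigma]_(z in A) (psi z)%:E.
  move=> mA; rewrite -(int_one_sub pi e mphi phi01 mA).
  rewrite -ge0_integralZl_EFin//; last 3 first.
  + by move=> z _; rewrite lee_fin.
  + exact/measurable_funTS/measurable_EFinP.
  + exact: ltW.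
  by rewrite -m1E -m2E pi'E; exact: measure_addE.
have fin d' (T : measurableType d') (m : {finite_measure set T -> \bar R}) (f : T -> R) A :
    measurable_fun setT f -> (forall x, (0 <= f x <= 1)%R) -> measurable A ->
    e%:E * \int[m]_(x in A) (f x)%:E \is a fin_num.
  move=> mf f01 mA; apply: fin_numM => //; rewrite ge0_fin_numE.
    apply: le_lt_trans (le_measure_density m mf f01 mA) _.
    by rewrite mul1e; exact: finite_measure_lty.
  by apply: int_ge0; exact: ge0 _ _ _ f01.
have [Pp' Pp'E] := ex_density_measure meh (ge0 _ _ _ eh0) (int_bounded_lty Pp meh eh0).
have [P' P'E] := ex_pushforward pi' mq.
pose r' y := ((1 - e * h y) * r y + e * v y)%R.
have mr' : measurable_fun setT r'.
  by apply: measurable_funD; apply: measurable_funM.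
(* The added mass is absolutely continuous, so the singular part only shrinks, by the factor
   [1 - e h]. *)
have r'P : is_lebesgue_decomposition P' nu r' Pp'.
  split => //.
  - move=> y; apply: addr_ge0; apply: mulr_ge0 => //; [exact: ge0 _ _ _ eh0 y|exact: ltW].
  - exists N; split => //; rewrite Pp'E int_null//; exact: measurableC.
  - move=> B mB; rewrite P'E pi'E; last exact: mqi.
    rewrite -uE -UE hE// -wE -VE vE// -PE -(int_one_sub P e mh h01 mB).
    rewrite (int_density_add rP)//; last exact: ge0 _ _ _ eh0.
    rewrite -Pp'E addeAC; congr (_ + _).
    rewrite -ge0_integralZl_EFin//; last 3 first.
    + by move=> z _; rewrite lee_fin.
    + exact/measurable_funTS/measurable_EFinP.
    + exact: ltW.
    rewrite -ge0_integralD//.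
    + by move=> y _; rewrite lee_fin mulr_ge0//; exact: ge0 _ _ _ eh0 y.
    + by apply/measurable_funTS/measurable_EFinP; exact: measurable_funM.
    + by move=> y _; rewrite mule_ge0// lee_fin// ltW.
    + by apply/measurable_funTS; apply/measurable_EFinP; exact: measurable_funM.
exists pi'; last first.
  rewrite (divergence_eq tlsc (P := P') _ r'P); last by move=> A _; exact/esym/P'E.
  by rewrite Pp'E.
split.
  have mEC : measurable (~` E) by exact: measurableC.
  by rewrite pi'E// piE !int_null// !mule0 sube0 adde0.
move=> A mA; have mpA := mpi mA; rewrite pi'E// phipsi// pimu//.
by rewrite subeK//; exact: fin.
Qed.

Lemma minimizer_level_ge theta pi t sigma :
  proper_nneg theta -> lsc_nneg theta -> strictly_convex_on_dom theta ->
  transports p E mu pi ->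
  (forall pi', transports p E mu pi' ->
     divergence theta (pushforward pi q) nu <=
     divergence theta (pushforward pi' q) nu) ->
  divergence theta (pushforward pi q) nu < +oo -> (0 < t)%R ->
  level_feasible p q E mu nu t sigma ->
  sigma setT <= \int[nu]_y (Num.min (density (pushforward pi q) nu y) t)%:E.
Proof.
move=> tprop tlsc tconv pitr pimin + t0 sgf.
have [P PE] := ex_pushforward pi mq.
have [r [Pp [N [rP mN nuN PpN rN]]]] := ex_clean_decomposition P nu.
rewrite (@level_integral_eq _ _ _ P nu _ r Pp)//.
have PE' A : measurable A -> pushforward pi q A = P A by move=> _; exact/esym/PE.
rewrite (divergence_eq tlsc PE' rP) => Dfin.
have [mr r0 _ PrE] := rP.
pose L := [set y | (r y <= t)%R] `\` N.
have mL : measurable L.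
  apply: measurableD => //; rewrite -[X in measurable X]setTI.
  exact: measurable_fun_ler.
have mLq := mqi mL.
have [be beE] := ex_pushforward (mrestr sigma mLq : {finite_measure set Z -> \bar R}) mp.
have {}beE A : be A = sigma (p @^-1` A `&` q @^-1` L) by exact: beE.
have [|b [mb b01 bE]] := @ex_bounded_density _ _ _ be mu 1 ler01.
  move=> A mA; rewrite mul1e; have [_ sgp _] := sgf; apply: le_trans (sgp _ mA).
  rewrite beE; apply: le_measure; rewrite ?inE//.
  + by apply: measurableI => //; exact: mpi.
  + exact: mpi.
apply: (exchange_or_bound pitr sgf t0 PE rP mN nuN PpN beE mb b01 bE) => s ts.
apply/eqP/negPn/negP => Jn0.
have [pi' pi'tr] := ex_better_transport tprop tlsc tconv pitr sgf t0 PE rP mN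
  nuN PpN rN beE mb b01 bE ts Jn0 Dfin.
rewrite -(divergence_eq tlsc PE' rP); apply/negP; rewrite -leNgt.
exact: pimin.
Qed.

End minimizer_level_optimality.

(** * Regularity of Borel measures *)

Lemma cvge_near_lt (R : realType) (u : nat -> \bar R) (l c : \bar R) :
  u n @[n --> \oo] --> l -> l < c -> \forall n \near \oo, u n < c.
Proof. by move=> cv lc; have := cv [set x | x < c] (open_ereal_lt' lc). Qed.

Lemma cvge_limit_le (R : realType) (u : nat -> \bar R) (l c : \bar R) :
  u n @[n --> \oo] --> l -> (forall n, u n <= c) -> l <= c.
Proof.
move=> cv uc; rewrite -(cvg_lim _ cv)//; apply: lime_le; last exact: nearW.
by apply/cvg_ex; exists l.
Qed.

Lemma borel_open_measurable (T : ptopologicalType) (A : set T) :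
  open A -> measurable (A : set (borel T)).
Proof. exact: sub_sigma_algebra. Qed.

Lemma borel_closed_measurable (T : ptopologicalType) (A : set T) :
  closed A -> measurable (A : set (borel T)).
Proof.
have h : open (~` A) -> measurable (A : set (borel T)).
  by move=> /borel_open_measurable/measurableC; rewrite setCK.
by move=> cA; apply: h; rewrite openC.
Qed.

Section outer_regularity.
Context (R : realType) (T : ptopologicalType) (d : T -> T -> R).
Hypothesis dm : metrizes d.
Variable m : {finite_measure set (borel T) -> \bar R}.

Let mO (A : set T) : open A -> measurable (A : set (borel T)).
Proof. exact: borel_open_measurable. Qed.
Let mF (A : set T) : closed A -> measurable (A : set (borel T)).
Proof. exact: borel_closed_measurable. Qed.

(** Two-sided approximation is stable under complements, unlike outer regularity alone; this makes
    the sets with the property a sigma-algebra. *)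
Definition squeezed (A : set T) := forall e : R, (0 < e)%R ->
  exists F G : set T, [/\ closed F, open G, F `<=` A, A `<=` G &
    m (G `\` F) <= e%:E].

Lemma squeezed_open (A : set T) : open A -> squeezed A.
Proof.
move=> oA e e0.
have [F [cF ndF FA AF]] := metric_open_exhaustion dm oA.
have AE : A = \bigcup_n F n.
  apply/seteqP; split => [x /AF[n /nbhs_singleton Fx]|x [n _ /FA//]].
  by exists n.
have mFn n : measurable (F n : set (borel T)) by exact: mF.
have cv : m (A `\` F n) @[n --> \oo] --> m (\bigcap_n (A `\` F n)).
  apply: nonincreasing_cvg_mu.
  - by apply: finite_measure_lty; apply: measurableD => //; exact: mO.
  - by move=> n; apply: measurableD => //; exact: mO.
  - by apply: bigcapT_measurable => n; apply: measurableD => //; exact: mO.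
  - by move=> n k nk; apply/subsetPset; apply: setDS; exact/subsetPset/ndF.
have e0' : \bigcap_n (A `\` F n) = set0.
  rewrite -subset0 => x /= h; have [Ax _] := h 0%N I.
  by move: Ax; rewrite AE => -[n _ Fx]; have [] := h n I.
rewrite e0' measure0 in cv.
have [N _ hN] : \forall n \near \oo, m (A `\` F n) < e%:E.
  by apply: (cvge_near_lt cv); rewrite lte_fin.
exists (F N), A; split => //.
by apply/ltW/hN => /=.
Qed.

Lemma squeezedC (A : set T) : squeezed A -> squeezed (~` A).
Proof.
move=> sA e e0; have [F [G [cF oG FA AG h]]] := sA e e0.
exists (~` G), (~` F); split.
- by rewrite closedC.
- by rewrite openC.
- exact: subsetC.
- exact: subsetC.
- by rewrite setDE setCK setIC -setDE.
Qed.

Lemma squeezed_bigcup (A : nat -> set T) : (forall n, squeezed (A n)) ->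
  squeezed (\bigcup_n A n).
Proof.
move=> sA e e0; have e20 : (0 < e / 2)%R by rewrite divr_gt0.
have /choice[FG hFG] n : exists FG : set T * set T,
    [/\ closed FG.1, open FG.2, FG.1 `<=` A n, A n `<=` FG.2 &
    m (FG.2 `\` FG.1) <= (e / 2 / (2 ^ n.+1)%:R)%:E].
  have [|F [G h]] := sA n (e / 2 / (2 ^ n.+1)%:R)%R.
    by rewrite divr_gt0// ltr0n expn_gt0.
  by exists (F, G).
pose F n := (FG n).1; pose G n := (FG n).2.
have cF n : closed (F n) by case: (hFG n).
have oG n : open (G n) by case: (hFG n).
have FA n : F n `<=` A n by case: (hFG n).
have AG n : A n `<=` G n by case: (hFG n).
have hm n : m (G n `\` F n) <= (e / 2 / (2 ^ n.+1)%:R)%:E by case: (hFG n).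
pose H n := \bigcup_(k < n) F k.
have cH n : closed (H n) by rewrite /H bigcup_mkord; apply: closed_bigsetU.
have oGG : open (\bigcup_n G n) by exact: bigcup_open.
pose D n := (\bigcup_n F n) `\` H n.
have mFF : measurable (\bigcup_n F n : set (borel T)).
  by apply: bigcupT_measurable => n; exact: mF.
have mD n : measurable (D n : set (borel T)) by apply: measurableD => //; exact: mF.
have cv : m (D n) @[n --> \oo] --> m (\bigcap_n D n).
  apply: nonincreasing_cvg_mu => //.
  - exact: finite_measure_lty.
  - exact: bigcapT_measurable.
  - move=> n k nk; apply/subsetPset; apply: setDS => x [j /= jn Fx].
    by exists j => //=; exact: leq_trans nk.
have e0' : \bigcap_n D n = set0.
  rewrite -subset0 => x /= h; have [[n _ Fx] _] := h 0%N I.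
  by have [_] := h n.+1 I; apply; exists n => /=.
rewrite e0' measure0 in cv.
have [N _ hN] : \forall n \near \oo, m (D n) < (e / 2)%:E.
  by apply: (cvge_near_lt cv); rewrite lte_fin.
(* The union of all [F n] need not be closed, so finitely many are kept; the rest has measure below
   [e / 2]. *)
exists (H N), (\bigcup_n G n); split => //.
- by move=> x [n _ Fx]; exists n => //; exact: FA.
- by move=> x [n _ Ax]; exists n => //; exact: AG.
have mGF n : measurable (G n `\` F n : set (borel T)).
  by apply: measurableD; [exact: mO|exact: mF].
have mGFU : measurable (\bigcup_n (G n `\` F n) : set (borel T)).
  exact: bigcupT_measurable.
apply: (@le_trans _ _ (m ((\bigcup_n (G n `\` F n)) `|` D N))).
  apply: le_measure; rewrite ?inE//.
  - by apply: measurableD; [exact: mO|exact: mF].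
  - exact: measurableU.
  - move=> x [[n _ Gx] nHx]; have [Fx|nFx] := pselect (F n x).
      by right; split => //; exists n.
    by left; exists n.
apply: (@le_trans _ _ (m (\bigcup_n (G n `\` F n)) + m (D N))); first exact: measureU2.
rewrite (splitr e) EFinD; apply: leeD; last by apply/ltW/hN => /=.
apply: le_trans (generalized_Boole_inequality m mGF mGFU) _.
apply: le_trans (epsilon_trick0 xpredT (ltW e20)).
by apply: lee_nneseries => // n _; exact: hm.
Qed.

Lemma squeezed_measurable (A : set (borel T)) : measurable A -> squeezed A.
Proof.
apply: smallest_sub => //; last exact: squeezed_open.
split.
- exact: squeezed_open open0.
- by move=> B sB; rewrite setTD; exact: squeezedC.
- exact: squeezed_bigcup.
Qed.

Lemma outer_regular (A : set (borel T)) (e : R) : measurable A -> (0 < e)%R ->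
  exists G : set T, [/\ open G, A `<=` G & m G <= m A + e%:E].
Proof.
move=> mA e0; have [F [G [cF oG FA AG h]]] := squeezed_measurable mA e0.
exists G; split => //.
apply: (@le_trans _ _ (m (A `|` (G `\` A)))).
  by rewrite setDUK.
have mGA : measurable (G `\` A : set (borel T)) by apply: measurableD => //; exact: mO.
apply: (le_trans (measureU2 _ mA mGA)); rewrite leeD2l//.
apply: le_trans h; apply: le_measure; rewrite ?inE//.
  by apply: measurableD; [exact: mO|exact: mF].
exact: setDS.
Qed.

(** By outer regularity it suffices to compare on open sets, the only ones on which the limit
    measure built below is controlled directly. *)
Lemma le_measure_of_open (f : set (borel T) -> \bar R) :
  (forall A B, measurable A -> measurable B -> A `<=` B -> f A <= f B) ->
  (forall G : set T, open G -> f G <= m G) ->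
  forall A, measurable A -> f A <= m A.
Proof.
move=> fle fO A mA; apply/lee_addgt0Pr => e e0.
have [G [oG AG mG]] := outer_regular mA e0.
by apply: le_trans (fle _ _ mA _ AG) _; [exact: mO|exact: le_trans (fO _ oG) mG].
Qed.

End outer_regularity.

(** * Almost everywhere selections of closed graphs *)

Section thick_sets.
Context d (T : measurableType d) (R : realType).
Variable m : {finite_measure set T -> \bar R}.

(* [thick c A] says that the outer measure of [A] is at least [c]. *)
Definition thick (c : R) (A : set T) := forall B, measurable B -> A `<=` B ->
  c%:E <= m B.

(** Projections of closed sets need not be Borel, hence the use of outer measure. If every [A n] had
    a measurable cover [B n] of measure below [c'], the tail intersections [H n] would be increasing
    covers whose union has measure at most [c']. *)
Lemma thick_bigcup (A : nat -> set T) (c c' : R) : nondecreasing_seq A ->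
  (c' < c)%R -> thick c (\bigcup_n A n) -> exists n, thick c' (A n).
Proof.
move=> ndA cc' tA; apply: contrapT => nex.
have /choice[B hB] n : exists B, [/\ measurable B, A n `<=` B & m B < c'%:E].
  apply: contrapT => nB; apply: nex; exists n => B mB AB.
  by rewrite leNgt; apply/negP => mBc; apply: nB; exists B.
pose H n := \bigcap_(k in [set k | (n <= k)%N]) B k.
have mB n : measurable (B n) by case: (hB n).
have mH n : measurable (H n) by apply: bigcap_measurable => //; exists n => /=.
have mHU : measurable (\bigcup_n H n) by exact: bigcupT_measurable.
have ndH : nondecreasing_seq H.
  by move=> n k nk; apply/subsetPset => x h j /= kj; apply: h => /=; exact: leq_trans kj.
have AH : \bigcup_n A n `<=` \bigcup_n H n.
  move=> x [n _ Ax]; exists n => // k /= nk; have [_ AB _] := hB k; apply: AB.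
  by have /subsetPset := ndA _ _ nk; exact.
have := tA _ mHU AH; apply/negP; rewrite -ltNge.
apply: (@le_lt_trans _ _ c'%:E); last by rewrite lte_fin.
have cv : m (H n) @[n --> \oo] --> m (\bigcup_n H n) by exact: nondecreasing_cvg_mu.
apply: (cvge_limit_le cv) => n /=; have [_ _ /ltW] := hB n; apply: le_trans.
by apply: le_measure; rewrite ?inE// => x; apply => /=.
Qed.

End thick_sets.

Section compact_sections.
Context (R : realType) (X Y : ptopologicalType) (d : X -> X -> R)
  (d' : Y -> Y -> R).
Hypotheses (dm : metrizes d) (dm' : metrizes d').
Hypothesis dcomplete : forall u : nat -> Y,
  (forall e : R, (0 < e)%R -> exists N : nat, forall m n : nat,
    (N <= m)%N -> (N <= n)%N -> (d' (u m) (u n) < e)%R) ->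
  exists l : Y, u @ \oo --> l.
Variables (y : nat -> Y).
Hypothesis ydense : forall (z : Y) (e : R), (0 < e)%R ->
  exists n, (d' (y n) z <= e)%R.
Variable E : set (X * Y).
Hypotheses (cE : closed E) (totE : forall x, exists z, E (x, z)).

(** The projection to [X] of the part of [E] lying over [A]. *)
Definition reaching (A : set Y) : set X := [set x | exists2 z, A z & E (x, z)].

(** The tube argument: if the fibre of [x] over the compact [C] misses [E], so do the fibres of all
    points near [x]. *)
Lemma closed_reaching (C : set Y) : compact C -> closed (reaching C).
Proof.
move=> /compact_near_coveringP Cnc; rewrite -openC openE => x nx.
rewrite /interior; have := Cnc X (nbhs x) (fun x' z => ~ E (x', z)) _.
have h : forall z, C z -> \forall z' \near z & x' \near x, ~ E (x', z').
  move=> z Cz; have : nbhs (x, z) (~` E).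
    by apply: open_nbhs_nbhs; split; [rewrite openC|move=> Exz; apply: nx; exists z].
  case=> -[A B] /= [nA nB] AB; exists (B, A) => //=.
  by move=> [z' x'] /= [Bz Ax]; exact: (AB (x', z')).
move=> /(_ _ h); apply: filterS => x' hx' [z Cz Exz].
exact: (hx' z Cz).
Qed.

Variable m : {finite_measure set (borel X) -> \bar R}.

Let U k n := \bigcup_(i < n) [set z | (d' (y i) z <= 2^-1 ^+ k)%R].

Let closedU k n : closed (U k n).
Proof.
by rewrite /U bigcup_mkord; apply: closed_bigsetU => i _; exact: metric_cball_closed.
Qed.

Let coverU k (z : Y) : exists n, U k n z.
Proof.
have [|n hn] := ydense z (e := (2^-1 ^+ k)%R); first by rewrite exprn_gt0// invr_gt0.
by exists n.+1; exists n => /=.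
Qed.

Let ndU k n n' : (n <= n')%N -> U k n `<=` U k n'.
Proof. by move=> nn' z [i /= ni zi]; exists i => //=; exact: leq_trans nn'. Qed.

(** The capacitability argument for analytic sets. Finite unions of balls of radius [2^-k] are
    intersected one scale at a time, each cut losing little outer measure of the projection. The
    intersection [C] is compact, and its projection is nearly full because it contains the
    intersection of the closures of the projections. *)
Lemma ex_compact_reaching (e : R) : (0 < e)%R ->
  exists C, [/\ compact C, closed C & m (~` reaching C) <= e%:E].
Proof.
move=> e0; pose M := fine (m setT).
have ME : m setT = M%:E by rewrite fineK// fin_num_measure.
(* [c] decreases strictly from the full mass [M] towards [M - e]; each step provides the strict gap
   that [thick_bigcup] asks for. *)
pose c k := (M - e * (1 - 2^-1 ^+ k))%R.
have /choice[f hf] (kD : nat * set Y) : exists n,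
    thick m (c kD.1) (reaching kD.2) ->
    thick m (c kD.1.+1) (reaching (kD.2 `&` U kD.1 n)).
  case: kD => k D /=; have [tk|ntk] := pselect (thick m (c k) (reaching D)); last by exists 0%N.
  have [n1 n2 n12|||n hn] := @thick_bigcup _ _ _ m (fun n => reaching (D `&` U k n)) (c k) (c k.+1).
  - apply/subsetPset => x [z [Dz Uz] Exz]; exists z => //; split => //; exact: ndU Uz.
  - rewrite /c exprS; have : (0 < 2^-1 ^+ k :> R)%R by rewrite exprn_gt0// invr_gt0.
    by set a := (_ ^+ k)%R => a0; nra.
  - move=> B mB AB; apply: tk => // x [z Dz Exz]; apply: AB.
    by have [n Un] := coverU k z; exists n => //; exists z.
  - by exists n.
pose D := fix D k := if k is k'.+1 then D k' `&` U k' (f (k', D k')) else setT.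
have tD k : thick m (c k) (reaching (D k)).
  elim: k => [|k IH]; last exact: (hf (k, D k)).
  move=> B mB AB; rewrite /c expr0 subrr mulr0 subr0 -ME.
  apply: le_measure; rewrite ?inE// => x _; apply: AB.
  by have [z Exz] := totE x; exists z.
have cD k : closed (D k).
  elim: k => [|k IH] /=; first exact: closedT.
  exact: closedI.
have ndD k k' : (k <= k')%N -> D k' `<=` D k.
  move=> kk'; rewrite -(subnK kk'); elim: (k' - k)%N => [//|n IH].
  by rewrite addSn /= => z [Dz _]; exact: IH.
have DU k k' : (k < k')%N -> D k' `<=` U k (f (k, D k)).
  by move=> kk' z /(ndD _ _ kk') /= [].
pose C := \bigcap_k D k.
have cC : closed C by apply: closed_bigI => k _; exact: cD.
have kC : compact C.
  apply: (totally_bounded_closed_compact dm' dcomplete (y := y)) => // k.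
  by exists (f (k, D k)) => z Cz; exact: (DU k k.+1 (ltnSn k) z (Cz k.+1 I)).
exists C; split => //.
pose cl k := closure (reaching (D k)).
have ccl k : closed (cl k) by exact: closed_closure.
(* The sets [D k] are not compact, so points of [E] over them whose first coordinates approach [x]
   are made to converge in [Y] along an ultrafilter, which total boundedness allows. Closedness of
   the [D k] and of [E] then applies to the limit. *)
have clC : \bigcap_k cl k `<=` reaching C.
  move=> x hx.
  have /choice[xz hxz] k : exists xz : X * Y, [/\ E xz, D k xz.2 & (d x xz.1 < 2^-1 ^+ k)%R].
    have [|x' [z Dz Exz] xx'] := metric_closureP dm (hx k I) (e := (2^-1 ^+ k)%R).
      by rewrite exprn_gt0// invr_gt0.
    by exists (x', z).
  have [V [VU Voo]] := ultraFilterLemma (F := nbhs \oo) _.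
  pose F := (fun k => (xz k).2) @ V.
  have Vge k : V [set j | (k <= j)%N] by apply: Voo; exact: nbhs_infty_ge.
  have [||l Fl] := totally_bounded_ultra_cvg dm' dcomplete (y := y) (F := F) _.
  - by move=> A; exact: (in_ultra_setVsetC ((fun k => (xz k).2) @^-1` A) VU).
  - move=> k; exists (f (k, D k)).
    suff : V [set j | U k (f (k, D k)) (xz j).2] by [].
    apply: filterS (Vge k.+1) => j /= kj.
    by have [_ Dj _] := hxz j; exact: DU Dj.
  have {}Fl B : nbhs l B -> V [set j | B (xz j).2] by move=> /Fl.
  exists l.
    move=> k _; apply: cD => B /Fl FB.
    have [j [/= Bj kj]] := filter_ex (filterI FB (Vge k)).
    by exists (xz j).2; split => //; have [_ Dj _] := hxz j; exact: ndD Dj.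
  apply: cE => B [[B1 B2] /= [nB1 nB2] B12].
  have [e' e'0 eB1] := (dm.2 x B1).1 nB1.
  have [K hK] := half_pow_lt e'0.
  have [j [/= Bj Kj]] := filter_ex (filterI (Fl _ nB2) (Vge K)).
  exists (xz j); have [Ej Dj xj] := hxz j; split => //.
  apply: B12; split => //=; apply: eB1 => /=; apply: lt_trans xj _.
  by apply: le_lt_trans hK; rewrite ler_wiXn2l// ?invr_ge0// invf_le1// ler1n.
have mcl k : measurable (~` cl k : set (borel X)).
  by apply: measurableC; exact: borel_closed_measurable (ccl k).
have mU : measurable (\bigcup_k ~` cl k : set (borel X)) by exact: bigcupT_measurable.
have cR := closed_reaching kC.
apply: (@le_trans _ _ (m (\bigcup_k ~` cl k))).
  apply: le_measure; rewrite ?inE//; first by apply: measurableC; exact: borel_closed_measurable cR.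
  by rewrite -setC_bigcap; exact: subsetC.
have cv : m (~` cl k) @[k --> \oo] --> m (\bigcup_k ~` cl k).
  apply: nondecreasing_cvg_mu => // k k' kk'; apply/subsetPset/subsetC/closureS.
  by move=> x [z Dz Exz]; exists z => //; exact: ndD Dz.
apply: (cvge_limit_le cv) => k.
have mclk : measurable (cl k : set (borel X)) by exact: borel_closed_measurable (ccl k).
have mT : m setT = m (~` cl k) + m (cl k).
  by have := measureDI m (@measurableT _ (borel X)) mclk; rewrite setTD setTI.
have -> : m (~` cl k) = M%:E - m (cl k).
  by rewrite -ME mT addeK// fin_num_measure.
rewrite leeBlDr ?fin_num_measure//.
apply: (@le_trans _ _ (e%:E + (c k)%:E)); last first.
  by rewrite leeD2l//; apply: (tD k) => //; exact: subset_closure.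
rewrite -EFinD lee_fin /c.
have : (0 <= 2^-1 ^+ k :> R)%R by rewrite exprn_ge0// invr_ge0.
by set a := (_ ^+ k)%R => a0; nra.
Qed.

End compact_sections.

(** The disjointified sets select the first suitable index, so the preimage of any set of indices is
    a countable union of measurable pieces. *)
Lemma ex_measurable_index d (T : measurableType d) (A : nat -> set T) :
  (forall n, measurable (A n)) -> (forall x, exists n, A n x) ->
  exists f : T -> nat, (forall S, measurable (f @^-1` S)) /\
    forall x, A (f x) x.
Proof.
move=> mA covA.
have /choice[f fP] x : exists n, seqDU A n x.
  have : (\bigcup_n A n) x by have [n An] := covA x; exists n.
  by rewrite seqDU_bigcup_eq => -[n _ An]; exists n.
exists f; split; last by move=> x; have [] := fP x.
move=> S; have -> : f @^-1` S = \bigcup_(n in S) seqDU A n.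
  apply/seteqP; split => [x Sx|x [n Sn An]]; first by exists (f x).
  suff : f x = n by rewrite /preimage/= => ->.
  have /trivIsetP tA := @trivIset_seqDU _ A.
  apply/eqP/negPn/negP => ne; have := tA _ _ I I ne.
  by rewrite -subset0 => /(_ x); apply; split.
apply: bigcup_measurable => n _; apply: measurableD => //.
exact: bigsetU_measurable.
Qed.

Section closed_valued_selection.
Context (R : realType) dX (X : measurableType dX) (Y : ptopologicalType)
  (d : Y -> Y -> R).
Hypothesis dm : metrizes d.
Hypothesis dcomplete : forall u : nat -> Y,
  (forall e : R, (0 < e)%R -> exists N : nat, forall m n : nat,
    (N <= m)%N -> (N <= n)%N -> (d (u m) (u n) < e)%R) ->
  exists l : Y, u @ \oo --> l.
Variables (y : nat -> Y).
Hypothesis ydense : forall (z : Y) (e : R), (0 < e)%R ->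
  exists n, (d (y n) z <= e)%R.
Variable Phi : X -> set Y.
Hypotheses (cPhi : forall x, closed (Phi x)) (Phi0 : forall x, Phi x !=set0)
  (mPhi : forall F : set Y, closed F -> measurable [set x | Phi x `&` F !=set0]).

Let dC a b : d a b = d b a. Proof. by case: dm => -[]. Qed.
Let dT a b c : (d a c <= d a b + d b c)%R. Proof. by case: dm => -[]. Qed.

Let dxx a : d a a = 0%R.
Proof. by case: dm => -[_ dE _ _] _; apply/dE. Qed.

Let B n i : set Y := [set z | (d (y i) z <= 2^-1 ^+ n)%R].

Let cB n i : closed (B n i). Proof. exact: metric_cball_closed. Qed.

Let covB n z : exists i, B n i z.
Proof. by apply: ydense; rewrite exprn_gt0// invr_gt0. Qed.

Let good n (j : X -> nat) := (forall S, measurable (j @^-1` S)) /\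
  forall x, Phi x `&` B n (j x) !=set0.

Let good_step n j : good n j -> exists2 j', good n.+1 j' &
  forall x, B n (j x) `&` B n.+1 (j' x) !=set0.
Proof.
move=> [mj jP].
pose A i := [set x | Phi x `&` (B n (j x) `&` B n.+1 i) !=set0].
have [i|x|j' [mj' j'P]] := @ex_measurable_index _ _ A.
- rewrite (_ : A i = \bigcup_k (j @^-1` [set k] `&`
      [set x | Phi x `&` (B n k `&` B n.+1 i) !=set0])); last first.
    apply/seteqP; split => [x Ax|x [k _ [/= jx]]]; first by exists (j x).
    by rewrite /A /= jx.
  apply: bigcupT_measurable => k; apply: measurableI => //.
  by apply: mPhi; exact: closedI.
- have [z [Pz Bz]] := jP x; have [i Bi] := covB n.+1 z.
  by exists i; exists z.
- exists j'; first split => // x.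
    by have [z [Pz [_ Bz]]] := j'P x; exists z.
  by move=> x; have [z [_ Bz]] := j'P x; exists z.
Qed.

(** The Kuratowski and Ryll-Nardzewski construction: at each scale the first ball of radius [2^-n]
    that meets [Phi x] inside the previous ball is chosen, and the centres converge to the
    selection. *)
Lemma ex_closed_valued_selection : exists g : X -> Y,
  measurable_fun setT (g : X -> borel Y) /\ forall x, Phi x (g x).
Proof.
have [j0 gj0] : exists j, good 0%N j.
  pose A i := [set x | Phi x `&` B 0 i !=set0].
  have [i|x|j [mj jP]] := @ex_measurable_index _ _ A.
  - exact: mPhi.
  - by have [z Pz] := Phi0 x; have [i Bi] := covB 0 z; exists i; exists z.
  - by exists j.
have /choice[f hf] (nj : nat * (X -> nat)) : exists j', good nj.1 nj.2 ->
    good nj.1.+1 j' /\ forall x, B nj.1 (nj.2 x) `&` B nj.1.+1 (j' x) !=set0.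
  case: nj => n j /=; have [gj|ngj] := pselect (good n j); last by exists j.
  by have [j' h1 h2] := good_step gj; exists j'.
pose J := fix J n := if n is n'.+1 then f (n', J n') else j0.
have gJ n : good n (J n).
  by elim: n => [//|n IH]; exact: (hf (n, J n) IH).1.
have lJ n x : B n (J n x) `&` B n.+1 (J n.+1 x) !=set0.
  exact: (hf (n, J n) (gJ n)).2.
have p0 n : (0 < 2^-1 ^+ n :> R)%R by rewrite exprn_gt0// invr_gt0.
have step n x : (d (y (J n x)) (y (J n.+1 x)) <= 2 * 2^-1 ^+ n)%R.
  have [z [/= z1 z2]] := lJ n x; apply: le_trans (dT _ z _) _; rewrite (dC z).
  have {}z1 : (d (y (J n x)) z <= 2^-1 ^+ n)%R := z1.
  have {}z2 : (d (y (J n.+1 x)) z <= 2^-1 ^+ n.+1)%R := z2.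
  by move: z1 z2 (p0 n); rewrite exprS; set a := (_ ^+ n)%R; lra.
(* The step [2 * 2^-n] is the difference [4 * 2^-n - 4 * 2^-(n+1)], so the bound telescopes. *)
have chain n k x : (d (y (J n x)) (y (J (k + n)%N x)) <=
    4 * 2^-1 ^+ n - 4 * 2^-1 ^+ (k + n))%R.
  elim: k => [|k IH]; first by rewrite add0n subrr dxx.
  apply: le_trans (dT _ (y (J (k + n)%N x)) _) _.
  apply: le_trans (lerD IH (step _ _)) _; rewrite addSn exprS.
  by set a := (_ ^+ (k + n))%R; set b := (_ ^+ n)%R; lra.
have /choice[g hg] x : exists l, forall n, (d (y (J n x)) l <= 4 * 2^-1 ^+ n)%R.
  apply: (geometric_cauchy_cvg dm dcomplete (u := fun n => y (J n x)) (K := 4)).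
  move=> m n nm; rewrite -(subnK nm); apply: le_trans (chain _ _ _) _.
  by rewrite lerBlDr lerDl mulr_ge0// ltW.
(* At most two distances of size [4 * 2^-n] will be added; the constant 9 leaves a strict margin. *)
have small (e : R) : (0 < e)%R -> exists n, (9 * 2^-1 ^+ n < e)%R.
  move=> e0; have [|n hn] := @half_pow_lt R (e / 9); first by rewrite divr_gt0.
  by exists n; move: hn; rewrite ltr_pdivlMr// mulrC.
exists g; split; last first.
  move=> x; apply: (metric_closedP dm (@cPhi x)) => e /small[n hn].
  have [_ /(_ x)[z [Pz zn]]] := gJ n; exists z => //.
  have {}zn : (d (y (J n x)) z <= 2^-1 ^+ n)%R := zn.
  apply: le_lt_trans (dT _ (y (J n x)) _) _; rewrite dC.
  apply: le_lt_trans hn; move: (hg x n) zn (p0 n).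
  by set a := (_ ^+ n)%R; lra.
have mgF (F : set Y) : closed F -> measurable (g @^-1` F).
  (* [g x] lies in [F] exactly when, at every scale, the chosen centre is within the convergence
     rate [4 * 2^-n] of a point of [F]. This only involves the indices [J n], all of whose preimages
     are measurable. *)
  move=> cF; pose S n := [set i | exists2 z, F z & (d (y i) z <= 4 * 2^-1 ^+ n)%R].
  rewrite (_ : g @^-1` F = \bigcap_n (J n @^-1` S n)).
    by apply: bigcapT_measurable => n; have [mJ _] := gJ n.
  apply/seteqP; split => [x Fg n _|x h]; first by exists (g x).
  apply: (metric_closedP dm cF) => e /small[n hn].
  have [z Fz zn] := h n I; exists z => //.
  apply: le_lt_trans (dT _ (y (J n x)) _) _; rewrite dC.
  apply: le_lt_trans hn; move: (hg x n) zn (p0 n).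
  by set a := (_ ^+ n)%R; lra.
apply: (@measurability _ _ X (borel Y) setT g (@open Y)) => // _ [A oA <-].
rewrite setTI -(setCK A) preimage_setC; apply: measurableC.
by have := mgF (~` A); apply; rewrite closedC.
Qed.

End closed_valued_selection.

Section graph_selection.
Context (R : realType) (X Y : ptopologicalType) (d : X -> X -> R)
  (d' : Y -> Y -> R).
Hypotheses (dm : metrizes d) (dm' : metrizes d').
Hypothesis dcomplete : forall u : nat -> Y,
  (forall e : R, (0 < e)%R -> exists N : nat, forall m n : nat,
    (N <= m)%N -> (N <= n)%N -> (d' (u m) (u n) < e)%R) ->
  exists l : Y, u @ \oo --> l.
Variables (y : nat -> Y).
Hypothesis ydense : forall (z : Y) (e : R), (0 < e)%R ->
  exists n, (d' (y n) z <= e)%R.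
Variable E : set (X * Y).
Hypotheses (cE : closed E) (totE : forall x, exists z, E (x, z)).
Variable m : {finite_measure set (borel X) -> \bar R}.

(* Borel uniformisation fails for closed sets with non-compact sections; off a
   null set one can restrict to countably many compact subsets of [Y]. *)
Lemma ex_ae_selection : exists (g : X -> Y) (G : set X),
  [/\ measurable_fun setT (g : borel X -> borel Y),
      measurable (G : set (borel X)), m (~` G) = 0 &
      forall x, G x -> E (x, g x)].
Proof.
have /choice[C hC] n : exists C, [/\ compact C, closed C &
    m (~` reaching E C) <= (n.+1%:R^-1)%:E].
  by apply: (ex_compact_reaching dm dm' dcomplete ydense cE totE); rewrite invr_gt0.
pose K n := reaching E (C n).
have cK n : closed (K n) by have [kC _ _] := hC n; exact: closed_reaching.
have mK n : measurable (K n : set (borel X)) by exact: borel_closed_measurable (cK n).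
pose G := \bigcup_n K n.
have mG : measurable (G : set (borel X)) by exact: bigcupT_measurable.
have mGC : measurable (~` G : set (borel X)) by exact: measurableC.
(* Index 0 is reserved for the null set off [G], where [Phi] will be the whole space so that the
   selection stays total. *)
pose A n := if n is n'.+1 then K n' else ~` G.
have [[|n]|x|f [mf fA]] := @ex_measurable_index _ (borel X) A.
- exact: mGC.
- exact: mK.
- by have [[n _ Kx]|nG] := pselect (G x); [exists n.+1|exists 0%N].
pose Phi x := if f x is n.+1 then [set z | C n z /\ E (x, z)] else setT.
have [x|x|F cF|g [mg gP]] :=
    @ex_closed_valued_selection _ _ (borel X) _ _ dm' dcomplete _ ydense Phi.
- rewrite /Phi; case: (f x) => [|n]; first exact: closedT.
  apply: closedI; first by case: (hC n).
  apply: (closed_comp (f := fun z => (x, z)) _ cE) => z _.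
  by apply: cvg_pair; [exact: cvg_cst|exact: cvg_id].
- have := fA x; rewrite /Phi; case: (f x) => [|n] /=; first by exists point.
  by move=> [z Cz Exz]; exists z.
(* Over each positive index the values stay in one compact set [C n], so the points whose section
   hits [F] come from a closed projection. *)
- rewrite (_ : [set x | _] = (f @^-1` [set 0%N] `&` [set x | F !=set0]) `|`
      \bigcup_n (f @^-1` [set n.+1] `&` reaching E (C n `&` F))).
    apply: measurableU.
      apply: measurableI => //; have [h|h] := pselect (F !=set0).
        by rewrite (_ : [set _ | _] = setT)//; apply/seteqP; split.
      by rewrite (_ : [set _ | _] = set0)//; apply/seteqP; split.
    apply: bigcupT_measurable => n; apply: measurableI => //.
    apply: borel_closed_measurable; apply: closed_reaching => //.
    by have [kC _ _] := hC n; exact: compact_closedI.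
  apply/seteqP; split => [x|x [[/= fx [z Fz]]|[n _ [/= fx [z [Cz Fz] Exz]]]]].
  + rewrite /Phi /=; case E' : (f x) => [|n] [z [Pz Fz]].
      by left; split => //; exists z.
    by right; exists n => //; split => //; have [Cz Exz] := Pz; exists z.
  + by rewrite /Phi fx; exists z.
  + by rewrite /Phi fx; exists z.
exists g, G; split => //.
- apply/eqP; rewrite eq_le measure_ge0 andbT; apply/lee_addgt0Pr => e e0.
  have [n hn] : exists n, (n.+1%:R^-1 < e :> R)%R.
    exists (Num.truncn e^-1); rewrite -[ltRHS]invrK ltf_pV2 ?posrE ?invr_gt0//.
    exact: truncnS_gt.
  rewrite add0e; apply: (@le_trans _ _ (m (~` K n))).
    apply: le_measure; rewrite ?inE//; first exact: measurableC.
    by apply: subsetC => x Kx; exists n.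
  by have [_ _] := hC n; move=> /le_trans; apply; rewrite lee_fin ltW.
- move=> x Gx; have := gP x; have := fA x; rewrite /Phi.
  by case: (f x) => [/(_ Gx)//|n _ []].
Qed.

End graph_selection.

(** * From finitely additive set functions to measures *)

Section regularisation.
Context (R : realType) (T : ptopologicalType) (d : T -> T -> R).
Hypothesis dm : metrizes d.
Variables (la : set T -> \bar R) (M : R).
Hypotheses (la0 : forall K, compact K -> 0 <= la K) (la_set0 : la set0 = 0)
  (laM : forall K, compact K -> la K <= M%:E)
  (la_le : forall K K', compact K -> compact K' -> K `<=` K' -> la K <= la K')
  (laU : forall K K', compact K -> compact K' -> la (K `|` K') <= la K + la K')
  (laD : forall K K', compact K -> compact K' -> K `&` K' = set0 ->
    la K + la K' <= la (K `|` K')).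

(** The classical passage from a content on compact sets to a Borel measure starts here: open sets
    are approximated from inside, then all sets from outside by open ones. *)
Definition inner_open (G : set T) : \bar R :=
  ereal_sup [set la K | K in [set K | compact K /\ K `<=` G]].

Let inner_ge K G : compact K -> K `<=` G -> la K <= inner_open G.
Proof. by move=> cK KG; apply: ereal_sup_ubound; exists K. Qed.

Let inner_ge0 G : 0 <= inner_open G.
Proof. by rewrite -la_set0; apply: inner_ge => //; exact: compact0. Qed.

Let inner_leM G : inner_open G <= M%:E.
Proof. by apply: ge_ereal_sup => _ [K [cK _] <-]; exact: laM. Qed.

Let inner_le G G' : G `<=` G' -> inner_open G <= inner_open G'.
Proof.
move=> GG'; apply: ge_ereal_sup => _ [K [cK KG] <-].
by apply: inner_ge => //; exact: subset_trans GG'.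
Qed.

(** A compact [K] in the union is covered by the interiors of the closed exhausting sets [F n k].
    Compactness bounds both indices by one [N], and the parts of [K] in the sets [F n N] are
    compact, so finite subadditivity applies. *)
Let inner_bigcup (G : nat -> set T) : (forall n, open (G n)) ->
  inner_open (\bigcup_n G n) <= \sum_(n <oo) inner_open (G n).
Proof.
move=> oG; apply: ge_ereal_sup => _ [K [cK KG] <-].
have /choice[F hF] n := metric_open_exhaustion dm (oG n).
have ndF n k l : (k <= l)%N -> F n k `<=` F n l.
  by have [_ + _ _] := hF n => nd kl; exact/subsetPset/nd.
have /compact_near_coveringP/(_ nat \oo
  (fun N x => exists2 n, (n < N)%N & F n N x)) := cK.
have h : forall x, K x -> \forall x' \near x & N \near \oo,
    exists2 n, (n < N)%N & F n N x'.
  move=> x /KG[n _ Gx]; have [_ _ _ /(_ x Gx)[m nm]] := hF n.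
  exists (F n m, [set N | (maxn n.+1 m <= N)%N]) => /=.
    by split => //; exact: nbhs_infty_ge.
  move=> [x' N] /= [Fx']; rewrite geq_max => /andP[nN mN].
  by exists n => //; exact: ndF Fx'.
move=> /(_ _ h)[N _ /(_ N (leqnn N)) KF].
have cKF n : compact (K `&` F n N).
  by apply: compact_closedI => //; have [+ _ _ _] := hF n; exact.
have {}KF : K `<=` \bigcup_(n < N) (K `&` F n N).
  by move=> x Kx; have [n nN Fx] := KF x Kx; exists n.
have cupS (S : nat -> set T) n :
    \bigcup_(k < n.+1) S k = (\bigcup_(k < n) S k) `|` S n.
  by rewrite !bigcup_mkord big_ord_recr.
have cU n : compact (\bigcup_(k < n) (K `&` F k N)).
  elim: n => [|n IH]; first by rewrite bigcup_mkord big_ord0; exact: compact0.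
  by rewrite cupS; exact: compactU.
have sumF n : la (\bigcup_(k < n) (K `&` F k N)) <= \sum_(k < n) la (K `&` F k N).
  elim: n => [|n IH]; first by rewrite bigcup_mkord !big_ord0 la_set0.
  by rewrite cupS big_ord_recr/=; apply: le_trans (laU _ _) _ => //; rewrite leeD2r.
apply: le_trans (la_le cK (cU N) KF) _; apply: le_trans (sumF N) _.
apply: (@le_trans _ _ (\sum_(k < N) inner_open (G k))).
  apply: lee_sum => k _; apply: inner_ge => //.
  by apply: subset_trans (@subIsetr _ _ _) _; have [_ _ + _] := hF k; exact.
rewrite -(big_mkord xpredT (fun k => inner_open (G k))).
by apply: nneseries_lim_ge => k _ _.
Qed.

Definition regularised (A : set T) : \bar R :=
  ereal_inf [set inner_open G | G in [set G | open G /\ A `<=` G]].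

Let reg_le_open A G : open G -> A `<=` G -> regularised A <= inner_open G.
Proof. by move=> oG AG; apply: ereal_inf_lbound; exists G. Qed.

Lemma regularised_open G : open G -> regularised G = inner_open G.
Proof.
move=> oG; apply/eqP; rewrite eq_le reg_le_open//=.
by apply: le_ereal_inf_tmp => _ [G' [oG' GG'] <-]; exact: inner_le.
Qed.

Let reg_ge0 A : 0 <= regularised A.
Proof. by apply: le_ereal_inf_tmp => _ [G _ <-]. Qed.

Let reg_leM A : regularised A <= M%:E.
Proof. by apply: le_trans (reg_le_open openT (@subsetT _ A)) _. Qed.

Let reg_fin A : regularised A \is a fin_num.
Proof. by rewrite ge0_fin_numE//; apply: le_lt_trans (reg_leM A) _; exact: ltry. Qed.

Let reg0 : regularised set0 = 0.
Proof.
rewrite regularised_open; last exact: open0.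
apply/eqP; rewrite eq_le inner_ge0 andbT.
by apply: ge_ereal_sup => _ [K [_ K0] <-]; rewrite (_ : K = set0) ?la_set0// -subset0.
Qed.

Let reg_subadd A (F : nat -> set T) : A `<=` \bigcup_n F n ->
  regularised A <= \sum_(n <oo) regularised (F n).
Proof.
move=> AF; apply/lee_addgt0Pr => e e0.
apply: le_trans (epsilon_trick _ _ (ltW e0)) => //.
have /choice[G hG] n : exists G, [/\ open G, F n `<=` G &
    inner_open G <= regularised (F n) + (e / (2 ^ n.+1)%:R)%:E].
  have [|_ [G [oG FG] <-] h] := @lb_ereal_inf_adherent _
      [set inner_open G | G in [set G | open G /\ F n `<=` G]] (e / (2 ^ n.+1)%:R)%R _ (reg_fin (F n)).
    by rewrite divr_gt0// ltr0n expn_gt0.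
  by exists G; split => //; exact: ltW.
apply: (@le_trans _ _ (inner_open (\bigcup_n G n))).
  apply: reg_le_open; first by apply: bigcup_open => n _; case: (hG n).
  by move=> x /AF[n _ Fx]; exists n => //; have [_ + _] := hG n; exact.
apply: le_trans (inner_bigcup _) _; first by move=> n; case: (hG n).
by apply: lee_nneseries => // n _; case: (hG n).
Qed.

HB.instance Definition _ := isSubsetOuterMeasure.Build R T regularised
  reg0 reg_ge0 reg_subadd.

(** Removing a compact [K] from the open [G'] leaves an open set, so superadditivity on disjoint
    compacts splits the inner content of [G'] between [K] and what covers [X] outside [G]. *)
Lemma regularised_caratheodory (G : set T) : open G ->
  regularised.-caratheodory G.
Proof.
move=> oG; apply: le_caratheodory_measurable => X.
apply: le_ereal_inf_tmp => _ [G' [oG' XG'] <-].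
have oGG : open (G' `&` G) by exact: openI.
have h K : compact K -> K `<=` G' `&` G ->
    la K + regularised (X `&` ~` G) <= inner_open G'.
  move=> cK KG.
  have cloK : closed K := compact_closed (metrizes_hausdorff dm) cK.
  have oGK : open (G' `&` ~` K) by apply: openI => //; exact: closed_openC.
  have le1 : regularised (X `&` ~` G) <= inner_open (G' `&` ~` K).
    apply: reg_le_open => // x [Xx nGx]; split; first exact: XG'.
    by move=> /KG[_ /nGx].
  have lafin : la K \is a fin_num.
    by rewrite ge0_fin_numE ?la0//; apply: le_lt_trans (laM cK) (ltry _).
  apply: le_trans (leeD2l _ le1) _; rewrite addeC -leeBrDr//.
  apply: ge_ereal_sup => _ [K' [cK' K'G] <-]; rewrite leeBrDr// addeC.
  apply: le_trans (laD cK cK' _) _.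
    by rewrite -subset0 => x [Kx /K'G[_ /(_ Kx)]].
  apply: inner_ge; first exact: compactU.
  by move=> x [/KG[]//|/K'G[]].
apply: (@le_trans _ _ (inner_open (G' `&` G) + regularised (X `&` ~` G))).
  by rewrite leeD2r//; apply: reg_le_open => // x [Xx Gx]; split => //; exact: XG'.
rewrite -leeBrDr//; apply: ge_ereal_sup => _ [K [cK KG] <-].
by rewrite leeBrDr//; exact: h.
Qed.

Lemma borel_sub_caratheodory (A : set T) : measurable (A : set (borel T)) ->
  regularised.-caratheodory A.
Proof.
apply: smallest_sub; last exact: regularised_caratheodory.
split.
- exact: caratheodory_measurable_set0.
- by move=> B mB; rewrite setTD; exact: caratheodory_measurable_setC.
- by move=> F mF; exact: caratheodory_measurable_bigcup.
Qed.

Lemma ex_regular_measure : exists sg : {finite_measure set (borel T) -> \bar R},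
  forall G, open G -> sg G = inner_open G.
Proof.
have radd : semi_sigma_additive (regularised : set (borel T) -> \bar R).
  move=> F mF tF mUF; apply: (@caratheodory_measure_sigma_additive _ _ regularised) => //.
  - by move=> n; exact: borel_sub_caratheodory.
  - exact: borel_sub_caratheodory.
have [|sg sgE] := @ex_measure_of_function _ (borel T) R regularised reg0 reg_ge0 radd.
  exact: le_lt_trans (reg_leM _) (ltry _).
by exists sg => G oG; rewrite sgE regularised_open.
Qed.

End regularisation.

(** * Borel sets and tightness on products of Polish spaces *)

Lemma polish_dense_seq (R : realType) (T : ptopologicalType) (d : T -> T -> R)
    (D : set T) : metrizes d -> countable D -> dense D ->
  exists y : nat -> T, forall (z : T) (e : R), (0 < e)%R ->
    exists n, (d (y n) z <= e)%R.
Proof.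
move=> dm /countable_injP[f finj] dD; have [[_ dE _ _] _] := dm.
exists (fun n => xget point [set x | D x /\ f x = n]) => z e e0.
have [|x [/= zx Dx]] := dD [set x | (d z x < e)%R] _ (metric_ball_open dm z e).
  by exists z => /=; rewrite (dE z z).2.
exists (f x); case: xgetP => [x' _ [Dx' fx']|/(_ x)[]//].
have -> : x' = x by apply: finj; rewrite ?inE.
by have [[_ _ -> _] _] := dm; exact: ltW.
Qed.

(** Equips the topological product with a base point, as [borel] asks for a pointed type. *)
HB.instance Definition _ (X Y : ptopologicalType) := Pointed.on (X * Y)%type.

(** Plans live on the product of the Borel sigma-algebras, whereas [E] is closed for the product
    topology. Separability reconciles the two: an open set is the union of those among countably
    many boxes of dyadic balls around dense points that it contains. *)
Lemma prod_open_measurable (R : realType) (X Y : ptopologicalType) (d : X -> X -> R)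
    (d' : Y -> Y -> R) (x : nat -> X) (y : nat -> Y) (G : set (X * Y)) :
  metrizes d -> metrizes d' ->
  (forall (z : X) (e : R), (0 < e)%R -> exists n, (d (x n) z <= e)%R) ->
  (forall (z : Y) (e : R), (0 < e)%R -> exists n, (d' (y n) z <= e)%R) ->
  open G -> measurable (G : set (borel X * borel Y)).
Proof.
move=> dm dm' xd yd oG.
pose Bx k n : set X := [set z | (d (x n) z <= 2^-1 ^+ k)%R].
pose By k n : set Y := [set z | (d' (y n) z <= 2^-1 ^+ k)%R].
pose A (u : nat * nat * nat) := if `[< Bx u.1.1 u.1.2 `*` By u.1.1 u.2 `<=` G >]
  then Bx u.1.1 u.1.2 `*` By u.1.1 u.2 else set0.
have -> : G = \bigcup_u A u.
  apply/seteqP; split => [[z w] Gzw|z [u _]]; last by rewrite /A; case: asboolP => // h; exact: h.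
  have [e e0 eG] := metric_open_ball (metrizes_prod dm dm') oG Gzw.
  have [|k hk] := @half_pow_lt R (e / 2); first by rewrite divr_gt0.
  have k0 : (0 < 2^-1 ^+ k :> R)%R by rewrite exprn_gt0// invr_gt0.
  have [i hi] := xd z _ k0; have [j hj] := yd w _ k0.
  exists ((k, i), j) => //; rewrite /A; case: asboolP => // h; exfalso; apply: h.
  have [[_ _ dC dT] _] := dm; have [[_ _ dC' dT'] _] := dm'.
  move=> [z' w'] [/= hz hw]; apply: eG; rewrite /= gt_max; apply/andP; split.
    apply: le_lt_trans (dT _ (x i) _) _; rewrite dC.
    apply: le_lt_trans (lerD hi hz) _; move: hk; set a := (_ ^+ k)%R; lra.
  apply: le_lt_trans (dT' _ (y j) _) _; rewrite dC'.
  apply: le_lt_trans (lerD hj hw) _; move: hk; set a := (_ ^+ k)%R; lra.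
apply: countable_bigcupT_measurable => [|u]; first exact: countableP.
rewrite /A; case: asboolP => // _; apply: measurableX.
  by apply: borel_closed_measurable; exact: metric_cball_closed.
by apply: borel_closed_measurable; exact: metric_cball_closed.
Qed.

(** The opposite inclusion, used to transfer a measure built on the Borel sets of the product. *)
Lemma prod_measurable_borel (X Y : ptopologicalType)
    (T := (X * Y)%type : ptopologicalType) :
  measurable_fun [set: borel T] (id : borel T -> borel X * borel Y).
Proof.
have mf : measurable_fun [set: borel T] (fst : borel T -> borel X).
  apply: (@measurability _ _ (borel T) (borel X) setT fst (@open X)) => // _ [A oA <-].
  have h : open ((fst : T -> X) @^-1` A).
    by apply: open_comp => // z _; exact: cvg_fst.
  by rewrite setTI; exact: (@borel_open_measurable T _ h).
have ms : measurable_fun [set: borel T] (snd : borel T -> borel Y).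
  apply: (@measurability _ _ (borel T) (borel Y) setT snd (@open Y)) => // _ [A oA <-].
  have h : open ((snd : T -> Y) @^-1` A).
    by apply: open_comp => // z _; exact: cvg_snd.
  by rewrite setTI; exact: (@borel_open_measurable T _ h).
have := measurable_fun_pair mf ms.
by rewrite (_ : (fun _ => _) = id)//; apply/funext => -[].
Qed.

Definition complete_separable (R : realType) (T : ptopologicalType)
    (d : T -> T -> R) (y : nat -> T) : Prop :=
  [/\ metrizes d,
      forall u : nat -> T,
        (forall e : R, (0 < e)%R -> exists N : nat, forall m n : nat,
          (N <= m)%N -> (N <= n)%N -> (d (u m) (u n) < e)%R) ->
        exists l : T, u @ \oo --> l &
      forall (z : T) (e : R), (0 < e)%R -> exists n, (d (y n) z <= e)%R].

Lemma polish_complete_separable (R : realType) (T : ptopologicalType) :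
  polish R T -> exists (d : T -> T -> R) y, complete_separable d y.
Proof.
case=> d [dm dN dc [D cD dD]]; have md : metrizes d by split.
have [y yd] := polish_dense_seq md cD dD.
by exists d, y.
Qed.

(** This is [ex_compact_reaching] for the diagonal, where projecting the part over [K] returns [K]
    itself. *)
Lemma ulam_tight (R : realType) (T : ptopologicalType) (d : T -> T -> R)
    (y : nat -> T) (m : {finite_measure set (borel T) -> \bar R}) (e : R) :
  complete_separable d y -> (0 < e)%R ->
  exists K : set T, [/\ compact K, closed K & m (~` K) <= e%:E].
Proof.
move=> [dm dc yd] e0; have [[_ dE dC dT] _] := dm.
pose D := [set z : (T * T)%type | z.1 = z.2].
have cD : closed D.
  move=> z cz; apply/dE/eqP; rewrite eq_le; apply/andP; split; last by case: dm => -[].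
  apply/ler_addgt0Pr => e' e'0; rewrite add0r.
  have [|w Dw] := metric_closureP (metrizes_prod dm dm) cz (e := (e' / 2)%R).
    by rewrite divr_gt0.
  rewrite gt_max => /andP[z1 z2]; apply: le_trans (dT _ w.1 _) _.
  by rewrite (splitr e') lerD ?(ltW z1)// dC Dw ltW.
have [|K [kK cK mK]] := ex_compact_reaching dm dm dc yd cD _ m e0.
  by move=> x; exists x.
exists K; split => //; rewrite (_ : K = reaching D K)//.
apply/seteqP; split => [x Kx|x [z Kz]]; first by exists x.
by rewrite /D /= => ->.
Qed.

Section measure_below.
Context (R : realType) (X Y : ptopologicalType) (d : X -> X -> R) (x : nat -> X)
  (d' : Y -> Y -> R) (y : nat -> Y).
Hypotheses (dX : complete_separable d x) (dY : complete_separable d' y).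
Local Notation Z := (borel X * borel Y)%type.
Let T := (X * Y)%type : ptopologicalType.
Variables (la : set Z -> \bar R) (a : {finite_measure set (borel X) -> \bar R})
  (b : {finite_measure set (borel Y) -> \bar R}).
Hypotheses (la0 : la set0 = 0) (la_ge0 : forall A, measurable A -> 0 <= la A)
  (laU : forall A B, measurable A -> measurable B -> A `&` B = set0 ->
    la (A `|` B) = la A + la B)
  (laa : forall A, measurable A -> la (fst @^-1` A) <= a A)
  (lab : forall B, measurable B -> la (snd @^-1` B) <= b B).

Lemma open_prod_measurable (G : set T) : open G -> measurable (G : set Z).
Proof.
by have [dm _ xd] := dX; have [dm' _ yd] := dY; exact: prod_open_measurable dm dm' xd yd.
Qed.

Let dmT : metrizes (fun z w : T => Num.max (d z.1 w.1) (d' z.2 w.2)).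
Proof. by have [dm _ _] := dX; have [dm' _ _] := dY; exact: metrizes_prod. Qed.

Let compact_measurable (K : set T) : compact K -> measurable (K : set Z).
Proof.
move=> cK; have cloK : closed K := compact_closed (metrizes_hausdorff dmT) cK.
rewrite -(setCK K); apply: measurableC; apply: open_prod_measurable.
by rewrite openC.
Qed.

Let la_le (A B : set Z) : measurable A -> measurable B -> A `<=` B -> la A <= la B.
Proof.
move=> mA mB AB; rewrite -(setDUK AB) laU//; last 2 first.
- exact: measurableD.
- by rewrite setDE setICA setICr setI0.
by rewrite leeDl// la_ge0//; exact: measurableD.
Qed.

Let la_subU (A B : set Z) : measurable A -> measurable B ->
  la (A `|` B) <= la A + la B.
Proof.
move=> mA mB; have mBA : measurable (B `\` A) by exact: measurableD.
have -> : A `|` B = A `|` (B `\` A).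
  apply/seteqP; split => z; last by move=> [|[]]; [left|right].
  by have [Az|nAz] := pselect (A z); [left|move=> [|Bz] //; right].
rewrite laU//; last by rewrite setDE setICA setICr setI0.
by rewrite leeD2l//; apply: la_le => // z [].
Qed.

Let laT_lty : la setT < +oo.
Proof.
apply: le_lt_trans (laa measurableT) _; exact: finite_measure_lty.
Qed.

Let laT_fin : la setT \is a fin_num.
Proof. by rewrite ge0_fin_numE// la_ge0. Qed.

(** On open sets the regularised content is a supremum over compact subsets and so stays below [la].
    No total mass is lost, because the marginals lie below the tight measures [a] and [b]: up to
    [e], [la] lives on a compact box [K * L]. *)
Lemma ex_measure_below : exists sg : {finite_measure set Z -> \bar R},
  (forall G : set T, open G -> sg G <= la G) /\ sg setT = la setT.
Proof.
have [||||||sg0 sg0E] := @ex_regular_measure R T _ dmT la (fine (la setT)).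
- by move=> K cK; apply: la_ge0; exact: compact_measurable.
- exact: la0.
- by move=> K cK; rewrite fineK//; apply: la_le => //; exact: compact_measurable.
- by move=> K K' cK cK' KK'; apply: la_le => //; exact: compact_measurable.
- by move=> K K' cK cK'; apply: la_subU; exact: compact_measurable.
- by move=> K K' cK cK' KK'; rewrite laU//; exact: compact_measurable.
have [sg sgE] := ex_pushforward sg0 (@prod_measurable_borel X Y).
have sgO (G : set T) : open G -> sg G <= la G.
  move=> oG; rewrite sgE sg0E//; apply: ge_ereal_sup => _ [K [cK KG] <-].
  by apply: la_le => //; [exact: compact_measurable|exact: open_prod_measurable].
exists sg; split => //; apply/eqP; rewrite eq_le sgO ?openT//=; last exact: openT.
apply/lee_addgt0Pr => e e0; have e20 : (0 < e / 2)%R by rewrite divr_gt0.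
have [K [cK clK aK]] := ulam_tight a dX e20.
have [L [cL clL bL]] := ulam_tight b dY e20.
have cKL : compact (K `*` L : set T) by exact: compact_setX.
have mK : measurable (~` K : set (borel X)).
  by apply: measurableC; exact: borel_closed_measurable.
have mL : measurable (~` L : set (borel Y)).
  by apply: measurableC; exact: borel_closed_measurable.
have mKL := compact_measurable cKL.
have mfK : measurable (fst @^-1` (~` K) : set Z).
  by rewrite -[X in measurable X]setTI; exact: measurable_fst.
have msL : measurable (snd @^-1` (~` L) : set Z).
  by rewrite -[X in measurable X]setTI; exact: measurable_snd.
apply: (@le_trans _ _ (la (K `*` L) + (e / 2)%:E + (e / 2)%:E)); last first.
  rewrite -addeA -EFinD -splitr leeD2r// sgE preimage_setT sg0E; last exact: openT.
  by apply: ereal_sup_ubound; exists (K `*` L).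
apply: (@le_trans _ _ (la ((K `*` L `|` fst @^-1` (~` K)) `|` snd @^-1` (~` L)))).
  apply: la_le => //; first by apply: measurableU => //; exact: measurableU.
  move=> [u v] _ /=; have [Ku|nKu] := pselect (K u); last by left; right.
  by have [Lv|nLv] := pselect (L v); [left; left|right].
apply: le_trans (la_subU _ msL) _; first exact: measurableU.
apply: leeD; last exact: le_trans (lab mL) bL.
apply: le_trans (la_subU mKL mfK) _.
by rewrite leeD2l//; exact: le_trans (laa mK) aK.
Qed.

End measure_below.

(** * Minimising sequences *)

Lemma bounded_variation_cvg (R : realType) (u : nat -> R) :
  \sum_(k <oo) `|u k - u k.+1|%:E < +oo -> cvgn u.
Proof.
set S := \sum_(k <oo) _ => Sfin.
have S0 : 0 <= S by apply: nneseries_ge0 => k _ _; rewrite lee_fin.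
have Sfn : S \is a fin_num by rewrite ge0_fin_numE.
have cs : cvgn (series (telescope u)).
  apply: normed_cvg; set s := (X in cvgn X).
  have sE n : s n = (\sum_(0 <= k < n) `|telescope u k|)%R by rewrite /s /normed_series_of/= /series/=.
  apply: nondecreasing_is_cvgn.
    by apply/nondecreasing_seqP => n; rewrite !sE big_nat_recr//= lerDl.
  exists (fine S) => _ [n _ <-]; rewrite sE -lee_fin fineK// -sumEFin.
  apply: le_trans (nneseries_lim_ge n _) => //.
  rewrite le_eqVlt; apply/orP; left; apply/eqP; apply: eq_bigr => k _.
  by rewrite /telescope distrC.
have -> : u = (fun n => u 0%N + series (telescope u) n)%R.
  by apply/funext => n; exact: eq_sum_telescope.
by apply: is_cvgD => //; exact: is_cvg_cst.
Qed.

Section pointwise_limits.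
Context d (T : measurableType d) (R : realType)
  (m : {finite_measure set T -> \bar R}).

(** The sum of the absolute increments is integrable, so almost everywhere the sequence has bounded
    variation. *)
Lemma fast_L1_cauchy_ae_cvg (f : nat -> T -> R) (c : R) :
  (forall n, measurable_fun setT (f n)) ->
  (forall n, \int[m]_x `|f n x - f n.+1 x|%:E <= (c / (2 ^ n.+1)%:R)%:E) ->
  {ae m, forall x, cvgn (f ^~ x)}.
Proof.
move=> mf fc; have mdf n : measurable_fun setT (fun x => `|f n x - f n.+1 x|%R).
  by apply: measurableT_comp => //; exact: measurable_funB.
have c0 : (0 <= c)%R.
  have : 0 <= \int[m]_x `|f 0%N x - f 1%N x|%:E by exact: int_ge0.
  by move=> /le_trans/(_ (fc 0%N)); rewrite lee_fin pmulr_lge0.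
pose S x := \sum_(k <oo) `|f k x - f k.+1 x|%:E.
have S0 x : 0 <= S x by apply: nneseries_ge0 => k _ _; rewrite lee_fin.
have iS : m.-integrable setT S.
  apply/integrableP; split.
    by apply: ge0_emeasurable_sum => k *; [rewrite lee_fin|exact/measurable_EFinP].
  under eq_integral do rewrite gee0_abs//.
  rewrite integral_nneseries//.
  - apply: (@le_lt_trans _ _ c%:E); last by rewrite ltry.
    apply: le_trans (epsilon_trick0 xpredT c0).
    apply: lee_nneseries => k *; [|exact: fc].
    by apply: integral_ge0 => x _; rewrite lee_fin.
  - by move=> n; exact/measurable_EFinP.
have [N [mN N0 hN]] := integrable_ae measurableT iS.
exists N; split => // x /= hx; apply: hN => /= h; apply: hx.
by apply: bounded_variation_cvg; rewrite -ge0_fin_numE//; [exact: h|exact: S0].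
Qed.

Lemma fatou_bound (f : nat -> T -> R) (c : \bar R) D : measurable D ->
  (forall n, measurable_fun setT (f n)) -> (forall n x, (0 <= f n x)%R) ->
  (forall n, \int[m]_(x in D) (f n x)%:E <= c) ->
  \int[m]_(x in D) limn_einf (fun n => (f n x)%:E) <= c.
Proof.
move=> mD mf f0 fc.
apply: le_trans (@fatou _ _ _ m D mD (fun n x => (f n x)%:E) _ _) _.
- by move=> n; exact/measurable_funTS/measurable_EFinP.
- by move=> n x _; rewrite lee_fin.
rewrite limn_einf_lim; apply: lime_le; first exact: is_cvg_einfs.
apply: nearW => n; apply: le_trans (fc n); apply: ereal_inf_lbound.
by exists n => /=.
Qed.

Lemma ge0_limit_integral_le (f : nat -> T -> R) (g : T -> R) (c : \bar R) D :
  measurable D ->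
  (forall n, measurable_fun setT (f n)) -> (forall n x, (0 <= f n x)%R) ->
  (forall x, f ^~ x @ \oo --> g x) ->
  (forall n, \int[m]_(x in D) (f n x)%:E <= c) -> \int[m]_(x in D) (g x)%:E <= c.
Proof.
move=> mD mf f0 fg fc; apply: le_trans (fatou_bound mD mf f0 fc).
rewrite le_eqVlt; apply/orP; left; apply/eqP; apply: eq_integral => x _.
by apply/esym; apply: (cvg_limn_einf_sup _).1; apply/fine_cvgP; split; [exact: nearW|exact: fg].
Qed.

(** By Fatou the lower limit is integrable, hence finite almost everywhere. *)
Lemma bounded_integrals_ae_not_cvg_pinfty (f : nat -> T -> R) (c : \bar R) :
  (forall n, measurable_fun setT (f n)) -> (forall n x, (0 <= f n x)%R) ->
  c < +oo -> (forall n, \int[m]_x (f n x)%:E <= c) ->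
  {ae m, forall x, ~ ((f n x)%:E @[n --> \oo] --> +oo)}.
Proof.
move=> mf f0 coo fc; pose g x := limn_einf (fun n => (f n x)%:E).
have g0 x : 0 <= g x.
  rewrite /g limn_einf_lim; apply: lime_ge; first exact: is_cvg_einfs.
  by apply: nearW => n; apply: le_ereal_inf_tmp => _ [k _ <-]; rewrite lee_fin.
have ig : m.-integrable setT g.
  apply/integrableP; split.
    rewrite /g /limn_einf; apply: measurableT_comp => //.
    by apply: measurable_fun_limn_esup => n; apply: measurableT_comp => //; exact/measurable_EFinP.
  under eq_integral do rewrite gee0_abs//.
  exact: le_lt_trans (fatou_bound measurableT mf f0 fc) coo.
have [N [mN N0 hN]] := integrable_ae measurableT ig.
exists N; split => // x /= /contrapT hx; apply: hN => /= /(_ Logic.I).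
by rewrite /g (cvg_limn_einf_sup hx).1.
Qed.

End pointwise_limits.

(** * The integrand [1 / (1 + x)] *)

Lemma measurable_inv_add1 d (T : measurableType d) (R : realType) (f : T -> R) :
  measurable_fun setT f -> (forall x, (0 <= f x)%R) ->
  measurable_fun setT (fun x => (1 + f x)^-1)%R.
Proof.
(* The absolute value changes nothing for a nonnegative [f] and makes the map continuous on all of
   [R]. *)
move=> mf f0; rewrite (_ : (fun x => _) = (fun t : R => (1 + `|t|)^-1)%R \o f); last first.
  by apply/funext => x /=; rewrite ger0_norm.
apply: measurableT_comp => //; apply: continuous_measurable_fun => t.
apply: cvgV; first by rewrite gt_eqF// ltr_pwDl.
by apply: cvgD; [exact: cvg_cst|exact: norm_continuous].
Qed.

Lemma inv_add1_itv (R : realType) (x : R) : (0 <= x)%R -> (0 <= (1 + x)^-1 <= 1)%R.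
Proof.
move=> x0; rewrite invr_ge0 addr_ge0//= invf_le1 ?ltr_pwDl//.
by rewrite lerDl.
Qed.

Lemma inv_add1_strictly_convex (R : realType) (a b w : R) :
  (0 <= a)%R -> (0 <= b)%R -> a != b -> (0 < w < 1)%R ->
  ((1 + (w * a + (1 - w) * b))^-1 < w * (1 + a)^-1 + (1 - w) * (1 + b)^-1)%R.
Proof.
move=> a0 b0 ab /andP[w0 w1].
have a1 : (0 < 1 + a)%R by lra.
have b1 : (0 < 1 + b)%R by lra.
have c1 : (0 < 1 + (w * a + (1 - w) * b))%R by nra.
rewrite -subr_gt0.
have -> : (w * (1 + a)^-1 + (1 - w) * (1 + b)^-1 - (1 + (w * a + (1 - w) * b))^-1
  = w * (1 - w) * (a - b) ^+ 2 /
    ((1 + a) * (1 + b) * (1 + (w * a + (1 - w) * b))))%R.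
  by field; rewrite !gt_eqF.
apply: divr_gt0; last by rewrite !mulr_gt0.
rewrite mulr_gt0//; first by rewrite mulr_gt0// subr_gt0.
by rewrite lt_neqAle sqr_ge0 eq_sym sqrf_eq0 subr_eq0 ab.
Qed.

(* Uniform convexity of [1 / (1 + x)], with the square removed by AM-GM. *)
Lemma inv_add1_midpoint_gap (R : realType) (a b w : R) :
  (0 <= a)%R -> (0 <= b)%R -> (0 < w)%R ->
  (`|(1 + a)^-1 - (1 + b)^-1| + w * (1 + (a + b) / 2)^-1 <=
   w^-1 + w / 2 * (1 + a)^-1 + w / 2 * (1 + b)^-1)%R.
Proof.
move=> a0 b0 w0.
set f := ((1 + a)^-1)%R; set g := ((1 + b)^-1)%R; set m := ((1 + _ / 2)^-1)%R.
have a1 : (0 < 1 + a)%R by lra.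
have b1 : (0 < 1 + b)%R by lra.
(* After clearing denominators this reduces to [2 (1 + a) (1 + b) >= (1 + a) + (1 + b)], true since
   [a] and [b] are nonnegative. *)
have gap : (m + (f - g) ^+ 2 / 4 <= (f + g) / 2)%R.
  rewrite -subr_ge0.
  have -> : ((f + g) / 2 - (m + (f - g) ^+ 2 / 4) = (a - b) ^+ 2
     * (2 * ((1 + a) * (1 + b)) - (1 + a + (1 + b))) /
       (4 * (1 + a + (1 + b)) * ((1 + a) * (1 + b)) ^+ 2))%R.
    by rewrite /f /g /m; field; rewrite !gt_eqF//; lra.
  apply: divr_ge0; first by rewrite mulr_ge0 ?sqr_ge0//; nra.
  by rewrite mulr_ge0 ?sqr_ge0//; lra.
have amgm : (`|f - g| <= w^-1 + w * ((f - g) ^+ 2 / 4))%R.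
  rewrite -(real_normK (num_real (f - g))); set s := `|_|%R.
  rewrite -subr_ge0.
  have -> : (w^-1 + w * (s ^+ 2 / 4) - s = (w * s / 2 - 1) ^+ 2 / w)%R.
    by field; rewrite gt_eqF.
  by rewrite divr_ge0 ?sqr_ge0// ltW.
have := ler_wpM2l (ltW w0) gap; lra.
Qed.

(** Inverting recovers [u] unless the limit of [1 / (1 + u n)] is 0, and a limit 0 would send [u] to
    [+oo]. *)
Lemma cvg_of_inv_add1 (R : realType) (u : nat -> R) : (forall n, (0 <= u n)%R) ->
  cvgn (fun n => (1 + u n)^-1)%R -> ~ ((u n)%:E @[n --> \oo] --> +oo) ->
  cvgn u.
Proof.
move=> u0 cf noo.
have f0 n : (0 < (1 + u n)^-1)%R by rewrite invr_gt0 ltr_pwDl.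
set l := lim ((1 + u n)^-1 @[n --> \oo])%R in cf *.
have {}cf : ((1 + u n)^-1 @[n --> \oo] --> l)%R by [].
have uE : u = (fun n => ((1 + u n)^-1)^-1 - 1)%R.
  by apply/funext => n; rewrite invrK addrC addKr.
have [l0|l0] := eqVneq l 0%R; last first.
  by rewrite uE; apply/cvg_ex; exists (l^-1 - 1)%R; apply: cvgB; [exact: cvgV|exact: cvg_cst].
exfalso; apply: noo; apply/cvgeryP; rewrite l0 in cf.
have /cvgryPge h : ((1 + u n)^-1)^-1%R @[n --> \oo] --> +oo%R.
  by apply/cvgrVy => //; exact: nearW.
apply/cvgryPge => A; apply: filterS (h (A + 1)%R) => n /=.
by rewrite invrK addrC lerD2l.
Qed.

(** * Relaxed plans and their minimising sequences *)

Section carried_densities.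
Context dz dx dy (Z : measurableType dz) (X : measurableType dx)
  (Y : measurableType dy) (R : realType).
Variables (p : Z -> X) (q : Z -> Y) (E : set Z).
Hypotheses (mp : measurable_fun setT p) (mq : measurable_fun setT q)
  (mE : measurable E).
Variables (mu : {finite_measure set X -> \bar R})
  (nu : {finite_measure set Y -> \bar R}).
Implicit Types (sigma : {finite_measure set Z -> \bar R}) (rho : Y -> R).

Let mqi A : measurable A -> measurable (q @^-1` A).
Proof. by move=> mA; rewrite -[X in measurable X]setTI; exact: mq. Qed.
Let mpi A : measurable A -> measurable (p @^-1` A).
Proof. by move=> mA; rewrite -[X in measurable X]setTI; exact: mp. Qed.

(** The competitors of the relaxed problem: the first marginal may fall short of [mu], which makes
    the class convex and stable under discarding singular mass. *)
Definition carries sigma rho := [/\ sigma (~` E) = 0,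
  forall A, measurable A -> sigma (p @^-1` A) <= mu A,
  measurable_fun setT rho, forall y, (0 <= rho y)%R &
  forall B, measurable B -> sigma (q @^-1` B) = \int[nu]_(y in B) (rho y)%:E].

Definition inv_add1_cost rho := \int[nu]_y ((1 + rho y)^-1)%:E.

Lemma carries_midpoint s1 r1 s2 r2 : carries s1 r1 -> carries s2 r2 ->
  exists s, carries s (fun y => (r1 y + r2 y) / 2)%R.
Proof.
move=> [s1E s1p m1 r10 s1q] [s2E s2p m2 r20 s2q].
have h0 : (0 <= 2^-1 :> R)%R by [].
have fin : 2^-1%:E * measure_add s1 s2 setT < +oo.
  by rewrite measure_addE lte_mul_pinfty// lte_add_pinfty// finite_measure_lty.
have [s sE] := @measure_finite_of _ _ _ (mscale (NngNum h0) (measure_add s1 s2)) fin.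
have {}sE A : s A = 2^-1%:E * (s1 A + s2 A).
  by rewrite sE /mscale/= -measure_addE.
exists s; split.
- by rewrite sE s1E s2E adde0 mule0.
- move=> A mA; rewrite sE.
  apply: (@le_trans _ _ (2^-1%:E * (mu A + mu A))).
    by rewrite lee_pmul2l// leeD ?s1p ?s2p.
  have [r ->] : exists r, mu A = r%:E.
    by exists (fine (mu A)); rewrite fineK// fin_num_measure.
  by rewrite -EFinD -EFinM lee_fin; lra.
- by apply: measurable_funM => //; exact: measurable_funD.
- by move=> y; rewrite divr_ge0// addr_ge0.
- move=> B mB; rewrite sE s1q// s2q//.
  rewrite -int_add// -int_scale//; last 2 first.
  + exact: measurable_funD.
  + by move=> y; rewrite addr_ge0.
  by apply: eq_integral => y _; rewrite mulrC.
Qed.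

Lemma carries_integral_le sigma rho : carries sigma rho ->
  \int[nu]_y (rho y)%:E <= mu setT.
Proof. by move=> [_ sp _ _ sq]; rewrite -sq// preimage_setT -(@preimage_setT _ _ p) sp. Qed.

Lemma carries_ae sigma rho rho' N : carries sigma rho -> measurable N ->
  nu N = 0 -> measurable_fun setT rho' -> (forall y, (0 <= rho' y)%R) ->
  (forall y, ~ N y -> rho' y = rho y) -> carries sigma rho'.
Proof.
move=> [sE sp mr r0 sq] mN N0 mr' r0' h; split => // B mB.
rewrite sq//; apply: ae_eq_integral => //.
- exact/measurable_funTS/measurable_EFinP.
- exact/measurable_funTS/measurable_EFinP.
- by exists N; split => // y /= hy; apply: contrapT => /h e; apply: hy; rewrite e.
Qed.

Lemma inv_add1_cost_ge0 rho : (forall y, (0 <= rho y)%R) -> 0 <= inv_add1_cost rho.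
Proof.
by move=> r0; apply: int_ge0 => y; case/andP: (inv_add1_itv (r0 y)).
Qed.

Lemma inv_add1_cost_lty rho : measurable_fun setT rho -> (forall y, (0 <= rho y)%R) ->
  inv_add1_cost rho < +oo.
Proof.
move=> mr r0; apply: int_bounded_lty (fun y => inv_add1_itv (r0 y)).
exact: measurable_inv_add1.
Qed.

(** Integrate [inv_add1_midpoint_gap]. The midpoint is again a competitor, so its cost is at least
    [I]; the tolerance [w ^- 2] multiplied by [w] leaves an error [w^-1], of the same size as the
    one from AM-GM. *)
Lemma inv_add1_cost_gap (I w : R) s1 r1 s2 r2 :
  (forall sigma rho, carries sigma rho -> I%:E <= inv_add1_cost rho) ->
  carries s1 r1 -> carries s2 r2 -> (0 < w)%R ->
  inv_add1_cost r1 <= (I + w ^- 2)%:E -> inv_add1_cost r2 <= (I + w ^- 2)%:E ->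
  \int[nu]_y `|(1 + r1 y)^-1 - (1 + r2 y)^-1|%:E
   <= ((fine (nu setT) + 1) / w)%:E.
Proof.
move=> Imin c1 c2 w0 F1 F2.
have [s cs] := carries_midpoint c1 c2; have Fm := Imin _ _ cs.
have [_ _ m1 r10 _] := c1; have [_ _ m2 r20 _] := c2; have [_ _ mm rm0 _] := cs.
have n0 := fin_num_measure nu _ (@measurableT _ Y).
set J := (X in X <= _).
have J0 : 0 <= J by exact: int_ge0.
have ge0 (r : Y -> R) (r0 : forall y, (0 <= r y)%R) y : (0 <= (1 + r y)^-1 :> R)%R.
  by case/andP: (inv_add1_itv (r0 y)).
have mi1 := measurable_inv_add1 m1 r10.
have mi2 := measurable_inv_add1 m2 r20.
have mim := measurable_inv_add1 mm rm0.
have key : J + w%:E * inv_add1_cost (fun y => (r1 y + r2 y) / 2)%R <=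
    w^-1%:E * nu setT + (w / 2)%:E * inv_add1_cost r1 + (w / 2)%:E * inv_add1_cost r2.
  have w20 : (0 <= w / 2)%R by lra.
  have w0' := ltW w0.
  have wm (f : Y -> R) (k : R) : (0 <= k)%R -> measurable_fun setT f -> (forall y : Y, (0 <= f y)%R) ->
      measurable_fun setT (fun y => k * f y)%R /\ forall y, (0 <= k * f y)%R.
    by move=> k0 mf f0; split => [|y]; [exact: measurable_funM|exact: mulr_ge0].
  have [] := wm _ _ (ltW w0) mim (ge0 _ rm0).
  have [] := wm _ _ w20 mi1 (ge0 _ r10).
  have [] := wm _ _ w20 mi2 (ge0 _ r20) => m3 z3 m4 z4 m5 z5.
  rewrite /J /inv_add1_cost -integral_cst// -!int_scale//; try exact: ge0.
  have mJ : measurable_fun setT (fun y => `|(1 + r1 y)^-1 - (1 + r2 y)^-1|)%R.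
    by apply: measurableT_comp => //; exact: measurable_funB.
  have wi0 : (0 <= w^-1)%R by rewrite invr_ge0 ltW.
  rewrite -!int_add//; last 2 first.
  + exact: measurable_funD.
  + by move=> y; rewrite addr_ge0.
  apply: le_int => //.
  + exact: measurable_funD.
  + by apply: measurable_funD => //; exact: measurable_funD.
  + by move=> y; rewrite addr_ge0.
  + by move=> y _; exact: inv_add1_midpoint_gap.
have real (r : Y -> R) : measurable_fun setT r -> (forall y : Y, (0 <= r y)%R) ->
    exists a, inv_add1_cost r = a%:E.
  move=> mr r0; exists (fine (inv_add1_cost r)); rewrite fineK// ge0_fin_numE.
    exact: inv_add1_cost_lty.
  exact: inv_add1_cost_ge0.
have [a aE] := real _ m1 r10; have [b bE] := real _ m2 r20.
have [m mE'] := real _ mm rm0.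
move: key F1 F2 Fm; rewrite aE bE mE' -[nu setT]fineK//.
rewrite -!EFinM -!EFinD !lee_fin.
set n := fine _.
case: J J0 => [j| |]//= _; rewrite -?EFinD ?lee_fin// => key F1 F2 Fm.
have e : (w * (I + w ^- 2) = w * I + w^-1)%R by field; rewrite gt_eqF.
have := ler_wpM2l (ltW w0) F1; have := ler_wpM2l (ltW w0) F2.
have := ler_wpM2l (ltW w0) Fm; rewrite e mulrDl mul1r; lra.
Qed.

Lemma ex_minimizing_sequence :
  exists (sig : nat -> {finite_measure set Z -> \bar R}) (rho : nat -> Y -> R) (r : Y -> R),
  [/\ forall n, carries (sig n) (rho n), measurable_fun setT r,
      forall y, (0 <= r y)%R, forall y, rho ^~ y @ \oo --> r y &
      forall sigma rho', carries sigma rho' -> inv_add1_cost r <= inv_add1_cost rho'].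
Proof.
pose S := [set x | exists sigma rho, carries sigma rho /\ x = inv_add1_cost rho].
have carries0 : carries (mzero : {finite_measure set Z -> \bar R}) (cst 0%R).
  by split => // [A mA|B mB]; [exact: measure_ge0|rewrite integral0_eq].
have S0 x : S x -> 0 <= x by case=> sigma [rho [[_ _ _ r0 _] ->]]; exact: inv_add1_cost_ge0.
have Sinf0 : 0 <= ereal_inf S by exact: le_ereal_inf_tmp.
have Sfin : ereal_inf S \is a fin_num.
  rewrite ge0_fin_numE//; apply: le_lt_trans (_ : inv_add1_cost (cst 0%R) < +oo).
    by apply: ereal_inf_lbound; exists mzero, (cst 0%R).
  exact: inv_add1_cost_lty.
pose I := fine (ereal_inf S); have IE : ereal_inf S = I%:E by rewrite fineK.
have Imin sigma rho : carries sigma rho -> I%:E <= inv_add1_cost rho.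
  by move=> c; rewrite -IE; apply: ereal_inf_lbound; exists sigma, rho.
(* With these weights consecutive differences are bounded by a constant over [2 ^ n.+1], hence
   summable. *)
pose w n : R := (2 ^ n.+1)%:R.
have w0 n : (0 < w n)%R by rewrite ltr0n expn_gt0.
have /choice[sr hsr] n : exists sr : {finite_measure set Z -> \bar R} * (Y -> R),
    carries sr.1 sr.2 /\ inv_add1_cost sr.2 < (I + w n ^- 2)%:E.
  have wn0 : (0 < w n ^- 2)%R by rewrite invr_gt0 exprn_gt0.
  have [_ [sigma [rho [c ->]]]] := lb_ereal_inf_adherent wn0 Sfin.
  by rewrite IE => h; exists (sigma, rho).
pose sig n := (sr n).1; pose rho n := (sr n).2.
have cn n : carries (sig n) (rho n) by have [] := hsr n.
have mrho n : measurable_fun setT (rho n) by have [] := cn n.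
have rho0 n y : (0 <= rho n y)%R by have [] := cn n.
have wle n k : (n <= k)%N -> (w k ^- 2 <= w n ^- 2)%R.
  move=> nk; rewrite lef_pV2 ?posrE ?exprn_gt0// ler_pXn2r ?nnegrE ?(ltW (w0 _))//.
  by rewrite ler_nat leq_exp2l.
have cost n k : (n <= k)%N -> inv_add1_cost (rho k) <= (I + w n ^- 2)%:E.
  by move=> nk; have [_ /ltW h] := hsr k; apply: le_trans h _; rewrite lee_fin lerD2l wle.
have [N1 [mN1 N10 h1]] : {ae nu, forall y, cvgn (fun n => (1 + rho n y)^-1)%R}.
  apply: (@fast_L1_cauchy_ae_cvg _ _ _ nu _ (fine (nu setT) + 1)) => n.
    exact: measurable_inv_add1.
  by apply: inv_add1_cost_gap Imin (cn n) (cn n.+1) (w0 n) (cost _ _ _) (cost _ _ _).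
have [N2 [mN2 N20 h2]] : {ae nu, forall y, ~ ((rho n y)%:E @[n --> \oo] --> +oo)}.
  apply: (@bounded_integrals_ae_not_cvg_pinfty _ _ _ nu _ (mu setT)) => //.
    exact: finite_measure_lty.
  by move=> n; exact: carries_integral_le (cn n).
pose N := N1 `|` N2.
have mN : measurable N by exact: measurableU.
have N0 : nu N = 0 by apply: null_set_setU.
(* Off [N] the values [1 / (1 + rho n y)] converge and [rho n y] does not tend to [+oo], so the
   densities converge; setting them to 0 on [N] gives convergence everywhere. *)
pose rh n y := (rho n y * \1_(~` N) y)%R.
have rhE n y : ~ N y -> rh n y = rho n y by move=> Ny; rewrite /rh indicE mem_set ?mulr1.
have rhN n y : N y -> rh n y = 0%R.
  by move=> Ny; rewrite /rh indicE memNset ?mulr0//; exact.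
have mrh n : measurable_fun setT (rh n).
  by apply: measurable_funM => //; apply: measurable_indic; exact: measurableC.
have rh0 n y : (0 <= rh n y)%R by rewrite mulr_ge0.
have cv y : cvgn (rh ^~ y).
  have [Ny|Ny] := pselect (N y).
    by apply/cvg_ex; exists 0%R; under eq_fun do rewrite rhN//; exact: cvg_cst.
  under eq_fun do rewrite rhE//.
  apply: cvg_of_inv_add1 => //.
    by apply: contrapT => h; apply: Ny; left; exact: h1.
  by move=> h; apply: Ny; right; apply: h2 => /(_ h).
pose r y := lim (rh n y @[n --> \oo])%R.
have {}cv y : rh ^~ y @ \oo --> r y by exact: cv.
have mr : measurable_fun setT r by apply: (measurable_fun_cvg mrh) => y _; exact: cv.
have r0 y : (0 <= r y)%R by apply: limr_ge; [apply/cvg_ex; exists (r y)|exact: nearW].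
have costE n : inv_add1_cost (rh n) = inv_add1_cost (rho n).
  apply: ae_eq_integral => //.
  - by apply/measurable_EFinP; exact: measurable_inv_add1.
  - by apply/measurable_EFinP; exact: measurable_inv_add1.
  - by exists N; split => // y /= h; apply: contrapT => /(rhE n) e; apply: h; rewrite e.
exists sig, rh, r; split => //.
  by move=> n; apply: (carries_ae (cn n) mN N0) => // y; exact: rhE.
(* Fatou bounds the cost of the limit through the sequence shifted by [k], whose terms are all
   within [w k ^- 2 <= 2^-k] of the infimum. *)
move=> sigma rho' c; apply: le_trans (Imin _ _ c).
apply/lee_addgt0Pr => e e0; have [k ke] := half_pow_lt e0.
apply: (@ge0_limit_integral_le _ _ _ nu (fun n y => (1 + rh (n + k)%N y)^-1)%R).
- exact: measurableT.
- by move=> n; exact: measurable_inv_add1.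
- by move=> n y; case/andP: (inv_add1_itv (rh0 (n + k)%N y)).
- move=> y; apply: cvgV; first by rewrite gt_eqF// ltr_pwDl.
  apply: cvgD; first exact: cvg_cst.
  by have := cv y; rewrite -(cvg_shiftn k).
- move=> n; rewrite -/(inv_add1_cost (rh (n + k)%N)) costE -EFinD.
  apply: le_trans (cost k _ _) _; first exact: leq_addl.
  rewrite lee_fin lerD2l (le_trans _ (ltW ke))//.
  have h1' : (1 <= w k)%R by rewrite ler1n expn_gt0.
  apply: (@le_trans _ _ (w k)^-1)%R.
    by rewrite -exprVn expr2 ler_piMl ?invr_ge0 ?(ltW (w0 k))// invf_le1.
  rewrite exprVn lef_pV2 ?posrE ?exprn_gt0// /w natrX ler_weXn2l// ler1n//.
Qed.

End carried_densities.

(** * Ultralimits of truncated plans *)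

Lemma ultra_bounded_cvg (R : realType) (T : Type) (U : set_system T)
    (f : T -> R) (a b : R) : UltraFilter U -> (forall t, (a <= f t <= b)%R) ->
  cvg (f t @[t --> U]).
Proof.
move=> UU fab; have := @segment_compact R a b (f @ U) _ _.
case; first by apply: (@filterE _ U) => t; rewrite /= in_itv/= fab.
move=> l [_ lU]; apply/cvg_ex; exists l => A lA.
have [//|UA] := in_ultra_setVsetC (f @^-1` A) UU.
by have [x []] := lU (~` A) A UA lA.
Qed.

Section carried_limit.
Context dz dx dy (Z : measurableType dz) (X : measurableType dx)
  (Y : measurableType dy) (R : realType).
Variables (p : Z -> X) (q : Z -> Y) (E : set Z).
Hypotheses (mp : measurable_fun setT p) (mq : measurable_fun setT q)
  (mE : measurable E).
Variables (mu : {finite_measure set X -> \bar R})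
  (nu : {finite_measure set Y -> \bar R}).
Implicit Types (sigma : {finite_measure set Z -> \bar R}) (rho : Y -> R).

Let mqi A : measurable A -> measurable (q @^-1` A).
Proof. by move=> mA; rewrite -[X in measurable X]setTI; exact: mq. Qed.
Let mpi A : measurable A -> measurable (p @^-1` A).
Proof. by move=> mA; rewrite -[X in measurable X]setTI; exact: mp. Qed.

Definition charge_carries (la : set Z -> \bar R) rho :=
  [/\ [/\ la set0 = 0, forall A, 0 <= la A & forall A B, measurable A ->
        measurable B -> A `&` B = set0 -> la (A `|` B) = la A + la B],
      la (~` E) = 0,
      forall A, measurable A -> la (p @^-1` A) <= mu A &
      forall B, measurable B -> la (q @^-1` B) = \int[nu]_(y in B) (rho y)%:E].

(* Truncating [rho n] at its limit [r] keeps the marginals of the limit below a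
   finite measure, so that no mass concentrates on a null set. *)
Lemma ex_limit_charge (sig : nat -> {finite_measure set Z -> \bar R})
    (rho : nat -> Y -> R) (r : Y -> R) :
  (forall n, carries p q E mu nu (sig n) (rho n)) -> measurable_fun setT r ->
  (forall y, (0 <= r y)%R) -> (forall y, rho ^~ y @ \oo --> r y) ->
  exists la, charge_carries la r.
Proof.
move=> cn mr r0 cv.
have mrho n : measurable_fun setT (rho n) by have [] := cn n.
have rho0 n y : (0 <= rho n y)%R by have [] := cn n.
have rint : \int[nu]_y (r y)%:E < +oo.
  apply: (@le_lt_trans _ _ (mu setT)); last exact: finite_measure_lty.
  apply: (@ge0_limit_integral_le _ _ _ nu rho) => // n.
  exact: carries_integral_le (cn n).
pose k n y := Num.min (rho n y) (r y).
have mk n : measurable_fun setT (k n) by exact: measurable_minr.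
have k0 n y : (0 <= k n y)%R by rewrite le_min rho0 r0.
have kr n y : (k n y <= r y)%R by rewrite ge_min lexx orbT.
have cvk y : k ^~ y @ \oo --> r y.
  apply/cvgrPdist_lt => e e0; have /cvgrPdist_lt/(_ e e0) := cv y.
  apply: filterS => n /=; apply: le_lt_trans; rewrite /k.
  by have [h|h] := leP (rho n y) (r y); rewrite ?subrr ?normr0.
have kint n : \int[nu]_y (k n y)%:E < +oo.
  by apply: le_lt_trans rint; exact: le_int.
have /choice[sg hsg] n : exists sg : {finite_measure set Z -> \bar R},
    (forall A, measurable A -> sg A <= sig n A) /\
    forall B, measurable B -> sg (q @^-1` B) = \int[nu]_(y in B) (k n y)%:E.
  have [kappa kE] := ex_density_measure (mk n) (k0 n) (kint n).
  have [B mB|s [s1 s2]] := @ex_submeasure_with_marginal _ _ _ _ _ (sig n) q kappa mq.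
    have [_ _ _ _ ->//] := cn n; rewrite kE; apply: le_int => // y _.
    by rewrite ge_min lexx.
  by exists s; split => // B mB; rewrite s2.
have [U [UU oU]] := ultraFilterLemma (eventually_filter : ProperFilter \oo).
have sgfin n A : measurable A -> sg n A \is a fin_num by move=> mA; exact: fin_num_measure.
have sgmu n A : measurable A -> sg n (p @^-1` A) <= mu A.
  have [_ cp _ _ _] := cn n.
  by move=> mA; apply: le_trans (cp _ mA); apply: (hsg n).1; exact: mpi.
have cvU A : measurable A -> cvg (fine (sg n A) @[n --> U]).
  move=> mA; apply: (@ultra_bounded_cvg _ _ _ _ 0 (fine (mu setT))) => // n.
  rewrite fine_ge0//= fine_le ?sgfin ?fin_num_measure//.
  apply: le_trans (sgmu n setT measurableT); rewrite preimage_setT.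
  by apply: le_measure; rewrite ?inE.
(* Nonmeasurable sets get the value 0, so that [la] is nonnegative on every set. *)
pose la A : \bar R := if pselect (measurable A) then (lim (fine (sg n A) @[n --> U]))%:E else 0.
have laE A : measurable A -> la A = (lim (fine (sg n A) @[n --> U]))%:E.
  by move=> mA; rewrite /la; case: pselect.
have la_lim A l : measurable A -> fine (sg n A) @[n --> U] --> l -> la A = l%:E.
  by move=> mA h; rewrite laE//; congr EFin; apply: cvg_lim.
have la0 A : measurable A -> (forall n, sg n A = 0) -> la A = 0.
  move=> mA h; apply: la_lim => //; under eq_fun do rewrite h; exact: cvg_cst.
exists la; split.
- split; first by apply: la0 => // n; rewrite measure0.
  + move=> A; rewrite /la; case: pselect => // mA; rewrite lee_fin.
    apply: limr_ge; first exact: cvU.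
    by apply: filterE => n; rewrite fine_ge0.
  + move=> A B mA mB AB; rewrite (laE A)// (laE B)// -EFinD.
    apply: la_lim; first exact: measurableU.
    have -> : (fun n => fine (sg n (A `|` B))) = (fun n => fine (sg n A) + fine (sg n B))%R.
      by apply/funext => n; rewrite measureU//= fineD// sgfin.
    by apply: cvgD; exact: cvU.
- have mEC : measurable (~` E) by exact: measurableC.
  apply: la0 => // n; apply/eqP; rewrite eq_le measure_ge0 andbT.
  by apply: le_trans ((hsg n).1 _ mEC) _; have [-> _ _ _ _] := cn n.
- move=> A mA; rewrite laE; last exact: mpi.
  rewrite -[leRHS]fineK ?fin_num_measure// lee_fin.
  apply: limr_le; first by apply: cvU; exact: mpi.
  apply: filterE => n; rewrite fine_le ?fin_num_measure ?sgfin//; last exact: sgmu.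
  exact: mpi.
- move=> B mB.
  have fB : \int[nu]_(y in B) (r y)%:E \is a fin_num.
    rewrite ge0_fin_numE; last exact: int_ge0.
    apply: le_lt_trans rint; apply: ge0_subset_integral => //.
      exact/measurable_EFinP.
    by move=> y _; rewrite lee_fin.
  rewrite -[RHS]fineK//; apply: la_lim; first exact: mqi.
  (* Dominated convergence gives the limit along [\oo], which [U] refines; the dominating function
     [r] is what the truncation provides. *)
  have : fine (sg n (q @^-1` B)) @[n --> \oo] --> fine (\int[nu]_(y in B) (r y)%:E).
    apply: fine_cvg; rewrite fineK//.
    have -> : (fun n => sg n (q @^-1` B)) = (fun n => \int[nu]_(y in B) (k n y)%:E).
      by apply/funext => n; rewrite (hsg n).2.
    apply: (@dominated_cvg _ _ _ nu B mB (fun n y => (k n y)%:E) (EFin \o r) (EFin \o r)) => //.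
    + by move=> n; exact/measurable_funTS/measurable_EFinP.
    + by move=> y _; apply/fine_cvgP; split; [exact: nearW|exact: cvk].
    + apply/integrableP; split; first exact/measurable_funTS/measurable_EFinP.
      under eq_integral => y _ do rewrite /= ger0_norm//.
      by move: fB; rewrite ge0_fin_numE//; exact: int_ge0.
    + by move=> n y _; rewrite /= lee_fin ger0_norm.
  by apply: cvg_trans => A /oU.
Qed.

End carried_limit.

(** * Existence of minimisers *)

Section countable_additivity.
Context (R : realType) dz (Z : measurableType dz) (V W : ptopologicalType)
  (dV : V -> V -> R) (dW : W -> W -> R).
Hypotheses (dmV : metrizes dV) (dmW : metrizes dW).
Variables (p : Z -> borel V) (q : Z -> borel W) (E : set Z).
Hypotheses (mp : measurable_fun setT p) (mq : measurable_fun setT q)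
  (mE : measurable E).
Variables (mu : {finite_measure set (borel V) -> \bar R})
  (nu : {finite_measure set (borel W) -> \bar R}).

(** Regularity extends both marginal bounds from open to Borel sets. The second one is an equality
    because the total masses agree: a deficit on [B] would have to be made up on its complement. *)
Lemma ex_carries_of_charge (la : set Z -> \bar R) (r : W -> R)
    (s : {finite_measure set Z -> \bar R}) :
  charge_carries p q E mu nu la r -> measurable_fun [set: borel W] r ->
  (forall y, (0 <= r y)%R) -> \int[nu]_y (r y)%:E < +oo ->
  s (~` E) <= la (~` E) ->
  (forall G : set V, open G -> s (p @^-1` G) <= la (p @^-1` G)) ->
  (forall G : set W, open G -> s (q @^-1` G) <= la (q @^-1` G)) ->
  s setT = la setT -> carries p q E mu nu s r.
Proof.
move=> [_ laE lap laq] mr r0 rfin sE sp sq sT.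
have mqi A : measurable A -> measurable (q @^-1` A).
  by move=> mA; rewrite -[X in measurable X]setTI; exact: mq.
have mpi A : measurable A -> measurable (p @^-1` A).
  by move=> mA; rewrite -[X in measurable X]setTI; exact: mp.
have [rnu rnuE] := ex_density_measure mr r0 rfin.
have sle A : measurable A -> s (p @^-1` A) <= mu A.
  apply: (le_measure_of_open dmV (f := fun A => s (p @^-1` A))) => [A1 A2 m1 m2 A12|G oG].
    apply: le_measure; rewrite ?inE; [exact: mpi|exact: mpi|].
    exact: preimage_subset.
  by apply: le_trans (sp _ oG) _; apply: lap; exact: borel_open_measurable.
have sqle B : measurable B -> s (q @^-1` B) <= rnu B.
  apply: (le_measure_of_open dmW (f := fun A => s (q @^-1` A))) => [A1 A2 m1 m2 A12|G oG].
    apply: le_measure; rewrite ?inE; [exact: mqi|exact: mqi|].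
    exact: preimage_subset.
  by apply: le_trans (sq _ oG) _; rewrite rnuE laq//; exact: borel_open_measurable.
split => //.
  by apply/eqP; rewrite eq_le measure_ge0 andbT (le_trans sE)// laE.
move=> B mB; have mBC := measurableC mB.
rewrite -rnuE; apply/eqP; rewrite eq_le sqle//=.
have e1 : s (q @^-1` B) + s (q @^-1` (~` B)) = s setT.
  rewrite -measureU//; [|exact: mqi|exact: mqi|].
    by rewrite -preimage_setU setUv preimage_setT.
  by rewrite -preimage_setI setICr preimage_set0.
have e2 : rnu B + rnu (~` B) = rnu setT.
  by rewrite -measureU// ?setUv// setICr.
have e3 : s setT = rnu setT.
  by rewrite rnuE; apply: (etrans sT); rewrite -laq ?preimage_setT.
have tot : s (q @^-1` B) + s (q @^-1` (~` B)) = rnu B + rnu (~` B).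
  by apply: (etrans e1); apply: (etrans e3).
have fBC : s (q @^-1` (~` B)) \is a fin_num by rewrite fin_num_measure//; exact: mqi.
rewrite -(leeD2rE _ _ fBC) tot leeD2l//; exact: sqle.
Qed.

End countable_additivity.

(** * Completion of an optimal relaxed plan *)

Section completion.
Context dz dx dy (Z : measurableType dz) (X : measurableType dx)
  (Y : measurableType dy) (R : realType).
Variables (p : Z -> X) (q : Z -> Y) (E : set Z).
Hypotheses (mp : measurable_fun setT p) (mq : measurable_fun setT q)
  (mE : measurable E).
Variables (mu : {finite_measure set X -> \bar R})
  (nu : {finite_measure set Y -> \bar R}).
Implicit Types (pi sigma : {finite_measure set Z -> \bar R}) (rho : Y -> R).

Let mqi A : measurable A -> measurable (q @^-1` A).
Proof. by move=> mA; rewrite -[X in measurable X]setTI; exact: mq. Qed.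
Let mpi A : measurable A -> measurable (p @^-1` A).
Proof. by move=> mA; rewrite -[X in measurable X]setTI; exact: mp. Qed.

(** The part of [mu] not yet transported has density [1 - h]; pushing it forward by the section [s]
    of [p] keeps its first marginal and lands in [E] up to a null set. *)
Lemma ex_transport_above sigma (s : X -> Z) (G : set X) :
  measurable_fun setT s -> measurable G -> mu (~` G) = 0 ->
  (forall x, G x -> E (s x)) -> (forall x, p (s x) = x) ->
  sigma (~` E) = 0 -> (forall A, measurable A -> sigma (p @^-1` A) <= mu A) ->
  exists pi, transports p E mu pi /\ forall A, measurable A -> sigma A <= pi A.
Proof.
move=> ms mG muG sGE ps sE sp.
have [P PE] := ex_pushforward sigma mp.
have [|h [mh h01 hE]] := @ex_bounded_density _ _ _ P mu 1 ler01.
  by move=> A mA; rewrite mul1e PE; exact: sp.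
(* The factor 1 matches the form of [int_one_sub]. *)
have mh1 : measurable_fun setT (fun x => 1 - 1 * h x)%R.
  by apply: measurable_funB => //; exact: measurable_funM.
have h101 x : (0 <= 1 - 1 * h x <= 1)%R.
  by have /andP[h0 h1] := h01 x; rewrite mul1r subr_ge0 h1 lerBlDr lerDl.
have [kappa kE] := ex_density_measure mh1 (fun x => (andP (h101 x)).1)
  (int_bounded_lty mu mh1 h101).
have [tau tauE] := ex_pushforward kappa ms.
have fin : measure_add sigma tau setT < +oo.
  by rewrite measure_addE lte_add_pinfty// finite_measure_lty.
have [pi piE] := measure_finite_of fin.
have {}piE A : pi A = sigma A + tau A by rewrite piE; exact: measure_addE.
exists pi; split; last by move=> A mA; rewrite piE leeDl.
split.
  rewrite piE sE add0e tauE kE; apply: int_null => //.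
    by rewrite -[X in measurable X]setTI; apply: ms => //; exact: measurableC.
  apply: (subset_measure0 _ (measurableC mG)) => //.
    by rewrite -[X in measurable X]setTI; apply: ms => //; exact: measurableC.
  by move=> x /= nE Gx; apply: nE; exact: sGE.
move=> A mA; rewrite piE tauE.
have -> : s @^-1` (p @^-1` A) = A by apply/seteqP; split => x /=; rewrite ps.
rewrite kE (int_one_sub mu 1 mh h01 mA) -hE// mul1e PE.
by rewrite addeC subeK// fin_num_measure//; exact: mpi.
Qed.

Let theta (r : R) : \bar R := ((1 + r)^-1)%:E.

Lemma inv_add1_proper : proper_nneg theta.
Proof. by split => //; exists 0%R; split => //; rewrite ltry. Qed.

Lemma inv_add1_lsc : lsc_nneg theta.
Proof.
move=> t a t0; rewrite /theta lte_fin => at1.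
apply: (@cvg_within _ (nbhs t)).
have : (1 + x)^-1%R @[x --> t] --> (1 + t)^-1%R.
  apply: cvgV; first by rewrite gt_eqF// ltr_pwDl.
  by apply: cvgD; [exact: cvg_cst|exact: cvg_id].
move=> /(@cvgr_gt _ _ _) /(_ a at1); apply: filterS => x.
by rewrite lte_fin.
Qed.

Lemma inv_add1_strictly_convex_on_dom : strictly_convex_on_dom theta.
Proof.
have dom (a : R) : (0 <= a)%R -> edom theta a by move=> a0; split => //; rewrite ltry.
split=> a b w [a0 _] [b0 _].
  move=> /andP[w0 w1]; apply: dom; rewrite addr_ge0// mulr_ge0// ?subr_ge0 ltW//.
move=> /eqP ab w01; rewrite /theta -!EFinM -EFinD lte_fin.
exact: inv_add1_strictly_convex.
Qed.

Lemma inv_add1_recession : recession theta = 0.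
Proof.
rewrite /recession; apply/cvg_lim => //.
have cinv (f : R -> R) : f @ +oo%R --> +oo%R -> ((f t)^-1)%R @[t --> +oo%R] --> 0%R.
  by move=> foo; apply/gtr0_cvgV0 => //; move/cvgryPgt : foo => /(_ 0%R).
have -> : (fun t => theta t * (t^-1)%:E) = EFin \o (fun t => (1 + t)^-1 * t^-1)%R by [].
apply: cvg_EFin; first exact: nearW.
rewrite -[X in _ --> X](mulr0 0%R); apply: cvgM; last exact: (cinv id).
apply: cinv.
apply/cvgryPge => A; near=> t.
have : (A <= t)%R by near: t; apply: nbhs_pinfty_ge; exact: num_real.
by move=> h; rewrite (le_trans h)// lerDr.
Unshelve. all: by end_near. Qed.

Lemma inv_add1_divergence (P' : set Y -> \bar R) (P : {finite_measure set Y -> \bar R}) r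
    (Pp : {finite_measure set Y -> \bar R}) :
  (forall A, measurable A -> P' A = P A) ->
  is_lebesgue_decomposition P nu r Pp ->
  divergence theta P' nu = inv_add1_cost nu r.
Proof.
move=> PE rP; rewrite (divergence_eq inv_add1_lsc PE rP) inv_add1_recession.
by rewrite mul0e adde0.
Qed.

(** Restricting a transport to the preimage of the complement of [N] removes the singular part of
    its second marginal, which yields a relaxed competitor with the same density. *)
Lemma carries_le_divergence rho pi :
  (forall sigma rho', carries p q E mu nu sigma rho' ->
     inv_add1_cost nu rho <= inv_add1_cost nu rho') ->
  transports p E mu pi ->
  inv_add1_cost nu rho <= divergence theta (pushforward pi q) nu.
Proof.
move=> rhomin [piE pimu]; have [P PE] := ex_pushforward pi mq.
have [r [Pp [N [rP mN nuN PpN rN]]]] := ex_clean_decomposition P nu.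
rewrite (inv_add1_divergence _ rP); last by move=> A _; exact/esym/PE.
have [mr r0 _ PrE] := rP; have mNC := measurableC mN.
have mqN := mqi mNC.
apply: (rhomin (mrestr pi mqN : {finite_measure set Z -> \bar R})).
have le A : measurable A -> mrestr pi mqN A <= pi A.
  by move=> mA; apply: le_measure; rewrite ?inE//; exact: measurableI.
split => //.
- apply/eqP; rewrite eq_le measure_ge0 andbT -piE; apply: le; exact: measurableC.
- by move=> A mA; rewrite -pimu//; apply: le; exact: mpi.
- move=> B mB; apply: (@etrans _ _ (P (B `&` ~` N))); first by rewrite PE preimage_setI.
  rewrite PrE; last exact: measurableI.
  rewrite [X in _ + X](_ : _ = 0) ?adde0; last first.
    by apply: (subset_measure0 _ mNC) => //; exact: measurableI.
  rewrite [RHS](@int_setU _ _ _ nu B (~` N))//.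
  by rewrite [X in _ = _ + X]integral0_eq ?adde0// => y [_ /contrapT /rN ->].
Qed.

(** Adding mass can only raise the density, and [1 / (1 + x)] is decreasing. The set [B] where the
    density of [pi] would be smaller than [rho] is null, as the integral of [rho] over it is at most
    that of [r]. *)
Lemma divergence_le_cost sigma rho pi : carries p q E mu nu sigma rho ->
  (forall A, measurable A -> sigma A <= pi A) ->
  divergence theta (pushforward pi q) nu <= inv_add1_cost nu rho.
Proof.
move=> cs sp; have [P PE] := ex_pushforward pi mq.
have [r [Pp [N [rP mN nuN PpN rN]]]] := ex_clean_decomposition P nu.
rewrite (inv_add1_divergence _ rP); last by move=> A _; exact/esym/PE.
have [mr r0 _ PrE] := rP; have mNC := measurableC mN.
have [_ _ mrho rho0 sq] := cs.
pose B := [set y | (r y < rho y)%R] `\` N.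
have mB : measurable B.
  by apply: measurableD => //; rewrite -[X in measurable X]setTI; exact: measurable_fun_ltr.
pose dl y := Num.max (rho y - r y)%R 0%R.
have mdl : measurable_fun setT dl by apply: measurable_maxr => //; exact: measurable_funB.
have dl0 y : (0 <= dl y)%R by rewrite le_max lexx orbT.
have le : \int[nu]_(y in B) (rho y)%:E <= \int[nu]_(y in B) (r y)%:E.
  rewrite -sq//; apply: le_trans (sp _ (mqi mB)) _; rewrite -PE PrE//.
  rewrite [X in _ + X](_ : _ = 0) ?adde0//.
  by apply: (subset_measure0 _ mNC) => // y [].
have nuB : nu B = 0.
  apply: (int_pos_eq0 (f := dl)) => //.
    by move=> y [/= ry _]; rewrite /dl lt_max subr_gt0 ry.
  have e : \int[nu]_(y in B) (rho y)%:E =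
      \int[nu]_(y in B) (r y)%:E + \int[nu]_(y in B) (dl y)%:E.
    rewrite -int_add//; apply: eq_integral => y; rewrite inE => -[/= ry _].
    by rewrite /dl max_l ?subr_ge0 ?ltW// addrC subrK.
  have rfin : \int[nu]_(y in B) (r y)%:E \is a fin_num.
    rewrite ge0_fin_numE; last exact: int_ge0.
    by apply: le_lt_trans (lebesgue_decomposition_int_le rP mB) _; exact: finite_measure_lty.
  by apply/eqP; rewrite eq_le int_ge0// andbT; move: le; rewrite e -{2}[\int[nu]_(y in B) (r y)%:E]adde0 leeD2lE.
apply: ae_ge0_le_integral => //.
- by move=> y _; rewrite lee_fin; case/andP: (inv_add1_itv (r0 y)).
- by apply/measurable_EFinP; exact: measurable_inv_add1.
- by move=> y _; rewrite lee_fin; case/andP: (inv_add1_itv (rho0 y)).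
- by apply/measurable_EFinP; exact: measurable_inv_add1.
exists (B `|` N); split; [exact: measurableU|exact: null_set_setU|].
move=> y /= h; apply: contrapT => /not_orP[nB nN]; apply: h => _.
rewrite lee_fin lef_pV2 ?posrE ?ltr_pwDl// lerD2l leNgt; apply/negP => ry.
by apply: nB.
Qed.

(** The two preceding bounds make [pi] a minimiser of the divergence among all transports, so the
    exchange argument applies to it. *)
Lemma ex_minimizing_transport sigma rho pi :
  carries p q E mu nu sigma rho ->
  (forall sigma rho', carries p q E mu nu sigma rho' ->
     inv_add1_cost nu rho <= inv_add1_cost nu rho') ->
  (forall A, measurable A -> sigma A <= pi A) ->
  transports p E mu pi -> forall t sg, (0 < t)%R ->
  level_feasible p q E mu nu t sg ->
  sg setT <= \int[nu]_y (Num.min (density (pushforward pi q) nu y) t)%:E.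
Proof.
move=> cs rhomin sp pitr t sg t0 sgf.
have Dle := divergence_le_cost cs sp; have [_ _ mrho rho0 _] := cs.
apply: (minimizer_level_ge mp mq mE inv_add1_proper inv_add1_lsc
  inv_add1_strictly_convex_on_dom pitr _ _ t0 sgf).
  by move=> pi' tr'; apply: le_trans Dle _; exact: carries_le_divergence.
by apply: le_lt_trans Dle _; exact: inv_add1_cost_lty.
Qed.

End completion.

(** * The two sides of a pair of Polish spaces *)

Section polish_pair.
Context (R : realType) (Omega : bool -> ptopologicalType).
Hypothesis hPolish : forall i : bool, polish R (Omega i).
Variable E : set (Omega false * Omega true)%type.
Hypotheses (hEclosed : closed E) (hN1 : forall x : Omega false, xsection E x !=set0)
  (hN0 : forall y : Omega true, ysection E y !=set0).
Variable nu : forall i : bool, {finite_measure set (borel (Omega i)) -> \bar R}.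
Implicit Type i : bool.
Local Notation Mplus := {finite_measure set (prodspace Omega) -> \bar R}.

Lemma measurable_pr i : measurable_fun setT (pr i : prodspace Omega -> borel (Omega i)).
Proof. by case: i; [exact: measurable_snd|exact: measurable_fst]. Qed.

Lemma open_measurable_pair (G : set (Omega false * Omega true)) :
  open G -> measurable (G : set (prodspace Omega)).
Proof.
have [d [y cs]] := polish_complete_separable (hPolish false).
have [d' [y' cs']] := polish_complete_separable (hPolish true).
exact: open_prod_measurable cs cs' _.
Qed.

Lemma measurable_graph : measurable (E : set (prodspace Omega)).
Proof.
rewrite -[E]setCK; apply: measurableC; apply: open_measurable_pair.
by rewrite openC.
Qed.

Lemma open_preimage_pr i (G : set (Omega i)) :
  open G -> open ((pr i : prodspace Omega -> borel (Omega i)) @^-1` G :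
                  set (Omega false * Omega true)).
Proof.
by case: i G => G oG; apply: open_comp oG => z _; [exact: cvg_snd|exact: cvg_fst].
Qed.

Lemma ex_pair_measure_below i (la : set (prodspace Omega) -> \bar R)
    (a : {finite_measure set (borel (Omega i)) -> \bar R})
    (b : {finite_measure set (borel (Omega (~~ i))) -> \bar R}) :
  la set0 = 0 -> (forall A, 0 <= la A) ->
  (forall A B, measurable A -> measurable B -> A `&` B = set0 ->
     la (A `|` B) = la A + la B) ->
  (forall A, measurable A -> la (pr i @^-1` A) <= a A) ->
  (forall A, measurable A -> la (pr (~~ i) @^-1` A) <= b A) ->
  exists s : Mplus, (forall G : set (Omega false * Omega true), open G -> s G <= la G) /\
    s setT = la setT.
Proof.
have [d [y cs]] := polish_complete_separable (hPolish false).
have [d' [y' cs']] := polish_complete_separable (hPolish true).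
(* For [i = true] the two marginal bounds trade places. *)
case: i a b => a b la0 la_ge0 laU laa lab.
- by apply: (ex_measure_below cs cs' la0 _ laU lab laa) => A _; exact: la_ge0.
- by apply: (ex_measure_below cs cs' la0 _ laU laa lab) => A _; exact: la_ge0.
Qed.

Lemma ex_graph_selection i : exists (s : borel (Omega i) -> prodspace Omega) G,
  [/\ measurable_fun setT s, measurable G, nu i (~` G) = 0,
      forall x, G x -> E (s x) & forall x, pr i (s x) = x].
Proof.
have [d [y [dm dc yd]]] := polish_complete_separable (hPolish false).
have [d' [y' [dm' dc' yd']]] := polish_complete_separable (hPolish true).
case: i.
(* This side is handled by transposing the graph. *)
- pose E' := [set yx : Omega true * Omega false | E (yx.2, yx.1)].
  have cE' : closed E'.
    apply: (@closed_comp _ _ (fun yx : Omega true * Omega false => (yx.2, yx.1))) => // z _.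
    by apply: cvg_pair; [exact: cvg_snd|exact: cvg_fst].
  have [z|g [G [mg mG G0 gG]]] := @ex_ae_selection _ _ _ d' d dm' dm dc y yd E' cE' _ (nu true).
    by have [x] := hN0 z; rewrite /ysection/= inE; exists x.
  exists (fun y => (g y, y)), G; split => //.
  exact: measurable_fun_pair.
- have [z|g [G [mg mG G0 gG]]] := @ex_ae_selection _ _ _ d d' dm dm' dc' y' yd' E hEclosed _ (nu false).
    by have [x] := hN1 z; rewrite /xsection/= inE; exists x.
  exists (fun x => (x, g x)), G; split => //.
  exact: measurable_fun_pair.
Qed.

(** The limit density [r] of a minimising sequence has minimal cost, but the ultralimit charge
    carries it only in a finitely additive way; [s] is the measure that replaces this charge. *)
Lemma ex_optimal_carried i : exists (s : Mplus) (r : Omega (~~ i) -> R),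
  carries (pr i) (pr (~~ i)) E (nu i) (nu (~~ i)) s r /\
  forall s' r', carries (pr i) (pr (~~ i)) E (nu i) (nu (~~ i)) s' r' ->
    inv_add1_cost (nu (~~ i)) r <= inv_add1_cost (nu (~~ i)) r'.
Proof.
have [sig [rho [r [cn mr r0 cv rmin]]]] := @ex_minimizing_sequence
  _ _ _ _ _ _ _ (@pr Omega i) (@pr Omega (~~ i)) E (nu i) (nu (~~ i)).
have [la lac] := ex_limit_charge (@measurable_pr i) (@measurable_pr (~~ i)) measurable_graph cn mr r0 cv.
have [[la0 la_ge0 laU] laE lap laq] := lac.
have rfin : \int[nu (~~ i)]_y (r y)%:E < +oo.
  rewrite -laq// preimage_setT -(@preimage_setT _ _ (pr i)).
  by apply: le_lt_trans (lap _ measurableT) _; exact: finite_measure_lty.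
have [rnu rnuE] := ex_density_measure mr r0 rfin.
have [|s [sla sT]] := ex_pair_measure_below la0 la_ge0 laU lap (b := rnu).
  by move=> B mB; rewrite laq// rnuE.
have [dV [_ [dmV _ _]]] := polish_complete_separable (hPolish i).
have [dW [_ [dmW _ _]]] := polish_complete_separable (hPolish (~~ i)).
exists s, r; split => //.
apply: (ex_carries_of_charge dmV dmW (@measurable_pr i) (@measurable_pr (~~ i)) lac) => //.
- by apply: sla; rewrite openC.
- by move=> G oG; apply: sla; exact: open_preimage_pr.
- by move=> G oG; apply: sla; exact: open_preimage_pr.
Qed.

Lemma level_optimal_of_ge i (pi : Mplus) : refinement E nu i pi ->
  (forall t s, (0 < t)%R -> feas E nu i t s ->
    s setT <= \int[nu (~~ i)]_y (Num.min (density (payload i pi) (nu (~~ i)) y) t)%:E) ->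
  level_optimal_maximin E nu i pi.
Proof.
move=> pir ge t t0; apply/eqP; rewrite eq_le; apply/andP; split.
  exact: (level_integral_le (@measurable_pr i) (@measurable_pr (~~ i)) measurable_graph (nu (~~ i)) pir t0).
by apply: ge_ereal_sup => _ [s sf <-]; exact: ge.
Qed.

End polish_pair.

Theorem theorem6p2 (R : realType) (Omega : bool -> ptopologicalType)
    (hPolish : forall i : bool, polish R (Omega i))
    (E : set (Omega false * Omega true)%type)
    (hEclosed : closed E)
    (hN1 : forall x : Omega false, xsection E x !=set0)
    (hN0 : forall y : Omega true, ysection E y !=set0)
    (nu : forall i : bool, {finite_measure set (borel (Omega i)) -> \bar R})
    (hnu : forall i : bool, nu i setT != 0)
    (i : bool) :
  (forall theta : R -> \bar R,
     proper_nneg theta -> lsc_nneg theta -> strictly_convex_on_dom theta ->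
     forall pistar : {finite_measure set (prodspace Omega) -> \bar R},
       refinement E nu i pistar ->
       divergence theta (payload i pistar) (nu (~~ i)) =
         ereal_inf [set divergence theta (payload i pi) (nu (~~ i))
                   | pi in refinement E nu i] ->
       divergence theta (payload i pistar) (nu (~~ i)) < +oo ->
       level_optimal_maximin E nu i pistar) /\
  (exists2 pi : {finite_measure set (prodspace Omega) -> \bar R},
     refinement E nu i pi & level_optimal_maximin E nu i pi).
Proof.
have mp := @measurable_pr Omega i; have mq := @measurable_pr Omega (~~ i).
have mE := measurable_graph hPolish hEclosed.
split=> [theta tprop tlsc tconv pistar pir Dmin Dfin|].
  apply: level_optimal_of_ge => // t s t0.
  apply: (minimizer_level_ge mp mq mE tprop tlsc tconv pir _ Dfin t0) => pi' pi'r.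
  by rewrite [leLHS]Dmin; apply: ereal_inf_lbound; exists pi'.
(* No [theta] is given for this half: the relaxed optimum [s] for [1 / (1 + x)] is completed along
   the selection [g]. *)
have [s [r [cs rmin]]] := ex_optimal_carried hPolish hEclosed nu i.
have [g [G [mg mG G0 gG pg]]] := ex_graph_selection hPolish hEclosed hN1 hN0 nu i.
have [sE sp _ _ _] := cs.
have [pi [pitr spi]] := ex_transport_above mp mE mg mG G0 gG pg sE sp.
exists pi => //; apply: level_optimal_of_ge => // t sg t0 sgf.
exact: (ex_minimizing_transport mp mq mE cs rmin spi pitr t0 sgf).
Qed.
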